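(* Let $k\ge3$ be an integer and let $\varepsilon>0$. There exists $\Delta_0\in\mathbb{N}$ such that for every $\Delta\ge\Delta_0$, every $k$-uniform linear hypergraph $\mathcal{H}$ of maximum degree at most $\Delta$ satisfies $$\chi(\mathcal{H})\le(1+\varepsilon)\left(\frac{(4k-5)(k-1)}{k-2}\,\frac{\Delta}{\log\Delta}\right)^{\frac{1}{k-1}}.$$
   Context: A hypergraph is a pair $(V,E)$ with $V$ a finite set and $E\subseteq 2^V$; it is $k$-uniform if every edge has exactly $k$ elements, and linear if any two distinct edges share at most one vertex. The degree of a vertex is the number of edges containing it. The chromatic number $\chi(\mathcal{H})$ is the minimum number of colors in a coloring of the vertices with no monochromatic edge. $\log$ is the natural logarithm. *)

(* Defs.v *)
From mathcomp Require Import all_boot.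

Set Implicit Arguments.
Unset Strict Implicit.
Unset Printing Implicit Defensive.

(* A hypergraph on the finite vertex type V is given by its edge set
   E : {set {set V}}. *)

Definition uniform (V : finType) (k : nat) (E : {set {set V}}) : Prop :=
  forall e : {set V}, e \in E -> #|e| = k.

Definition linear_hypergraph (V : finType) (E : {set {set V}}) : Prop :=
  forall e f : {set V}, e \in E -> f \in E -> e != f -> #|e :&: f| <= 1.

Definition degree (V : finType) (E : {set {set V}}) (v : V) : nat :=
  #|[set e in E | v \in e]|.

Definition max_degree (V : finType) (E : {set {set V}}) : nat :=
  \max_(v : V) degree E v.

Definition monochromatic (V C : finType) (c : {ffun V -> C}) (e : {set V}) :
    bool :=
  [forall x in e, forall y in e, c x == c y].

Definition proper_coloring (V C : finType) (E : {set {set V}})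
    (c : {ffun V -> C}) : bool :=
  [forall e in E, ~~ monochromatic c e].

Definition colorable (V : finType) (E : {set {set V}}) (q : nat) : bool :=
  [exists c : {ffun V -> 'I_q}, proper_coloring E c].

(* The search is restricted to q <= #|V|, which loses nothing when every edge
   has at least two vertices: an injective coloring is then proper.  A
   hypergraph with an edge of size at most 1 has no proper coloring at all, and
   the value is then the junk value #|V|. *)
Definition chromatic_number (V : finType) (E : {set {set V}}) : nat :=
  [arg min_(q < ord_max : 'I_#|V|.+1 | colorable E q) q].

Lemma chromatic_numberP (V : finType) (E : {set {set V}}) :
  (forall e : {set V}, e \in E -> 2 <= #|e|) ->
  colorable E (chromatic_number E) /\
  (forall q : nat, colorable E q -> chromatic_number E <= q).
Proof.
move=> E2.
have colV : colorable E (@ord_max #|V|).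
  apply/existsP; exists [ffun v => enum_rank v].
  apply/forall_inP => e /E2 /card_gt1P [x [y [xe ye xy]]].
  apply/negP => /forall_inP /(_ x xe) /forall_inP /(_ y ye).
  by rewrite !ffunE => /eqP /enum_rank_inj xyE; rewrite xyE eqxx in xy.
rewrite /chromatic_number.
case: arg_minnP => //= i coli mini; split=> // q colq.
have [qV|Vq] := ltnP q #|V|.+1; first exact: (mini (Ordinal qV)).
exact: leq_trans (ltnW (ltn_ord i)) Vq.
Qed.

(* Main.v *)
(* The colouring is built in batches, each of which replaces the maximum degree D
by at most tau^(k-1) D with tau = 1 - eta + O(eta^2).

A batch uses m = eta / p independent colours.  The class of each colour is a random
independent set produced by a local nibble: in round i an available vertex is
proposed with probability pi_i, every proposed vertex is selected, a vertex v is
discarded as soon as e - v is selected for some edge e at v, and an equalizing coin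
brings the probability of surviving a round down to kappa.  By a correlation
inequality, a set S is available and a set Z is selected after i rounds with
probability at most about kappa^(i |S|) x_i^|Z|, where x_i is the sum of the
pi_j kappa^j for j < i.  The error terms come from pairs of edges sharing a vertex
outside S; they are of order D x^(2k-3) kappa^(-i(4k-6)), a negative power of D as
long as D x^(k-1) <= alpha ln D, where alpha (4k-5)(k-1) = k-2.  Running the nibble
up to that point puts a vertex into a class with probability p close to
(alpha ln D / D)^(1/(k-1)), and two given vertices with probability at most
(x / kappa^n)^2.

Hence m colours leave any fixed set of edges at v uncovered with probability about
exp(-eta (k-1)) per edge, and a factorial moment of order ln(D)^3 shows that the
uncovered degree of v exceeds tau^(k-1) D with probability exp(-c ln(D)^3).  The
event depends on a ball of radius O(ln D) around v, so the Lovasz local lemma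
applies.  Summing the sizes of the batches over geometrically decreasing degrees
gives (1 + O(eta)) (Delta / (alpha ln Delta))^(1/(k-1)) colours, and once the degree
is below Delta^(1 - eta) a uniformly random colouring takes care of the rest with
negligibly many colours. *)

Require Import Defs.
From mathcomp Require Import all_boot all_order all_algebra.
From mathcomp Require Import ring lra zify.

Set Implicit Arguments.
Unset Strict Implicit.
Unset Printing Implicit Defensive.

Import Order.TTheory GRing.Theory Num.Theory.
Local Open Scope ring_scope.

(** * Product measures *)

(** The induction over the rounds does not close at a fixed size of [(S, Z)]: two edges at different
    vertices of [S] that share a vertex bring in 2k-3 further vertices, so a bound for n vertices
    calls on one for n+2k-3. The bound therefore carries a factor that grows by at most M^2 per
    extra vertex, where M is the inverse of the final availability, and that is so generous for
    large sets that a crude estimate suffices there. This is the source of 4k-6 = 2(2k-3). Put u =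
    alpha ln D. Up to logarithms M is e^u and x^(k-2) is e^(-u(4k-5)), so D x^(2k-3) M^(4k-6) is
    about e^(-u): this single spare factor has to pay for every loss in the estimate. In the
    opposite direction two facts suffice: a vertex rarely enters a round with a survival probability
    already below kappa, and it is rarely proposed twice. All probability spaces are finite. The
    equalizing coin is a uniform value compared with a rounded threshold, and conditioning on the
    past is replaced by resampling the other coordinates. *)

Section ProductMeasure.
Variables (R : realFieldType) (I T : finType) (w : I -> T -> R).
Hypothesis w_ge0 : forall i t, 0 <= w i t.
Hypothesis w_sum1 : forall i, \sum_t w i t = 1.

Implicit Types (f g : {ffun I -> T} -> R) (om : {ffun I -> T}) (J : {set I}).

Definition weight om : R := \prod_i w i (om i).
Definition Ex f : R := \sum_om weight om * f om.

Definition depends_on (U : Type) J (f : {ffun I -> T} -> U) : Prop :=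
  forall om om', (forall i, i \in J -> om i = om' i) -> f om = f om'.

(** Resampling outside [J]: averaging over [om'] stands in for the conditional expectation given the
    coordinates in [J]. *)
Definition merge J om om' : {ffun I -> T} :=
  [ffun i => if i \in J then om i else om' i].

Lemma weight_ge0 om : 0 <= weight om.
Proof. exact: prodr_ge0. Qed.

Lemma Ex_prod (h : I -> T -> R) :
  Ex (fun om => \prod_i h i (om i)) = \prod_i \sum_t w i t * h i t.
Proof.
rewrite bigA_distr_bigA; apply: eq_bigr => om _.
by rewrite /weight big_split.
Qed.

Lemma Ex_cst c : Ex (fun=> c) = c.
Proof.
transitivity (c * Ex (fun om => \prod_i (fun _ _ => 1) i (om i))).
  by rewrite mulr_sumr; apply: eq_bigr => om _; rewrite big1 ?mulr1 1?mulrC.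
rewrite (Ex_prod (fun _ _ => 1)) big1 ?mulr1 // => i _; rewrite -[RHS](w_sum1 i).
by apply: eq_bigr => t _; rewrite mulr1.
Qed.

Lemma eq_Ex f g : f =1 g -> Ex f = Ex g.
Proof. by move=> fg; apply: eq_bigr => om _; rewrite fg. Qed.

Lemma Ex_le f g : (forall om, f om <= g om) -> Ex f <= Ex g.
Proof. by move=> fg; apply: ler_sum => om _; rewrite ler_wpM2l ?weight_ge0. Qed.

Lemma Ex_ge0 f : (forall om, 0 <= f om) -> 0 <= Ex f.
Proof. by move=> f0; apply: sumr_ge0 => om _; rewrite mulr_ge0 ?weight_ge0. Qed.

Lemma ExD f g : Ex (fun om => f om + g om) = Ex f + Ex g.
Proof. by rewrite -big_split; apply: eq_bigr => om _; rewrite mulrDr. Qed.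

Lemma ExB f g : Ex (fun om => f om - g om) = Ex f - Ex g.
Proof. by rewrite -sumrB; apply: eq_bigr => om _; rewrite mulrBr. Qed.

Lemma ExZ c f : Ex (fun om => c * f om) = c * Ex f.
Proof. by rewrite mulr_sumr; apply: eq_bigr => om _; rewrite mulrCA. Qed.

Lemma ExZr c f : Ex (fun om => f om * c) = Ex f * c.
Proof. by rewrite mulr_suml; apply: eq_bigr => om _; rewrite mulrA. Qed.

Lemma Ex_sum (K : Type) (s : seq K) (P : pred K) (F : K -> {ffun I -> T} -> R) :
  Ex (fun om => \sum_(j <- s | P j) F j om) = \sum_(j <- s | P j) Ex (F j).
Proof.
rewrite /Ex [RHS]exchange_big /=.
by apply: eq_bigr => om _; rewrite mulr_sumr.
Qed.

Lemma Ex_exists_pos f : 0 < Ex f -> exists om, 0 < f om.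
Proof.
move=> f_gt0; apply/existsP; apply: contraTT f_gt0 => /existsPn f_le0.
rewrite -leNgt -[leRHS](Ex_cst 0); apply: Ex_le => om.
by rewrite leNgt f_le0.
Qed.

(* The map (om, om') |-> (merge J om om', merge J om' om) is an involution
   that preserves the product measure on pairs. *)
Lemma Ex_merge J f : Ex f = Ex (fun om => Ex (fun om' => f (merge J om om'))).
Proof.
pose sw (p : {ffun I -> T} * {ffun I -> T}) := (merge J p.1 p.2, merge J p.2 p.1).
have swK : involutive sw.
  move=> [a b]; rewrite /sw /=; congr pair; apply/ffunP => i; rewrite !ffunE;
  by case: (i \in J).
have W p : weight (sw p).1 * weight (sw p).2 = weight p.1 * weight p.2.
  rewrite /weight -!big_split; apply: eq_bigr => i _; rewrite !ffunE.
  by case: (i \in J) => //=; exact: mulrC.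
transitivity (\sum_p weight p.1 * weight p.2 * f p.1).
  rewrite -(pair_bigA _ (fun a b => weight a * weight b * f a)) /=.
  apply: eq_bigr => a _; under eq_bigr do rewrite mulrAC.
  rewrite -mulr_sumr -[LHS]mulr1; congr (_ * _).
  by rewrite -[LHS](Ex_cst 1); apply: eq_bigr => b _; rewrite mulr1.
rewrite (reindex_inj (inv_inj swK)) /=.
under eq_bigr do rewrite W.
rewrite -(pair_bigA _ (fun a b => weight a * weight b * f (merge J a b))) /=.
apply: eq_bigr => a _; rewrite mulr_sumr; apply: eq_bigr => b _.
by rewrite mulrA.
Qed.

Lemma Ex_indep J1 J2 f g : depends_on J1 f -> depends_on J2 g ->
  [disjoint J1 & J2] -> Ex (fun om => f om * g om) = Ex f * Ex g.
Proof.
move=> df dg dJ; rewrite (Ex_merge J1) -ExZr; apply: eq_Ex => om.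
rewrite -ExZ; apply: eq_Ex => om'; congr (_ * _).
  by apply: df => i iJ; rewrite ffunE iJ.
apply: dg => i iJ; rewrite ffunE ifN //.
by apply: contraTN iJ => iJ; rewrite (disjointFr dJ iJ).
Qed.

Lemma Ex_indep_prod (K : eqType) (s : seq K) (J : K -> {set I})
    (F : K -> {ffun I -> T} -> R) :
  uniq s -> (forall j, depends_on (J j) (F j)) ->
  {in s &, forall j j', j != j' -> [disjoint J j & J j']} ->
  Ex (fun om => \prod_(j <- s) F j om) = \prod_(j <- s) Ex (F j).
Proof.
move=> us dF; elim: s us => [|j s IHs] /=.
  by rewrite big_nil -[RHS](Ex_cst 1); move=> _ _; apply: eq_Ex => om; rewrite big_nil.
move=> /andP[js us] dJ; rewrite big_cons -IHs //; last first.
  by move=> a b as_ bs; apply: dJ; rewrite inE ?as_ ?bs orbT.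
have -> : Ex (fun om => \prod_(a <- j :: s) F a om) =
          Ex (fun om => F j om * \prod_(a <- s) F a om).
  by apply: eq_Ex => om; rewrite big_cons.
pose Js := \big[@setU I/set0]_(a <- s) J a.
have sJs a : a \in s -> J a \subset Js.
  by move=> a_s; rewrite /Js (big_rem a) //= subsetUl.
apply: (@Ex_indep (J j) Js) => //.
  move=> om om' e; apply: eq_big_seq => a a_s; apply: dF => i /(subsetP (sJs _ a_s)).
  exact: e.
rewrite /Js.
have : {in s, forall a, [disjoint J j & J a]}.
  move=> a a_s; apply: dJ; rewrite ?inE ?eqxx ?a_s ?orbT //.
  by apply: contraNneq js => ->.
elim: (s) => [|b s' IH] H; first by rewrite big_nil -setI_eq0 setI0.
rewrite big_cons -setI_eq0 setIUr setU_eq0 !setI_eq0 H ?inE ?eqxx //=.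
by apply: IH => a a_s; apply: H; rewrite inE a_s orbT.
Qed.

Definition Pr (A : {ffun I -> T} -> bool) : R := Ex (fun om => (A om)%:R).

Implicit Types (A B : {ffun I -> T} -> bool).

Lemma Pr_ge0 A : 0 <= Pr A.
Proof. by apply: Ex_ge0 => om; rewrite ler0n. Qed.

Lemma Pr_le A B : (forall om, A om -> B om) -> Pr A <= Pr B.
Proof.
move=> AB; apply: Ex_le => om; rewrite ler_nat.
by have := AB om; case: (A om) => // ->.
Qed.

Lemma Pr_le1 A : Pr A <= 1.
Proof. by rewrite -[leRHS](Ex_cst 1); apply: Ex_le => om; rewrite lern1 leq_b1. Qed.

Lemma eq_Pr A B : A =1 B -> Pr A = Pr B.
Proof. by move=> AB; apply: eq_Ex => om; rewrite AB. Qed.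

Lemma Pr_indep J1 J2 A B : depends_on J1 A -> depends_on J2 B ->
  [disjoint J1 & J2] -> Pr (fun om => A om && B om) = Pr A * Pr B.
Proof.
move=> dA dB dJ; rewrite -(@Ex_indep J1 J2) => //.
- by apply: eq_Ex => om; rewrite -mulnb natrM.
- by move=> om om' /dA ->.
- by move=> om om' /dB ->.
Qed.

Lemma Pr_splitC A B : Pr A = Pr (fun om => A om && B om) + Pr (fun om => A om && ~~ B om).
Proof.
rewrite -ExD; apply: eq_Ex => om.
by case: (A om); case: (B om); rewrite /= ?addr0 ?add0r.
Qed.

Lemma Pr_union_bound (K : eqType) (s : seq K) (P : pred K) (C : {ffun I -> T} -> bool)
    (A : K -> {ffun I -> T} -> bool) :
  Pr (fun om => C om && has (fun j => P j && A j om) s) <=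
  \sum_(j <- s | P j) Pr (fun om => C om && A j om).
Proof.
rewrite /Pr -Ex_sum; apply: Ex_le => om.
case: (C om) => //=; last by rewrite sumr_ge0.
case: hasP => [[j js /andP[Pj Aj]]|_]; last by rewrite sumr_ge0.
by rewrite (big_rem j) //= Pj Aj lerDl sumr_ge0.
Qed.

Lemma Ex_coord i (h : T -> R) : Ex (fun om => h (om i)) = \sum_t w i t * h t.
Proof.
transitivity (Ex (fun om => \prod_j (if j == i then h (om j) else 1))).
  by apply: eq_Ex => om; rewrite -big_mkcond big_pred1_eq.
rewrite (Ex_prod (fun j t => if j == i then h t else 1)) (bigD1 i) //= eqxx.
rewrite [X in _ * X]big1 ?mulr1 // => j /negbTE ->; rewrite -[RHS](w_sum1 j).
by apply: eq_bigr => t _; rewrite mulr1.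
Qed.

End ProductMeasure.

(** * The local lemma and moment estimates *)

Section LocalLemma.
Variables (R : realFieldType) (I T : finType) (w : I -> T -> R).
Hypothesis w_ge0 : forall i t, 0 <= w i t.
Hypothesis w_sum1 : forall i, \sum_t w i t = 1.
Variables (K : finType) (bad : K -> {ffun I -> T} -> bool) (vbl : K -> {set I}).
Variables (p : R) (d : nat).
Hypothesis dep_bad : forall j, depends_on (vbl j) (bad j).
Hypothesis bad_le : forall j, Pr w (bad j) <= p.
Hypothesis p_ge0 : 0 <= p.
Hypothesis d_gt0 : (0 < d)%N.
Hypothesis deg_le : forall j, (#|[set j' | ~~ [disjoint vbl j & vbl j']]| <= d)%N.
Hypothesis pd_le : 4 * p * d%:R <= 1.

Let none (S : {set K}) om := [forall j in S, ~~ bad j om].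

Let none_setU1 j S om : none (j |: S) om = none S om && ~~ bad j om.
Proof.
apply/forall_inP/andP => [H|[/forall_inP H bj] i].
  split; last by apply: H; rewrite !inE eqxx.
  by apply/forall_inP => i iS; apply: H; rewrite !inE iS orbT.
by rewrite !inE => /orP[/eqP->//|/H].
Qed.

Let none_sub (S S' : {set K}) om : S \subset S' -> none S' om -> none S om.
Proof.
by move=> /subsetP SS' /forall_inP H; apply/forall_inP => i /SS'; apply: H.
Qed.

Let dep_none (S : {set K}) : depends_on (\bigcup_(j in S) vbl j) (none S).
Proof.
move=> om om' e; apply: eq_forallb_in => j jS; congr (~~ _).
by apply: dep_bad => i ij; apply: e; apply/bigcupP; exists j.
Qed.

Let none_le (S S' : {set K}) : S \subset S' -> Pr w (none S') <= Pr w (none S).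
Proof. by move=> SS'; apply: Pr_le => // om; apply: none_sub. Qed.

(** The usual conditional bound 2p, multiplied out so that it makes sense before [none S] is known
    to have positive probability; [local_lemma] derives that positivity from it. *)
Let cond_bad n : forall (S : {set K}) j, (#|S| <= n)%N -> j \notin S ->
  Pr w (fun om => none S om && bad j om) <= 2 * p * Pr w (none S).
Proof.
elim: n => [|n IHn] S j Sn jS.
  have -> : S = set0 by apply/eqP; rewrite -cards_eq0 -leqn0.
  have none0 om : none set0 om by apply/forall_inP => i; rewrite inE.
  have -> : Pr w (none set0) = 1.
    by rewrite -[RHS](Ex_cst w_sum1 1); apply: eq_Ex => om; rewrite none0.
  have -> : Pr w (fun om => none set0 om && bad j om) = Pr w (bad j).
    by apply: eq_Pr => om; rewrite none0.
  by rewrite mulr1; apply: le_trans (bad_le j) _; rewrite mulr_natl mulr2n lerDl.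
set G := [set j' | ~~ [disjoint vbl j & vbl j']].
set S1 := S :&: G; set S2 := S :\: G.
(* The events of [S] near [j] are added one at a time to the far part [S2]; by induction each costs
   at most 2p times the probability of [none S2]. At most [d] are added, so half of it remains. *)
have step m : forall A : {set K}, #|A| = m -> A \subset S1 ->
    Pr w (none (A :|: S2)) >= (1 - 2 * p * m%:R) * Pr w (none S2).
  elim: m => [|m IHm] A Am AS1.
    by rewrite (_ : A = set0) ?set0U ?mulr0 ?subr0 ?mul1r //; apply/eqP; rewrite -cards_eq0 Am.
  have [a aA] : exists a, a \in A by apply/card_gt0P; rewrite Am.
  have A'm : #|A :\ a| = m by move: Am; rewrite (cardsD1 a) aA => -[].
  have A'S : A :\ a \subset S1 by apply: subset_trans (subD1set _ _) AS1.
  have := IHm _ A'm A'S; set P' := Pr w (none (A :\ a :|: S2)) => hP'.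
  have eA : A :|: S2 = a |: (A :\ a :|: S2) by rewrite setUA setD1K.
  have aS1 := subsetP AS1 _ aA.
  have aN : a \notin A :\ a :|: S2.
    by move: aS1; rewrite !inE eqxx /= => /andP[_ ->].
  have sub : a |: (A :\ a :|: S2) \subset S.
    rewrite -eA subUset (subset_trans AS1 (subsetIl _ _)) /=; exact: subsetDl.
  have sz : (#|A :\ a :|: S2| <= n)%N.
    rewrite -ltnS; apply: leq_trans Sn; apply: leq_trans (subset_leq_card sub).
    by rewrite cardsU1 aN.
  have := IHn _ a sz aN; rewrite -/P' => hb.
  have := Pr_splitC w (none (A :\ a :|: S2)) (bad a); rewrite -/P' => e.
  have -> : Pr w (none (A :|: S2)) = Pr w (fun om => none (A :\ a :|: S2) om && ~~ bad a om).
    by apply: eq_Pr => om; rewrite eA none_setU1.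
  have PP : P' <= Pr w (none S2) by apply: none_le; rewrite subsetUr.
  have : 2 * p * P' <= 2 * p * Pr w (none S2) by rewrite ler_wpM2l // mulr_ge0.
  rewrite -[m.+1]addn1 natrD; lra.
have half : 2 * Pr w (none S) >= Pr w (none S2).
  have := step _ S1 erefl (subxx _); rewrite setID.
  have : (#|S1|%:R : R) <= d%:R.
    by rewrite ler_nat; apply: leq_trans (deg_le j); apply: subset_leq_card; apply: subsetIr.
  move=> /(ler_wpM2l p_ge0) Hd.
  have P0 : 0 <= Pr w (none S2) by apply: Pr_ge0.
  have : (1 - 2 * p * #|S1|%:R) >= 2^-1 by have := pd_le; lra.
  by move=> /(ler_wpM2r P0); lra.
(* Forgetting the near events leaves [S2], which is independent of [bad j]. *)
have : Pr w (fun om => none S om && bad j om) <= Pr w (none S2) * Pr w (bad j).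
  rewrite -(@Pr_indep _ _ _ _ w_sum1 (\bigcup_(j in S2) vbl j) (vbl j)) //.
    apply: Pr_le => // om /andP[h ->]; rewrite andbT.
    by apply: none_sub h; apply: subsetDl.
  rewrite disjoint_sym; apply/bigcup_disjointP => i; rewrite !inE negbK.
  by move=> /andP[].
have Pb : Pr w (none S2) * Pr w (bad j) <= Pr w (none S2) * p.
  by rewrite ler_wpM2l // Pr_ge0.
have : p * Pr w (none S2) <= p * (2 * Pr w (none S)) by rewrite ler_wpM2l.
have := p_ge0; lra.
Qed.

Lemma local_lemma : exists om, forall j, ~~ bad j om.
Proof.
have p4 : 4 * p <= 1.
  apply: le_trans pd_le; rewrite ler_peMr ?mulr_ge0 //.
  by rewrite (ler_nat _ 1).
have pos n : forall S : {set K}, #|S| = n -> 0 < Pr w (none S).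
  elim: n => [|n IHn] S Sn.
    rewrite (_ : S = set0); last by apply/eqP; rewrite -cards_eq0 Sn.
    rewrite (_ : Pr w _ = 1) ?ltr01 // -[RHS](Ex_cst w_sum1 1).
    apply: eq_Ex => om; rewrite (_ : none _ _ = true) //.
    by apply/forall_inP => i; rewrite inE.
  have [a aS] : exists a, a \in S by apply/card_gt0P; rewrite Sn.
  have S'n : #|S :\ a| = n by move: Sn; rewrite (cardsD1 a) aS => -[].
  have P0 := IHn _ S'n.
  have := @cond_bad n (S :\ a) a; rewrite S'n leqnn !inE eqxx => /(_ isT isT) hb.
  have e := Pr_splitC w (none (S :\ a)) (bad a).
  have -> : Pr w (none S) = Pr w (fun om => none (S :\ a) om && ~~ bad a om).
    by apply: eq_Pr => om; rewrite -{1}(setD1K aS) none_setU1.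
  have : 2 * p * Pr w (none (S :\ a)) <= 2^-1 * Pr w (none (S :\ a)).
    by rewrite ler_wpM2r ?(ltW P0) //; lra.
  lra.
have [om] := Ex_exists_pos w_ge0 w_sum1 (pos _ setT erefl).
rewrite ltr0n lt0b => /forall_inP H; exists om => j; apply: H.
by rewrite inE.
Qed.

End LocalLemma.

(** * Correlation inequality for avoiding many sets at once *)

Section AvoidingSets.
Variables (R : realFieldType) (I T : finType) (w : I -> T -> R).
Hypothesis w_ge0 : forall i t, 0 <= w i t.
Hypothesis w_sum1 : forall i, \sum_t w i t = 1.
Variables (V : finType) (ix : V -> I) (xin : V -> {ffun I -> T} -> bool).
Hypothesis ix_inj : injective ix.
Hypothesis dep_xin : forall v, depends_on [set ix v] (xin v).
Implicit Types (F : {set V}) (om : {ffun I -> T}).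

Definition in_all (F : {set V}) om := [forall v in F, xin v om].
Definition pall (F : {set V}) : R := \prod_(v in F) Pr w (xin v).

Lemma in_all_prod F om : (in_all F om)%:R = \prod_(v in F) (xin v om)%:R :> R.
Proof.
rewrite /in_all; case: (boolP [forall _ in _, _]) => [/forall_inP H|].
  by rewrite big1 // => v /H ->.
rewrite negb_forall_in => /exists_inP[v vF nv].
by rewrite (bigD1 v vF) /= (negbTE nv) mul0r.
Qed.

Lemma dep_in_all F : depends_on (ix @: F) (in_all F).
Proof.
move=> om om' e; apply: eq_forallb_in => v vF; apply: dep_xin => i.
by rewrite inE => /eqP ->; apply: e; apply: imset_f.
Qed.

Lemma Pr_in_all F : Pr w (in_all F) = pall F.
Proof.
rewrite /Pr /pall; under eq_Ex do rewrite in_all_prod -big_filter.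
rewrite -[RHS]big_filter.
rewrite (Ex_indep_prod (J := fun v => [set ix v]) (F := fun v om => (xin v om)%:R) w_sum1) //.
- by rewrite filter_uniq // index_enum_uniq.
- by move=> v om om' /dep_xin ->.
- move=> u v _ _; apply: contraNT; rewrite -setI_eq0 => /set0Pn[i].
  by rewrite !inE => /andP[/eqP -> /eqP /ix_inj ->].
Qed.

Lemma pall_ge0 F : 0 <= pall F.
Proof. by apply: prodr_ge0 => v _; apply: Pr_ge0. Qed.

Lemma pall_le1 F : pall F <= 1.
Proof. by rewrite -Pr_in_all Pr_le1. Qed.

Lemma in_allU F F' om : in_all (F :|: F') om = in_all F om && in_all F' om.
Proof.
apply/forall_inP/andP => [H|[/forall_inP H /forall_inP H'] v].
  by split; apply/forall_inP => v vF; apply: H; rewrite inE vF ?orbT.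
by rewrite inE => /orP[/H|/H'].
Qed.

Variables (K : eqType) (F : K -> {set V}).
Implicit Types s : seq K.

Definition avoids s om := all (fun j => ~~ in_all (F j) om) s.

Lemma dep_avoids s : depends_on (ix @: \bigcup_(v <- s) F v) (avoids s).
Proof.
move=> om om' e; apply: eq_in_all => j js; congr (~~ _).
apply: (@dep_in_all (F j)) => i /imsetP[v vF ->]; apply: e; apply: imset_f.
by rewrite (big_rem j) //= inE vF.
Qed.

Lemma Pr_in_all_avoids (Z : {set V}) s :
  {in s, forall j, [disjoint Z & F j]} ->
  Pr w (fun om => in_all Z om && avoids s om) = pall Z * Pr w (avoids s).
Proof.
move=> dZ; rewrite -Pr_in_all; apply: (@Pr_indep _ _ _ _ w_sum1 (ix @: Z)
  (ix @: \bigcup_(v <- s) F v)) => //; [exact: dep_in_all | exact: dep_avoids |].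
rewrite -setI_eq0 -(imsetI (in2W ix_inj)) imset_eq0.
elim: s dZ => [|j s IHs] dZ; first by rewrite big_nil setI0.
rewrite big_cons setIUr setU_eq0 IHs ?andbT => [|i is_].
  by rewrite setI_eq0 dZ ?mem_head.
by apply: dZ; rewrite inE is_ orbT.
Qed.

Definition meets (A B : {set V}) := ~~ [disjoint A & B].

(** Induction on [s]. Avoiding only the members disjoint from [F i] is independent of [F i] and at
    least as likely as avoiding [s]. Hence the event that [F i] is in while [s] is avoided has at
    least the probability predicted by independence, minus the chance that [F i] and some [F j]
    meeting it are both in. *)
Lemma Pr_avoids_le s : uniq s ->
  Pr w (avoids s) <= \prod_(j <- s) (1 - pall (F j)) +
    \sum_(i <- s) \sum_(j <- s | (i != j) && meets (F i) (F j))
      pall (F i :|: F j).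
Proof.
elim: s => [_|i s IHs /= /andP[is_ /IHs{}IHs]].
  by rewrite !big_nil addr0 Pr_le1.
rewrite !big_cons eqxx /=.
set P := \prod_(j <- s) _ in IHs *; set S0 := \sum_(j <- s | _) _.
set S := \sum_(i <- s) _ in IHs; set S' := \sum_(j <- s) _.
have SS' : S <= S'.
  apply: ler_sum => j _; rewrite big_cons; case: ifP => // _.
  by rewrite lerDr pall_ge0.
pose s' := [seq j <- s | [disjoint F i & F j]].
have split_i := Pr_splitC w (avoids s) (in_all (F i)).
have -> : Pr w (avoids (i :: s)) = Pr w (fun om => avoids s om && ~~ in_all (F i) om).
  by apply: eq_Pr => om; rewrite /avoids /= andbC.
have E1 : Pr w (fun om => in_all (F i) om && avoids s' om) = pall (F i) * Pr w (avoids s').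
  by apply: Pr_in_all_avoids => j; rewrite mem_filter => /andP[].
have E2 := Pr_splitC w (fun om => in_all (F i) om && avoids s' om) (avoids s).
have E3 : Pr w (fun om => (in_all (F i) om && avoids s' om) && avoids s om) =
    Pr w (fun om => avoids s om && in_all (F i) om).
  apply: eq_Pr => om; case: (boolP (avoids s om)); last by rewrite andbF.
  move=> /allP H; rewrite andbT; suff -> : avoids s' om by rewrite andbT.
  by apply/allP => j; rewrite mem_filter => /andP[_ /H].
have E4 : Pr w (fun om => (in_all (F i) om && avoids s' om) && ~~ avoids s om) <= S0.
  apply: (@le_trans _ _ (\sum_(j <- s | (i != j) && meets (F i) (F j))
      Pr w (fun om => in_all (F i) om && in_all (F j) om))); last first.
    by apply: ler_sum => j _; rewrite -Pr_in_all; apply: Pr_le => // om; rewrite in_allU.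
  apply: le_trans (Pr_union_bound w_ge0 _ _ _ _); apply: Pr_le => // om.
  move=> /andP[/andP[-> h]]; rewrite -has_predC => /hasP[j js /= /negPn Fj].
  apply/hasP; exists j => //; rewrite Fj andbT; apply/andP; split.
    by apply: contraNneq is_ => ->.
  apply/negP => dij; have := allP h j; rewrite mem_filter dij js Fj.
  by move=> /(_ isT).
have E5 : Pr w (avoids s) <= Pr w (avoids s').
  apply: Pr_le => // om /allP H; apply/allP => j; rewrite mem_filter => /andP[_ /H] //.
have G0 := pall_ge0 (F i); have G1 := pall_le1 (F i).
have : pall (F i) * Pr w (avoids s) <= pall (F i) * Pr w (avoids s').
  by rewrite ler_wpM2l.
have : (1 - pall (F i)) * Pr w (avoids s) <= (1 - pall (F i)) * (P + S).
  by rewrite ler_wpM2l // subr_ge0.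
have S_ge0 : 0 <= S by apply: sumr_ge0 => j _; apply: sumr_ge0 => j' _; apply: pall_ge0.
have : 0 <= pall (F i) * S by rewrite mulr_ge0.
lra.
Qed.

Lemma Pr_avoids_disjoint s : uniq s ->
  {in s &, forall i j, i != j -> [disjoint F i & F j]} ->
  Pr w (avoids s) = \prod_(j <- s) (1 - pall (F j)).
Proof.
elim: s => [_ _|i s IHs /= /andP[is_ us] dF].
  by rewrite big_nil -[RHS](Ex_cst w_sum1 1); apply: eq_Ex.
rewrite big_cons -IHs // => [|a b as_ bs]; last by apply: dF; rewrite inE ?as_ ?bs orbT.
have -> : Pr w (avoids (i :: s)) = Pr w (fun om => avoids s om && ~~ in_all (F i) om).
  by apply: eq_Pr => om; rewrite /avoids /= andbC.
have := Pr_splitC w (avoids s) (in_all (F i)).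
rewrite (@eq_Pr _ _ _ w (fun om => avoids s om && in_all (F i) om)
  (fun om => in_all (F i) om && avoids s om)); last by move=> om; rewrite andbC.
rewrite Pr_in_all_avoids => [|j js]; first lra.
by apply: dF; rewrite ?inE ?eqxx ?js ?orbT //; apply: contraNneq is_ => ->.
Qed.

End AvoidingSets.

(** * Upper tails from factorial moments *)

Section FactorialMarkov.
Variables (R : realFieldType) (I T : finType) (w : I -> T -> R).
Hypothesis w_ge0 : forall i t, 0 <= w i t.
Hypothesis w_sum1 : forall i, \sum_t w i t = 1.
Variables (K : finType) (Es : {set K}) (g : K -> {ffun I -> T} -> R).
Variables (xi : {ffun I -> T} -> R) (gm b C w0 : R) (r : nat).
Hypothesis xi_ge0 : forall om, 0 <= xi om.
Hypothesis g_ge0 : forall e om, 0 <= g e om.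
Hypothesis g_le : forall e om, g e om <= gm.
Hypothesis gm_ge0 : 0 <= gm.
Hypothesis moment_le : forall Q : {set K}, Q \subset Es -> (#|Q| <= r)%N ->
  Ex w (fun om => xi om * \prod_(e in Q) g e om) <= C * b ^+ #|Q|.
Hypothesis w0_gt : r%:R * gm < w0.

(* The sum of the products of g over the ordered r-tuples of distinct
   elements of Es outside Q. *)
Let Fixpoint h (n : nat) (Q : {set K}) (om : {ffun I -> T}) : R :=
  if n is n'.+1 then \sum_(e in Es :\: Q) g e om * h n' (e |: Q) om else 1.

Let h_ge0 n : forall (Q : {set K}) om, 0 <= h n Q om.
Proof. by elim: n => //= n IHn Q om; apply: sumr_ge0 => e _; rewrite mulr_ge0. Qed.

Let h_lower n om : w0 <= \sum_(e in Es) g e om -> forall Q : {set K}, Q \subset Es ->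
  (#|Q| + n <= r)%N -> (w0 - r%:R * gm) ^+ n <= h n Q om.
Proof.
move=> hw; have y0 : 0 <= w0 - r%:R * gm by rewrite subr_ge0 ltW.
elim: n => //= n IHn Q QE Qn.
apply: (@le_trans _ _ (\sum_(e in Es :\: Q) g e om * (w0 - r%:R * gm) ^+ n)).
  rewrite -mulr_suml exprS ler_wpM2r ?exprn_ge0 //.
  have : \sum_(e in Es) g e om = \sum_(e in Es :\: Q) g e om + \sum_(e in Q) g e om.
    by rewrite (big_setID Q) /= (setIidPr QE) addrC.
  have : \sum_(e in Q) g e om <= \sum_(e in Q) gm by apply: ler_sum.
  rewrite sumr_const -[leRHS]mulr_natl.
  have : #|Q|%:R * gm <= r%:R * gm.
    by rewrite ler_wpM2r // ler_nat; apply: leq_trans Qn; apply: leq_addr.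
  lra.
apply: ler_sum => e; rewrite inE => /andP[eQ eE].
rewrite ler_wpM2l //; apply: IHn; first by rewrite subUset sub1set eE.
by rewrite cardsU1 eQ addSnnS.
Qed.

Let h_upper n : 0 <= b -> 0 <= C -> forall Q : {set K}, Q \subset Es -> (#|Q| + n <= r)%N ->
  Ex w (fun om => xi om * \prod_(e in Q) g e om * h n Q om) <=
  C * b ^+ #|Q| * (#|Es|%:R * b) ^+ n.
Proof.
move=> b0 C0; elim: n => [|n IHn] Q QE Qn /=.
  rewrite expr0 mulr1; under eq_Ex do rewrite mulr1.
  by apply: moment_le => //; rewrite addn0 in Qn.
under eq_Ex do rewrite mulr_sumr.
rewrite Ex_sum.
apply: (@le_trans _ _ (\sum_(e in Es :\: Q) C * b ^+ #|Q|.+1 * (#|Es|%:R * b) ^+ n)).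
  apply: ler_sum => e; rewrite inE => /andP[eQ eE].
  have := IHn (e |: Q); rewrite cardsU1 eQ addSnnS.
  move=> /(_ _ Qn); rewrite subUset sub1set eE QE => /(_ isT).
  apply: le_trans; rewrite le_eqVlt; apply/orP; left; apply/eqP.
  by apply: eq_Ex => om; rewrite big_setU1 //=; ring.
rewrite sumr_const -[leLHS]mulr_natl !exprS.
have -> c1 c2 c3 c4 : c1 * c2 * (c3 * b * c4) = c3 * (c1 * (b * c2) * c4) :> R by ring.
apply: ler_wpM2r; first by rewrite ?mulr_ge0 ?exprn_ge0 ?mulr_ge0.
by rewrite ler_nat subset_leq_card ?subsetDl.
Qed.

(** Markov's inequality for the [r]-th factorial moment. If the sum reaches [w0], the terms already
    chosen, fewer than [r] and each at most [gm], leave at least [w0 - r%:R * gm] for every further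
    choice. The weight [xi] restricts the estimate to an event. *)
Lemma factorial_markov : 0 <= b -> 0 <= C ->
  Ex w (fun om => xi om * (w0 <= \sum_(e in Es) g e om)%R%:R) <=
  C * (#|Es|%:R * b / (w0 - r%:R * gm)) ^+ r.
Proof.
move=> b0 C0; have y0 : 0 < w0 - r%:R * gm by rewrite subr_gt0.
rewrite expr_div_n mulrA ler_pdivlMr ?exprn_gt0 // -ExZr.
have := @h_upper r b0 C0 set0; rewrite sub0set cards0 add0n leqnn expr0 mulr1.
move=> /(_ isT isT); apply: le_trans; apply: Ex_le => // om.
rewrite big_set0 mulr1 -mulrA ler_wpM2l //.
case: (boolP (w0 <= _)) => hw; rewrite ?mul1r ?mul0r ?h_ge0 //.
by apply: h_lower; rewrite ?sub0set ?cards0.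
Qed.

End FactorialMarkov.

Lemma prodrD_subsets (R : comNzRingType) (V : finType) (F : {set V}) (a b : V -> R) :
  \prod_(u in F) (a u + b u) =
  \sum_(J : {set V} | J \subset F) (\prod_(u in J) b u * \prod_(u in F :\: J) a u).
Proof.
transitivity (\prod_u ((if u \in F then b u else 0) + (if u \in F then a u else 1))).
  by rewrite big_mkcond; apply: eq_bigr => u _; case: ifP => _; rewrite ?add0r // addrC.
rewrite bigA_distr (bigID (fun J : {set V} => J \subset F)) /= [X in _ + X]big1 ?addr0.
  apply: eq_bigr => J JF; rewrite (bigID (mem J)) /=; congr (_ * _).
    by apply: eq_bigr => u uJ; rewrite [X in if X then _ else _]uJ (subsetP JF).
  rewrite [RHS]big_mkcond [LHS]big_mkcond; apply: eq_bigr => u _.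
  by rewrite inE; case: ifP => uJ /=; rewrite ?uJ // (negbTE uJ).
move=> J /subsetPn[u uJ uF].
by rewrite (bigD1 u) //= uJ (negbTE uF) mul0r.
Qed.

Lemma sum_prod_le1 (R : realFieldType) (K : Type) (s : seq K) (g : K -> R) :
  (forall j, 0 <= g j <= 1) -> 1 - \sum_(j <- s) g j <= \prod_(j <- s) (1 - g j) <= 1.
Proof.
move=> g01; elim: s => [|j s /andP[IH1 IH2]]; first by rewrite !big_nil; lra.
rewrite !big_cons; have /andP[g0 g1] := g01 j.
set S := \sum_(j <- s) _ in IH1 *; set P := \prod_(j <- s) _ in IH1 IH2 *.
have P0 : 0 <= P by apply: prodr_ge0 => i _; have /andP[_] := g01 i; rewrite subr_ge0.
have : (1 - g j) * P >= P - g j by rewrite mulrBl mul1r lerB // ler_piMr.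
have : (1 - g j) * P <= P by rewrite mulrBl mul1r gerBl mulr_ge0.
by move=> h1 h2; apply/andP; split; lra.
Qed.

Lemma indicator_prod (R : comNzRingType) (V : finType) (F A : {set V}) :
  (F \subset A)%:R = \prod_(u in F) (u \in A)%:R :> R.
Proof.
case: (boolP (F \subset A)) => [/subsetP H|/subsetPn[u uF uA]].
  by rewrite big1 // => u /H ->.
by rewrite (bigD1 u uF) /= (negbTE uA) mul0r.
Qed.

Lemma prod_setU (R : comNzRingType) (V : finType) (A B : {set V}) (f : V -> R) :
  [disjoint A & B] ->
  \prod_(u in A :|: B) f u = \prod_(u in A) f u * \prod_(u in B) f u.
Proof. by move=> dAB; rewrite -bigU //; apply: eq_bigl => u; rewrite !inE. Qed.

(** * Propagation of monomial bounds through one round *)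

Section Moments.
Variables (R : realFieldType) (I T V : finType) (w : I -> T -> R).
Hypothesis w_ge0 : forall i t, 0 <= w i t.
Variables (Xr Ar : {ffun I -> T} -> {set V}) (p x lam phi : R) (n : nat).
Hypothesis p_ge0 : 0 <= p.
Hypothesis Pr_le_monomial : forall S Z : {set V}, [disjoint S & Z] -> (#|S| + #|Z|)%N = n ->
  Pr w (fun om => (S \subset Ar om) && (Z \subset Xr om)) <= phi * lam ^+ #|S| * x ^+ #|Z|.

Local Notation X u om := ((u \in Xr om)%:R : R).
Local Notation A u om := ((u \in Ar om)%:R : R).
Local Notation mono S Z om := (((S \subset Ar om) && (Z \subset Xr om))%:R : R).

Let mono_merge (S Z J F : {set V}) om : J \subset F ->
  mono S Z om * (\prod_(u in J) (p * A u om) * \prod_(u in F :\: J) X u om) =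
  p ^+ #|J| * mono (S :|: J) (Z :|: F :\: J) om.
Proof.
move=> JF; rewrite big_split /= prodr_const -!indicator_prod.
rewrite !subUset; do ?case: (_ \subset _); by rewrite /= ?(mul1r, mulr1, mul0r, mulr0).
Qed.

Let card_merge (S Z J F : {set V}) : [disjoint S & Z] -> [disjoint S :|: Z & F] ->
  J \subset F ->
  [/\ [disjoint S :|: J & Z :|: F :\: J], #|S :|: J| = (#|S| + #|J|)%N
    & #|Z :|: F :\: J| = (#|Z| + (#|F| - #|J|))%N].
Proof.
rewrite -!setI_eq0 => /eqP SZ SZF JF.
have [/eqP SF /eqP ZF] : S :&: F == set0 /\ Z :&: F == set0.
  by apply/andP; rewrite -setU_eq0 -setIUl.
have SJ : S :&: J = set0 by apply/eqP; rewrite -subset0 -SF setIS.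
have ZJ : J :&: Z = set0 by apply/eqP; rewrite setIC -subset0 -ZF setIS.
have SFJ : S :&: (F :\: J) = set0 by apply/eqP; rewrite -subset0 -SF setIS ?subsetDl.
have ZFJ : Z :&: (F :\: J) = set0 by apply/eqP; rewrite -subset0 -ZF setIS ?subsetDl.
have JFJ : J :&: (F :\: J) = set0 
  by apply/setP => u; rewrite !inE; case: (u \in J).
split.
- by rewrite setIUl !setIUr SZ SFJ ZJ JFJ !setU0.
- by rewrite cardsU SJ cards0 subn0.
- by rewrite cardsU ZFJ cards0 subn0 cardsD (setIidPr JF).
Qed.

(** [X u + p * A u] bounds the chance that [u] is selected one round later. Expanding over the set
    [J] of newly proposed vertices gives monomials of the same total size [n], and the binomial
    formula resums their bounds. *)
Lemma Ex_mixed_le (S Z1 Z2 : {set V}) :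
  [disjoint S & Z1] -> [disjoint S :|: Z1 & Z2] -> (#|S| + #|Z1| + #|Z2|)%N = n ->
  Ex w (fun om => mono S Z1 om * \prod_(u in Z2) (X u om + p * A u om)) <=
  phi * lam ^+ #|S| * x ^+ #|Z1| * (x + p * lam) ^+ #|Z2|.
Proof.
move=> dSZ dF cn; under eq_Ex do rewrite prodrD_subsets mulr_sumr.
rewrite Ex_sum.
rewrite -[(x + _) ^+ _]prodr_const (prodrD_subsets _ (fun=> x) (fun=> p * lam)) mulr_sumr.
apply: ler_sum => J JF; under eq_Ex do rewrite mono_merge //.
rewrite ExZ !prodr_const.
have [d c1 c2] := card_merge dSZ dF JF.
have JF' := subset_leq_card JF.
have /(Pr_le_monomial d) : (#|S :|: J| + #|Z1 :|: Z2 :\: J|)%N = n.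
  by rewrite c1 c2 -cn addnACA addnCA; lia.
move=> /(ler_wpM2l (exprn_ge0 #|J| p_ge0)) h; apply: le_trans h _.
rewrite c1 c2 cardsD (setIidPr JF) !exprD exprMn.
by rewrite le_eqVlt; apply/orP; left; apply/eqP; ring.
Qed.

(** Subtracting the product of the [X u] removes the term [J = set0], an edge fully selected before
    the round. Only the growth of [x ^+ c] during this round is left, which keeps the load of a
    single round small. The edges are treated one by one, each enlarging [S] and [Z]. *)
Lemma Ex_edges_le (K : finType) (Fe : K -> {set V}) (c : nat) (Q : {set K}) :
  forall S Z : {set V}, (forall e, e \in Q -> #|Fe e| = c) ->
  {in Q &, forall e f, e != f -> [disjoint Fe e & Fe f]} ->
  (forall e, e \in Q -> [disjoint S :|: Z & Fe e]) ->
  [disjoint S & Z] -> (#|S| + #|Z| + #|Q| * c)%N = n ->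
  0 <= lam -> 0 <= x ->
  Ex w (fun om => mono S Z om * \prod_(e in Q)
     (\prod_(u in Fe e) (X u om + p * A u om) - \prod_(u in Fe e) X u om)) <=
  phi * lam ^+ #|S| * x ^+ #|Z| * ((x + p * lam) ^+ c - x ^+ c) ^+ #|Q|.
Proof.
move: {2}#|Q| (erefl #|Q|) => q; elim: q Q => [|q IHq] Q Qq S Z hc dFe dF dSZ cn l0 x0.
  have -> : Q = set0 by apply/eqP; rewrite -cards_eq0 Qq.
  under eq_Ex do rewrite big_set0 mulr1.
  rewrite cards0 expr0 mulr1; apply: Pr_le_monomial => //.
  by rewrite -cn Qq mul0n addn0.
have [e eQ] : exists e, e \in Q by apply/card_gt0P; rewrite Qq.
have Q'q : #|Q :\ e| = q by move: Qq; rewrite (cardsD1 e) eQ => -[].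
have sub (J : {set V}) : J \subset Fe e -> (#|J| <= c)%N by rewrite -(hc e eQ); apply: subset_leq_card.
under eq_Ex do rewrite (big_setD1 e eQ) /= mulrA.
have E1 om : mono S Z om * (\prod_(u in Fe e) (X u om + p * A u om) - \prod_(u in Fe e) X u om) =
   \sum_(J : {set V} | (J \subset Fe e) && (J != set0))
      p ^+ #|J| * mono (S :|: J) (Z :|: Fe e :\: J) om.
  rewrite prodrD_subsets (bigD1 set0) ?sub0set //= big_set0 mul1r setD0 addrC addrK mulr_sumr.
  by apply: eq_bigr => J /andP[JF _]; rewrite mono_merge.
have E2 : (x + p * lam) ^+ c - x ^+ c =
   \sum_(J : {set V} | (J \subset Fe e) && (J != set0)) (p * lam) ^+ #|J| * x ^+ (c - #|J|).
  have -> : (x + p * lam) ^+ c = \prod_(u in Fe e) (x + p * lam).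
    by rewrite prodr_const hc.
  rewrite (prodrD_subsets _ (fun=> x) (fun=> p * lam)) (bigD1 set0) ?sub0set //=.
  rewrite big_set0 mul1r setD0 prodr_const hc // addrC addrK; apply: eq_bigr => J /andP[JF _].
  by rewrite !prodr_const cardsD (setIidPr JF) (hc e eQ).
under eq_Ex do rewrite E1 mulr_suml.
rewrite Ex_sum [_ ^+ #|Q|](_ : _ = \sum_(J : {set V} | (J \subset Fe e) && (J != set0))
  ((p * lam) ^+ #|J| * x ^+ (c - #|J|) * ((x + p * lam) ^+ c - x ^+ c) ^+ q)); last first.
  by rewrite Qq exprS {1}E2 mulr_suml.
rewrite mulr_sumr; apply: ler_sum => J /andP[JF _].
under eq_Ex do rewrite -mulrA; rewrite ExZ.
have [d c1 c2] := card_merge dSZ (dF e eQ) JF.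
have := IHq (Q :\ e) Q'q (S :|: J) (Z :|: Fe e :\: J).
rewrite c1 c2 (hc e eQ) => /(_ _ _ _ d _ l0 x0).
have H1 : forall f, f \in Q :\ e -> #|Fe f| = c by move=> f /setD1P[_ /hc].
have H2 : {in Q :\ e &, forall f g, f != g -> [disjoint Fe f & Fe g]}.
  by move=> f g /setD1P[_ fQ] /setD1P[_ gQ]; apply: dFe.
have H3 : forall f, f \in Q :\ e -> [disjoint (S :|: J) :|: (Z :|: Fe e :\: J) & Fe f].
  move=> f /setD1P[fe fQ]; apply: (@disjointWl _ _ (mem (S :|: Z :|: Fe e))).
    apply/subsetP => u; rewrite !inE => /orP[/orP[->//|uJ]|/orP[->|/andP[_ ->]]]; rewrite ?orbT //.
    by rewrite (subsetP JF) ?orbT.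
  have d1 := dF f fQ; have d2 : [disjoint Fe e & Fe f] by apply: dFe; rewrite // eq_sym.
  by rewrite -setI_eq0 setIUl setU_eq0 !setI_eq0 d1 d2.
have H4 : (#|S| + #|J| + (#|Z| + (c - #|J|)) + #|Q :\ e| * c)%N = n.
  by rewrite -cn Qq Q'q mulSn; have := sub _ JF; lia.
move=> /(_ H1 H2 H3 H4) /(ler_wpM2l (exprn_ge0 #|J| p_ge0)) h; apply: le_trans h _.
rewrite Q'q !exprD exprMn.
by rewrite le_eqVlt; apply/orP; left; apply/eqP; ring.
Qed.

End Moments.

(** * One round of the nibble *)

Section Threshold.
Variables (R : realFieldType) (N : nat).

(** The value N+1 is allowed, for a coin that always passes. *)
Definition threshold (y : R) : nat :=
  [arg max_(i > (ord0 : 'I_N.+2) | ((i : nat)%:R <= y)) (i : nat)].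

Lemma threshold_lt y : (threshold y < N.+2)%N.
Proof. exact: ltn_ord. Qed.

Lemma threshold_le y : 0 <= y -> (threshold y)%:R <= y.
Proof. by move=> y0; rewrite /threshold; case: arg_maxnP. Qed.

Lemma threshold_ge y : 0 <= y <= N.+1%:R -> y <= (threshold y)%:R + 1.
Proof.
move=> /andP[y0 yN]; rewrite /threshold; case: arg_maxnP => //= i iy imax.
have [iN|iN] := ltnP i.+1 N.+2; last first.
  by apply: le_trans yN _; rewrite natr1 ler_nat ltnW.
rewrite leNgt; apply/negP => /ltW h.
have := imax (Ordinal iN); rewrite /= -natr1 => /(_ h).
by rewrite ltnn.
Qed.

End Threshold.

Section Step.
Variables (R : realFieldType) (V : finType) (E : {set {set V}}).
Variables (m rounds N : nat) (pi : nat -> R) (kap : R).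
Hypothesis pi01 : forall i, 0 <= pi i < 1.
Hypothesis kap01 : 0 < kap <= 1.
Hypothesis lin : linear_hypergraph E.

Definition edges_at v : {set {set V}} := [set e in E | v \in e].

Lemma edges_at_eq v u e f : u != v -> e \in edges_at v -> f \in edges_at v ->
  u \in e -> u \in f -> e = f.
Proof.
move=> uv; rewrite !inE => /andP[eE ve] /andP[fE vf] ue uf.
apply/eqP; apply/negPn/negP => ef; have := lin eE fE ef.
apply/negP; rewrite -ltnNge; apply/card_gt1P.
by exists u, v; rewrite !inE ue uf ve vf.
Qed.

(* The variable at (c, i, v, false) decides whether v is proposed for color c
   in round i; the one at (c, i, v, true) is an equalizing coin. *)
Definition index : finType := ('I_m * 'I_rounds.+1 * V * bool)%type.
Definition coord : finType := (bool * 'I_N.+1)%type.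

Definition bern (p : R) (b : bool) := if b then p else 1 - p.
(** Every coordinate carries an independent Bernoulli bit and uniform value; [prop_at] reads the
    bit, [coin_at] the value. *)
Definition wt (j : index) (t : coord) : R :=
  bern (pi j.1.1.2) t.1 / N.+1%:R.

Lemma wt_ge0 j t : 0 <= wt j t.
Proof.
rewrite /wt divr_ge0 //= /bern; have := pi01 j.1.1.2.
by case: t.1 => /andP[] // _ /ltW; rewrite subr_ge0.
Qed.

Lemma sum_wt j (f : bool -> R) (g : 'I_N.+1 -> R) :
  \sum_t wt j t * (f t.1 * g t.2) =
  (\sum_b bern (pi j.1.1.2) b * f b) * (\sum_n g n / N.+1%:R).
Proof.
rewrite mulr_suml (eq_bigr (fun b => \sum_n bern (pi j.1.1.2) b / N.+1%:R * (f b * g n))).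
  by rewrite pair_bigA.
by move=> b _; rewrite mulr_sumr; apply: eq_bigr => n _; rewrite [g n / _]mulrC mulrACA.
Qed.

Lemma sum_bern p : \sum_b bern p b = 1.
Proof. by rewrite big_bool /= addrC subrK. Qed.

Lemma sum_unif : \sum_(n < N.+1) 1 / N.+1%:R = 1 :> R.
Proof.
by rewrite -mulr_suml sumr_const card_ord divff // pnatr_eq0.
Qed.

Lemma wt_sum1 j : \sum_t wt j t = 1.
Proof.
transitivity (\sum_t wt j t * (1 * 1)).
  by apply: eq_bigr => t _; rewrite !mulr1.
rewrite (sum_wt j (fun=> 1) (fun=> 1)) sum_unif [LHS]mulr1.
rewrite -[RHS](sum_bern (pi j.1.1.2)).
by apply: eq_bigr => b _; rewrite mulr1.
Qed.

Definition state : Type := ({set V} * {set V})%type.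
Implicit Types (s : state) (om : {ffun index -> coord}) (S Z F : {set V}).

(** [inord] maps a round beyond [rounds] to round 0, whence the side conditions [i <= rounds]. *)
Definition prop_at (c : 'I_m) i v om : bool := (om (c, inord i, v, false)).1.
Definition coin_at (c : 'I_m) i v om : nat := (om (c, inord i, v, true)).2.

Lemma Pr_prop c i v : (i <= rounds)%N -> Pr wt (prop_at c i v) = pi i.
Proof.
move=> ir; rewrite /Pr /prop_at.
rewrite (Ex_coord wt_sum1 (c, inord i, v, false) (fun t => (t.1)%:R)).
have := sum_wt (c, inord i, v, false) (fun b => b%:R) (fun=> 1).
rewrite sum_unif mulr1 big_bool /= mulr1 mulr0 addr0 inordK // => <-.
by apply: eq_bigr => t _; rewrite mulr1.
Qed.

Lemma Pr_coin c i v n : (n <= N.+1)%N ->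
  Pr wt (fun om => (coin_at c i v om < n)%N) = n%:R / N.+1%:R.
Proof.
move=> nN; rewrite /Pr /coin_at.
rewrite (Ex_coord wt_sum1 (c, inord i, v, true) (fun t => (t.2 < n)%N%:R)).
have := sum_wt (c, inord i, v, true) (fun=> 1) (fun t => (t < n)%N%:R).
under [X in _ = X * _ -> _]eq_bigr do rewrite mulr1.
rewrite sum_bern mul1r => e; transitivity (\sum_(t < N.+1) (t < n)%N%:R / N.+1%:R : R).
  by rewrite -e; apply: eq_bigr => t _; rewrite mul1r.
rewrite -mulr_suml; congr (_ / _).
rewrite -(big_mkord xpredT (fun t => (t < n)%N%:R)) (big_cat_nat (n := n)) //=.
rewrite (eq_big_nat _ _ (F2 := fun=> 1)) => [|t /andP[_ ->] //].
rewrite sumr_const_nat subn0 big_nat_cond big1 ?addr0 // => t /andP[/andP[h _] _].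
by rewrite ltnNge h.
Qed.

(* gfun s p u is the probability that u is selected by the end of a round
   entered in state s = (selected, available) with proposal probability p. *)
Definition gfun s p u : R := if u \in s.1 then 1 else if u \in s.2 then p else 0.
Definition edgep s p v (e : {set V}) : R := \prod_(u in e :\ v) gfun s p u.
(** By linearity the sets [e :\ v] are disjoint, so this is the exact probability, given the state,
    that no edge at [v] discards it. *)
Definition keep s p v : R := \prod_(e in edges_at v) (1 - edgep s p v e).
(** A survival probability already below [kap] cannot be raised, so the coin then always passes;
    [overload] shows that this case is rare. *)
Definition ratio s p v : R := if keep s p v <= kap then 1 else kap / keep s p v.

(** A selected vertex may stay available, and its survival looks only at [e :\ v]; hence the
    proposal of [v] is independent of its survival ([Pr_prop_step2]). *)
Definition step c i s om : state :=
  let X' := s.1 :|: [set v in s.2 | prop_at c i v om] in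
  (X', [set v in s.2 | [forall e in edges_at v, ~~ (e :\ v \subset X')]
     && (coin_at c i v om < threshold N (ratio s (pi i) v * N.+1%:R))%N]).

(** Every edge at an available vertex then has another vertex that is not selected, so [edgep] is at
    most [p < 1] and [keep] is positive. *)
Definition good s := forall v e, v \in s.2 -> e \in edges_at v -> ~~ (e :\ v \subset s.1).

Section OneRound.
Variables (c : 'I_m) (i : nat) (s : state).
Hypothesis ir : (i <= rounds)%N.
Hypothesis gs : good s.
Local Notation p := (pi i).
Let p_ge0 : 0 <= p. Proof. by case/andP: (pi01 i). Qed.
Let p_lt1 : p < 1. Proof. by case/andP: (pi01 i). Qed.

Definition selected v om := (v \in s.1) || (v \in s.2) && prop_at c i v om.
Definition ixp v : index := (c, inord i, v, false).
Definition ixc v : index := (c, inord i, v, true).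
Definition passes v om := (coin_at c i v om < threshold N (ratio s p v * N.+1%:R))%N.

Lemma ixp_inj : injective ixp. Proof. by move=> u v []. Qed.
Lemma ixc_inj : injective ixc. Proof. by move=> u v []. Qed.

Lemma dep_selected v : depends_on [set ixp v] (selected v).
Proof. by move=> om om' e; rewrite /selected /prop_at e ?inE. Qed.

Lemma dep_passes v : depends_on [set ixc v] (passes v).
Proof. by move=> om om' e; rewrite /passes /coin_at e ?inE. Qed.

Lemma step1E om : (step c i s om).1 = [set v | selected v om].
Proof. by apply/setP => v; rewrite !inE. Qed.

Lemma subset_step1 F om : (F \subset (step c i s om).1) = in_all selected F om.
Proof.
rewrite step1E; apply/subsetP/forall_inP => H v /H; by rewrite inE.
Qed.

Lemma mem_step2 v om : (v \in (step c i s om).2) =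
  [&& v \in s.2, avoids selected (fun e => e :\ v) (enum (edges_at v)) om & passes v om].
Proof.
rewrite inE -/(step c i s om).1; congr [&& _, _ & _].
apply/forall_inP/allP => H e.
  by rewrite mem_enum => /H; rewrite -[_ :|: _]/(step c i s om).1 subset_step1.
by move=> eE; rewrite -[_ :|: _]/(step c i s om).1 subset_step1; apply: H; rewrite mem_enum.
Qed.

Lemma Pr_selected v : Pr wt (selected v) = gfun s p v.
Proof.
rewrite /selected /gfun; case: (v \in s.1) => /=.
  by rewrite -[RHS](Ex_cst wt_sum1); apply: eq_Ex.
case: (v \in s.2) => /=; first by rewrite Pr_prop.
by rewrite -[RHS](Ex_cst wt_sum1); apply: eq_Ex.
Qed.

Lemma pall_selected F : pall wt selected F = \prod_(u in F) gfun s p u.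
Proof. by apply: eq_bigr => u _; rewrite Pr_selected. Qed.

Lemma gfun01 v : 0 <= gfun s p v <= 1.
Proof. by rewrite /gfun; case: ifP => _; [|case: ifP => _]; rewrite ?ler01 ?lexx ?p_ge0 ?(ltW p_lt1). Qed.

Lemma edgep_ge0 v e : 0 <= edgep s p v e.
Proof. by apply: prodr_ge0 => u _; case/andP: (gfun01 u). Qed.

Lemma edgep_le v e : v \in s.2 -> e \in edges_at v -> edgep s p v e <= p.
Proof.
move=> vs /(gs vs)/subsetPn[u uF us]; rewrite /edgep (bigD1 u uF) /=.
rewrite -[leRHS]mulr1; apply: ler_pM => //.
- by case/andP: (gfun01 u).
- by apply: prodr_ge0 => u' _; case/andP: (gfun01 u').
- by rewrite /gfun (negbTE us); case: ifP.
- by apply: prodr_ile1 => u' _; apply: gfun01.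
Qed.

Lemma keep_bounds v : v \in s.2 -> 0 < keep s p v <= 1.
Proof.
move=> vs; apply/andP; split.
  by apply: prodr_gt0 => e /(edgep_le vs) h; rewrite subr_gt0; apply: le_lt_trans h p_lt1.
apply: prodr_ile1 => e /(edgep_le vs) h; rewrite subr_ge0 gerBl edgep_ge0 andbT.
exact: le_trans h (ltW p_lt1).
Qed.

Lemma ratio_bounds v : 0 < ratio s p v <= 1.
Proof.
have /andP[k0 k1] := kap01; rewrite /ratio; case: (leP (keep s p v) kap) => [_|h] /=; first by rewrite ltr01 lexx.
have kp : 0 < keep s p v by apply: lt_trans h.
by rewrite divr_gt0 //= ler_pdivrMr // mul1r ltW.
Qed.

Lemma ratio_keep v : v \in s.2 -> ratio s p v * keep s p v = Num.min (keep s p v) kap.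
Proof.
move=> vs; have /andP[kp _] := keep_bounds vs.
rewrite /ratio; case: (leP (keep s p v) kap) => h /=; first by rewrite mul1r.
by rewrite divfK // gt_eqF.
Qed.

Lemma Pr_passes v : ratio s p v - 1 / N.+1%:R <= Pr wt (passes v) <= ratio s p v.
Proof.
have /andP[/ltW r0 r1] := ratio_bounds v.
have N0 : 0 < N.+1%:R :> R by rewrite ltr0n.
rewrite Pr_coin; last exact: (threshold_lt N (ratio s p v * N.+1%:R)).
apply/andP; split; last by rewrite ler_pdivrMr // threshold_le // mulr_ge0.
rewrite ler_pdivlMr // mulrBl divfK ?gt_eqF //.
have := @threshold_ge R N (ratio s p v * N.+1%:R).
rewrite mulr_ge0 ?ler0n //= ger_pMl // r1 => /(_ isT); lra.
Qed.

(** For these pairs [rest] is disjoint from [S :|: Z]: the proposals in it are independent of those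
    in [Z], and the monomials it adds later have disjoint supports. *)
Definition clean S Z : {set V * {set V}} :=
  [set q | [&& q.1 \in S, q.2 \in edges_at q.1 & q.2 :&: (S :|: Z) == [set q.1]]].
Definition rest (q : V * {set V}) : {set V} := q.2 :\ q.1.

Definition pair_sum S Z : R :=
  \sum_(q in clean S Z) \sum_(q' in clean S Z | (q != q') && meets (rest q) (rest q'))
     \prod_(u in rest q :|: rest q') gfun s p u.

Lemma clean_disjoint S Z q : q \in clean S Z -> [disjoint S :|: Z & rest q].
Proof.
rewrite inE => /and3P[_ _ /eqP e]; rewrite -setI_eq0.
apply/eqP/setP => u; have /setP/(_ u) := e; rewrite !inE => <-.
by case: (u \in q.2); case: (_ || _).
Qed.

(** By linearity a vertex of [S] and a second vertex of [S :|: Z] lie in at most one common edge. *)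
Lemma unclean_card S Z :
  (#|[set q : V * {set V} | (q.1 \in S) && (q.2 \in edges_at q.1)] :\: clean S Z|
     <= #|S| * #|S :|: Z|)%N.
Proof.
rewrite -cardsX; set B := _ :\: _.
pose f (q : V * {set V}) := (q.1, odflt q.1 [pick u in q.2 :&: (S :|: Z) :\ q.1]).
have fP q : q \in B -> [/\ q.1 \in S, q.2 \in edges_at q.1, (f q).2 \in q.2,
     (f q).2 \in S :|: Z & (f q).2 != q.1].
  rewrite !inE /= => /andP[h1 /andP[qS /andP[qE qq]]].
  move: h1; rewrite qS qE qq /= => h; rewrite /f /=.
  case: pickP => [u|none]; first by rewrite !inE => /and3P[-> -> ->].
  exfalso; move/negP: h; apply; apply/eqP/setP => u; have := none u; rewrite !inE.
  have [->|/=] := eqVneq u q.1; first by rewrite qq qS.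
  by move=> _ ->.
have finj : {in B &, injective f}.
  move=> [v e] [v' e'] /fP[_ he fe _ fv] /fP[_ he' fe' _ _] ef.
  have ev : v = v' by case: ef.
  rewrite -ef in fe'; congr pair => //.
  by apply: (edges_at_eq fv he _ fe fe'); rewrite [(v, e).1]ev.
rewrite -(card_in_imset finj); apply: subset_leq_card; apply/subsetP => y /imsetP[q qB ->].
by have [h1 _ _ h2 _] := fP q qB; rewrite in_setX h1.
Qed.

(** Ignoring the unclean edges only increases the probability. [Pr_avoids_le] for the clean ones
    gives the product of all [keep] divided by the missing factors, each at least 1 - p, plus the
    pair sum. Multiplied by the passing probabilities, the product of the [keep] is at most
    [kap ^+ #|S|]. *)
Lemma Pr_step_le S Z : [disjoint S & Z] ->
  Pr wt (fun om => (S \subset (step c i s om).2) && (Z \subset (step c i s om).1)) <=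
  (S \subset s.2)%:R * (\prod_(u in Z) gfun s p u) *
    (kap ^+ #|S| / (1 - p) ^+ (#|S| * #|S :|: Z|) + pair_sum S Z).
Proof.
move=> dSZ; have [SA|SA] := boolP (S \subset s.2); last first.
  rewrite !mul0r -[leRHS](Ex_cst wt_sum1 0) /Pr; apply: Ex_le; first exact: wt_ge0.
  move=> om; rewrite (_ : (S \subset _) = false) //; apply: contraNF SA => h.
  by apply: subset_trans h _; apply/subsetP => v; rewrite mem_step2 => /and3P[].
rewrite mul1r; set GZ := \prod_(u in Z) _.
have GZ0 : 0 <= GZ by apply: prodr_ge0 => u _; case/andP: (gfun01 u).
have gprod0 F : 0 <= \prod_(u in F) gfun s p u by apply: prodr_ge0 => u _; case/andP: (gfun01 u).
pose Q := enum (clean S Z).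
apply: (@le_trans _ _ (Pr wt (fun om => in_all passes S om &&
     (in_all selected Z om && avoids selected rest Q om)))).
  apply: Pr_le; first exact: wt_ge0.
  move=> om /andP[/subsetP hS hZ]; rewrite -subset_step1 hZ /=; apply/andP; split.
    by apply/forall_inP => v /hS; rewrite mem_step2 => /and3P[].
  apply/allP => q; rewrite mem_enum inE => /and3P[/hS + qE _].
  by rewrite mem_step2 => /and3P[_ /allP H _]; apply: (H q.2); rewrite mem_enum.
rewrite (@Pr_indep _ _ _ _ wt_sum1 [set j | j.2] [set j | ~~ j.2]); first last.
- by rewrite -setI_eq0; apply/eqP/setP => j; rewrite !inE andbN.
- move=> om om' e; congr (_ && _).
    apply: (@dep_in_all _ _ _ ixp selected dep_selected Z) => j /imsetP[v _ ->].
    by apply: e; rewrite inE.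
  apply: (@dep_avoids _ _ _ ixp selected dep_selected) => j /imsetP[v _ ->].
  by apply: e; rewrite inE.
- move=> om om' e; apply: (@dep_in_all _ _ _ ixc passes dep_passes S) => j /imsetP[v _ ->].
  by apply: e; rewrite inE.
rewrite (Pr_in_all wt_sum1 ixc_inj dep_passes).
rewrite (Pr_in_all_avoids wt_sum1 ixp_inj dep_selected) => [|q]; last first.
  rewrite mem_enum => /clean_disjoint; apply: disjointWl.
  by apply/subsetP => u uZ; rewrite inE uZ orbT.
rewrite pall_selected -/GZ mulrCA ler_wpM2l //.
have PA := Pr_avoids_le wt_ge0 wt_sum1 ixp_inj dep_selected rest (enum_uniq (mem (clean S Z))).
set Pc := pall wt passes S.
have Pc0 : 0 <= Pc by apply: pall_ge0; exact: wt_ge0.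
have Pc1 : Pc <= \prod_(v in S) ratio s p v.
  apply: ler_prod => v _; rewrite Pr_ge0; last exact: wt_ge0.
  by case/andP: (Pr_passes v).
have ratio1 : \prod_(v in S) ratio s p v <= 1.
  apply: prodr_ile1 => v _; have /andP[h1 h2] := ratio_bounds v.
  by rewrite (ltW h1) h2.
apply: le_trans (ler_wpM2l Pc0 PA) _; rewrite mulrDr; apply: lerD; last first.
  rewrite big_enum /=; under eq_bigr do rewrite big_enum_cond /=.
  under eq_bigr do under eq_bigr do rewrite pall_selected.
  apply: ler_piMl; last exact: le_trans Pc1 ratio1.
  by apply: sumr_ge0 => q _; apply: sumr_ge0 => q' _.
rewrite big_enum /=.
set PG := \prod_(q in clean S Z) _.
pose h (q : V * {set V}) := 1 - edgep s p q.1 q.2.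
have PGE : PG = \prod_(q in clean S Z) h q.
  by apply: eq_bigr => q _; rewrite pall_selected.
pose W := [set q : V * {set V} | (q.1 \in S) && (q.2 \in edges_at q.1)].
have WE : \prod_(v in S) keep s p v = \prod_(q in W) h q.
  rewrite /keep pair_big_dep /=; apply: eq_bigl => q; by rewrite [RHS]inE.
have GW : clean S Z \subset W by apply/subsetP => q; rewrite !inE => /and3P[-> ->].
have h_ge q : q \in W -> 1 - p <= h q.
  rewrite inE => /andP[qS qE]; rewrite lerD2l lerN2 edgep_le //.
  exact: (subsetP SA).
have hlow : (1 - p) ^+ (#|S| * #|S :|: Z|) <= \prod_(q in W :\: clean S Z) h q.
  apply: (@le_trans _ _ (\prod_(q in W :\: clean S Z) (1 - p))).
    rewrite prodr_const; apply: ler_wiXn2l; rewrite ?unclean_card //.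
      by rewrite subr_ge0 ltW.
    by rewrite gerBl.
  apply: ler_prod => q; rewrite inE => /andP[_ /h_ge ->].
  by rewrite andbT subr_ge0 ltW.
have PG0 : 0 <= PG.
  rewrite PGE; apply: prodr_ge0 => q qG.
  by apply: le_trans (h_ge q (subsetP GW _ qG)); rewrite subr_ge0 ltW.
have pp0 : 0 < (1 - p) ^+ (#|S| * #|S :|: Z|) by rewrite exprn_gt0 // subr_gt0.
rewrite ler_pdivlMr //.
have WGE : \prod_(q in W) h q = PG * \prod_(q in W :\: clean S Z) h q.
  by rewrite (big_setID (clean S Z)) /= (setIidPr GW) PGE.
apply: (@le_trans _ _ (\prod_(v in S) ratio s p v * \prod_(v in S) keep s p v)).
  rewrite WE WGE -mulrA; apply: ler_pM => //; first by rewrite mulr_ge0 // ltW.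
  by rewrite ler_wpM2l.
rewrite -big_split /= -prodr_const; apply: ler_prod => v vS.
rewrite ratio_keep ?(subsetP SA) // ge_min lexx orbT andbT.
have /andP[k0 _] := keep_bounds (subsetP SA _ vS).
by rewrite le_min ltW //=; case/andP: kap01 => /ltW.
Qed.

Lemma rest_disjoint v : {in enum (edges_at v) &, forall e f, e != f -> [disjoint e :\ v & f :\ v]}.
Proof.
move=> e f; rewrite !mem_enum => ve vf; apply: contraNT; rewrite -setI_eq0.
move=> /set0Pn[u]; rewrite !inE => /andP[/andP[uv ue] /andP[_ uf]].
by apply/eqP; apply: edges_at_eq uv ve vf ue uf.
Qed.

Lemma Pr_step2 v : v \in s.2 ->
  Pr wt (fun om => v \in (step c i s om).2) = keep s p v * Pr wt (passes v).
Proof.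
move=> vs; pose av om := avoids selected (fun e => e :\ v) (enum (edges_at v)) om.
transitivity (Pr wt (fun om => av om && passes v om)).
  by apply: eq_Pr => om; rewrite mem_step2 vs.
rewrite (@Pr_indep _ _ _ _ wt_sum1 [set j | ~~ j.2] [set j | j.2]); first last.
- by rewrite -setI_eq0; apply/eqP/setP => j; rewrite !inE andNb.
- by move=> om om' e; apply: dep_passes => j; rewrite inE => /eqP ->; apply: e; rewrite inE.
- move=> om om' e; apply: (@dep_avoids _ _ _ ixp selected dep_selected) => j /imsetP[u _ ->].
  by apply: e; rewrite inE.
congr (_ * _); rewrite /av.
rewrite (Pr_avoids_disjoint wt_sum1 ixp_inj dep_selected (enum_uniq _) (@rest_disjoint v)).
by rewrite big_enum /=; apply: eq_bigr => e _; rewrite pall_selected.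
Qed.

Lemma Pr_step2_ge v : v \in s.2 ->
  Num.min (keep s p v) kap - 1 / N.+1%:R <= Pr wt (fun om => v \in (step c i s om).2).
Proof.
move=> vs; rewrite Pr_step2 // -ratio_keep //; have /andP[k0 k1] := keep_bounds vs.
have /andP[h _] := Pr_passes v.
apply: le_trans (ler_wpM2l (ltW k0) h); rewrite mulrBr [_ * ratio _ _ _]mulrC lerD2l lerN2.
by rewrite ler_piMl // divr_ge0 ?ler0n.
Qed.

Lemma Pr_prop_step2 v : Pr wt (fun om => prop_at c i v om && (v \in (step c i s om).2)) =
  p * Pr wt (fun om => v \in (step c i s om).2).
Proof.
rewrite -(Pr_prop c v ir); apply: (@Pr_indep _ _ _ _ wt_sum1 [set ixp v] (~: [set ixp v])).
- by move=> om om' e; rewrite /prop_at e ?inE.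
- move=> om om' e; rewrite !mem_step2; congr [&& _, _ & _].
    apply: eq_in_all => f; rewrite mem_enum => fE; congr (~~ _).
    apply: (@dep_in_all _ _ _ ixp selected dep_selected) => j /imsetP[u uF ->].
    apply: e; rewrite !inE; apply: contraTN uF => /eqP/ixp_inj ->.
    by rewrite !inE eqxx.
  by apply: dep_passes => j; rewrite inE => /eqP ->; apply: e; rewrite !inE /ixc /ixp xpair_eqE andbF.
- by rewrite -setI_eq0 setICr.
Qed.

Lemma good_step om : good (step c i s om).
Proof.
move=> v e; rewrite mem_step2 => /and3P[_ /allP H _] eE.
by rewrite subset_step1; apply: H; rewrite mem_enum.
Qed.

End OneRound.
End Step.

(** * The nibble *)

Section Rounds.
Variables (R : realFieldType) (V : finType) (E : {set {set V}}) (k D : nat).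
Variables (m rounds N : nat) (pi : nat -> R) (kap : R).
Hypothesis pi01 : forall i, 0 <= pi i < 1.
Hypothesis kap01 : 0 < kap <= 1.
Hypothesis k_ge2 : (1 < k)%N.
Hypothesis lin : linear_hypergraph E.
Hypothesis unif : uniform k E.
Hypothesis degE : forall v, (#|edges_at E v| <= D)%N.

Local Notation Om := {ffun index V m rounds -> coord N}.
Local Notation wt := (@wt R V m rounds N pi).
Local Notation wt_ge0 := (wt_ge0 pi01).
Local Notation wt_sum1 := (@wt_sum1 R V m rounds N pi).
Local Notation step := (step E pi kap).
Implicit Types (c : 'I_m) (om : Om) (S Z : {set V}).

Definition st c i om : state V := iteri i (fun j s => step c j s om) (set0, setT).

Lemma stS c i om : st c i.+1 om = step c i (st c i om) om.
Proof. by []. Qed.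

Definition past c i : {set index V m rounds} :=
  [set j : index V m rounds | (j.1.1.1 == c) && (j.1.1.2 < i)%N].

Lemma prop_at_past c i j v om om' : (i < j)%N -> (i <= rounds)%N ->
  {in past c j, forall a, om a = om' a} -> prop_at c i v om = prop_at c i v om'.
Proof. by move=> ij ir e; rewrite /prop_at e // inE /= eqxx inordK. Qed.

Lemma coin_at_past c i j v om om' : (i < j)%N -> (i <= rounds)%N ->
  {in past c j, forall a, om a = om' a} -> coin_at c i v om = coin_at c i v om'.
Proof. by move=> ij ir e; rewrite /coin_at e // inE /= eqxx inordK. Qed.

Lemma eq_step c i s om om' : prop_at c i ^~ om =1 prop_at c i ^~ om' ->
  coin_at c i ^~ om =1 coin_at c i ^~ om' -> step c i s om = step c i s om'.
Proof.
move=> e1 e2; rewrite /step.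
have -> : [set v in s.2 | prop_at c i v om] = [set v in s.2 | prop_at c i v om'].
  by apply/setP => v; rewrite !inE e1.
by congr pair; apply/setP => v; rewrite !inE e2.
Qed.

Lemma dep_st c i : (i <= rounds.+1)%N -> depends_on (past c i) (st c i).
Proof.
elim: i => [|i IHi] ir om om' e //; rewrite !stS.
rewrite (IHi (ltnW ir) om om') => [|a].
  apply: eq_step => v; [exact: (prop_at_past v _ ir e) | exact: (coin_at_past v _ ir e)].
rewrite !inE => /andP[ac ai]; apply: e; rewrite inE ac /=; exact: leqW.
Qed.

Lemma dep_step c i s om om' : (i <= rounds)%N ->
  (forall j, j \in ~: past c i -> om j = om' j) -> step c i s om = step c i s om'.
Proof.
move=> ir e; apply: eq_step => v; rewrite /prop_at /coin_at e //.
- by rewrite !inE /= inordK // ltnn andbF.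
- by rewrite !inE /= inordK // ltnn andbF.
Qed.

(** The state after [i] rounds depends on [past c i] only, so the remaining coordinates may be
    redrawn afresh. *)
Lemma Ex_round c i (F : state V -> Om -> R) :
  (i <= rounds.+1)%N -> (forall s, depends_on (~: past c i) (F s)) ->
  Ex wt (fun om => F (st c i om) om) =
  Ex wt (fun om => Ex wt (fun om' => F (st c i om) om')).
Proof.
move=> ir dF; rewrite (Ex_merge wt_sum1 (past c i)).
apply: eq_Ex => om; apply: eq_Ex => om'.
have -> : st c i (merge (past c i) om om') = st c i om.
  by apply: dep_st => // j jp; rewrite ffunE jp.
apply: dF => j; rewrite inE => jp.
by rewrite ffunE (negbTE jp).
Qed.

Lemma Pr_round c i (F : state V -> Om -> bool) :
  (i <= rounds.+1)%N -> (forall s, depends_on (~: past c i) (F s)) ->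
  Pr wt (fun om => F (st c i om) om) =
  Ex wt (fun om => Pr wt (fun om' => F (st c i om) om')).
Proof.
move=> ir dF; apply: (Ex_round (F := fun s om => (F s om)%:R)) => // s om om' e.
by rewrite (dF s om om' e).
Qed.

Lemma card_rest e v : e \in edges_at E v -> #|e :\ v| = k.-1.
Proof.
by rewrite inE => /andP[eE ve]; rewrite -(unif eE) [in RHS](cardsD1 v) ve.
Qed.

Lemma good_st c i om : good E (st c i om).
Proof.
case: i => [|i]; last exact: good_step.
move=> v e _ eE; rewrite subset0 -cards_eq0 (card_rest eE).
by case: k k_ge2 => [|[]].
Qed.

(** Heuristic values: [lam i] for the probability of being available after [i] rounds, [xs i] for
    that of being selected. *)
Definition lam i : R := kap ^+ i.
Definition xs i : R := \sum_(j < i) pi j * lam j.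

Lemma lam_gt0 i : 0 < lam i. Proof. by rewrite exprn_gt0 //; case/andP: kap01. Qed.
Lemma lamX_ge0 i n : 0 <= lam i ^+ n. Proof. by rewrite exprn_ge0 // ltW // lam_gt0. Qed.
Lemma pi_ge0 i : 0 <= pi i. Proof. by case/andP: (pi01 i). Qed.
Lemma xsS i : xs i.+1 = xs i + pi i * lam i. Proof. by rewrite /xs big_ord_recr. Qed.
Lemma xs_ge0 i : 0 <= xs i.
Proof. by apply: sumr_ge0 => j _; rewrite mulr_ge0 ?pi_ge0 ?(ltW (lam_gt0 _)). Qed.
Lemma xs_le i j : (i <= j)%N -> xs i <= xs j.
Proof.
elim: j => [|j IHj]; first by rewrite leqn0 => /eqP ->.
rewrite leq_eqVlt => /predU1P[->//|/IHj h]; apply: le_trans h _.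
by rewrite xsS lerDl mulr_ge0 ?pi_ge0 ?(ltW (lam_gt0 _)).
Qed.

Local Notation Xi c i om := (st c i om).1.
Local Notation Ai c i om := (st c i om).2.

Definition mon c i S Z om := (S \subset Ai c i om) && (Z \subset Xi c i om).

Lemma gfun_le c i om (p : R) u : 0 <= p ->
  gfun (st c i om) p u <= (u \in Xi c i om)%:R + p * (u \in Ai c i om)%:R.
Proof.
move=> p0; rewrite /gfun; case: ifP => _; first by rewrite lerDl mulr_ge0.
by case: ifP => _; rewrite ?mulr1 ?mulr0 add0r.
Qed.

Lemma gprod_le c i om (F : {set V}) :
  \prod_(u in F) gfun (st c i om) (pi i) u <=
  \prod_(u in F) ((u \in Xi c i om)%:R + pi i * (u \in Ai c i om)%:R).
Proof.
apply: ler_prod => u _; rewrite gfun_le ?pi_ge0 // andbT.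
by case/andP: (gfun01 pi01 i (st c i om) u).
Qed.

(** * The correlation bound, by induction on the rounds *)

Section Correlation.
Variables (M tht xmax : R) (N0 : nat).
Local Notation npair := (k.-1 + k.-2)%N.
Hypothesis M_ge1 : 1 <= M.
Hypothesis M_lam : 1 <= M * lam rounds.+1.
Hypothesis tht_ge0 : 0 <= tht.
Hypothesis C1 : forall i, 1 <= (1 + tht / 2) * (1 - pi i) ^+ (N0 * N0).
Hypothesis xs_xmax : xs rounds.+1 <= xmax.
Hypothesis C2 : (N0 * N0 * D * k)%:R * (xmax * M ^+ 2) ^+ npair <= tht / 2 * kap ^+ N0.

Let M_lam_i i : (i <= rounds.+1)%N -> 1 <= M * lam i.
Proof.
move=> ir; apply: le_trans M_lam _; rewrite ler_wpM2l //; first by apply: le_trans M_ge1.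
have /andP[k0 k1] := kap01.
by rewrite /lam; apply: ler_wiXn2l => //; exact: ltW.
Qed.

Lemma sum_pi_le i : (i <= rounds.+1)%N -> \sum_(j < i) pi j <= M * xs i.
Proof.
move=> ir; rewrite /xs mulr_sumr; apply: ler_sum => j _.
rewrite mulrCA -[leLHS]mulr1 ler_wpM2l ?pi_ge0 //; apply: M_lam_i.
by apply: leq_trans ir; apply: ltnW.
Qed.

(** Selected vertices have been proposed, and proposals are independent. Availability is forgotten
    altogether: [Ex_mixed_le] is run with 1 in place of [lam]. *)
Lemma Pr_selected_le c i Z : (i <= rounds.+1)%N ->
  Pr wt (fun om => Z \subset Xi c i om) <= (\sum_(j < i) pi j) ^+ #|Z|.
Proof.
elim: i Z => [|i IHi] Z ir.
  rewrite /st /= subset0; have [->|Z0] := eqVneq Z set0.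
    by rewrite cards0 expr0; apply: Pr_le1; [exact: wt_ge0 | exact: wt_sum1].
  rewrite big_ord0 expr0n cards_eq0 (negbTE Z0) -[leRHS](Ex_cst wt_sum1).
  by apply: Ex_le; [exact: wt_ge0 | move=> om].
rewrite (Pr_round (F := fun s om => Z \subset (step c i s om).1)) ?(ltnW ir) //; last first.
  by move=> s om om' e; rewrite (dep_step s ir e).
apply: (@le_trans _ _ (Ex wt (fun om => ((set0 \subset Ai c i om) && (set0 \subset Xi c i om))%:R *
   \prod_(u in Z) ((u \in Xi c i om)%:R + pi i * (u \in Ai c i om)%:R)))).
  apply: Ex_le => [|om]; first exact: wt_ge0.
  rewrite !sub0set mul1r; apply: le_trans (gprod_le _ _ _ _).
  rewrite -(@pall_selected R V m rounds N pi c i (st c i om) ir).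
  rewrite -(Pr_in_all wt_sum1 (@ixp_inj V m rounds c i) (@dep_selected V m rounds N c i (st c i om))).
  by apply: Pr_le => [|om']; [exact: wt_ge0 | rewrite subset_step1].
have mono S' Z' : [disjoint S' & Z'] -> (#|S'| + #|Z'|)%N = #|Z| ->
    Pr wt (fun om => (S' \subset Ai c i om) && (Z' \subset Xi c i om)) <=
    1 * 1 ^+ #|S'| * (\sum_(j < i) pi j) ^+ #|Z'|.
  move=> _ _; rewrite expr1n !mul1r; apply: le_trans (IHi Z' (ltnW ir)).
  by apply: Pr_le => [|om /andP[]] //; exact: wt_ge0.
have d0 : [disjoint (set0 : {set V}) & (set0 : {set V})] by rewrite -setI_eq0 setI0.
have dZ : [disjoint (set0 : {set V}) :|: set0 & Z] by rewrite -setI_eq0 setU0 set0I.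
apply: le_trans (Ex_mixed_le (pi_ge0 i) mono d0 dZ _) _; first by rewrite cards0.
by rewrite cards0 !expr0 !mulr1 mul1r big_ord_recr.
Qed.

(* The second factor makes the correlation bound trivial (corr_crude) from N0 vertices on,
   where the error terms of the induction would no longer be small. *)
Definition corr i n : R := (1 + tht) ^+ i * (1 + M ^+ (2 * n) / M ^+ N0).

Let M_gt0 : 0 < M. Proof. exact: lt_le_trans M_ge1. Qed.

Lemma corr_ge i n : M ^+ (2 * n) / M ^+ N0 <= corr i n.
Proof.
have X0 : 0 <= M ^+ (2 * n) / M ^+ N0 by rewrite divr_ge0 // exprn_ge0 // ltW.
rewrite /corr -[leLHS]mul1r; apply: ler_pM => //; first by rewrite exprn_ege1 // lerDl.
by rewrite lerDr.
Qed.

(** The price M^2 per additional vertex. *)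
Lemma corr_shift i n j : corr i (n + j) <= corr i n * (M ^+ 2) ^+ j.
Proof.
rewrite /corr -mulrA ler_wpM2l ?exprn_ge0 ?addr_ge0 //.
rewrite mulnDr exprD (exprM M 2 j) [_ * _ / _]mulrAC mulrDl mul1r.
by rewrite lerD2r exprn_ege1 // exprn_ege1.
Qed.

Let corr_ge0 i n : 0 <= corr i n.
Proof. by apply: le_trans (corr_ge i n); rewrite divr_ge0 // exprn_ge0 // ltW. Qed.

Let bound_ge0 i j n a b : 0 <= corr i n * lam i ^+ a * xs j ^+ b.
Proof. by apply: mulr_ge0; [apply: mulr_ge0 (corr_ge0 _ _) (lamX_ge0 _ _) | exact: exprn_ge0 (xs_ge0 _)]. Qed.

(** Against the heuristic value, the bound from [Pr_selected_le] loses at most M per vertex; for n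
    >= N0 the total M^n is below M^(2n) / M^N0. *)
Lemma corr_crude c i S Z : (i <= rounds.+1)%N -> (N0 <= #|S| + #|Z|)%N ->
  Pr wt (mon c i S Z) <= corr i (#|S| + #|Z|) * lam i ^+ #|S| * xs i ^+ #|Z|.
Proof.
move=> ir nN; set n := (#|S| + #|Z|)%N.
apply: (@le_trans _ _ ((M * xs i) ^+ #|Z|)).
  apply: (@le_trans _ _ (Pr wt (fun om => Z \subset Xi c i om))).
    by apply: Pr_le => [|om /andP[]] //; exact: wt_ge0.
  apply: le_trans (Pr_selected_le c Z ir) _; apply: lerXn2r; rewrite ?nnegrE ?sum_pi_le //.
    by apply: sumr_ge0 => j _; apply: pi_ge0.
  by rewrite mulr_ge0 ?xs_ge0 // ltW.
rewrite exprMn ler_wpM2r ?exprn_ge0 ?xs_ge0 //.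
apply: (@le_trans _ _ (M ^+ n * lam i ^+ #|S|)).
  rewrite /n exprD mulrAC -exprMn ler_peMl ?exprn_ge0 ?(ltW M_gt0) //.
  by rewrite exprn_ege1 // M_lam_i.
rewrite ler_wpM2r ?lamX_ge0 //.
apply: le_trans (corr_ge i n); rewrite ler_pdivlMr ?exprn_gt0 //.
by rewrite mul2n -addnn exprD ler_wpM2l ?exprn_ge0 ?(ltW M_gt0) // ler_weXn2l.
Qed.

Lemma corr_Ex c i n : (forall S Z, [disjoint S & Z] -> (#|S| + #|Z|)%N = n ->
    Pr wt (mon c i S Z) <= corr i n * lam i ^+ #|S| * xs i ^+ #|Z|) ->
  forall S Z, [disjoint S & Z] -> (#|S| + #|Z|)%N = n ->
  Ex wt (fun om => (S \subset Ai c i om)%:R * \prod_(u in Z) gfun (st c i om) (pi i) u) <=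
  corr i n * lam i ^+ #|S| * xs i.+1 ^+ #|Z|.
Proof.
move=> H S Z dSZ cn.
have := @Ex_mixed_le R _ _ V wt (fun om => Xi c i om) (fun om => Ai c i om) (pi i)
  (xs i) (lam i) (corr i n) n (pi_ge0 i) H S set0 Z.
rewrite cards0 expr0 mulr1 setU0 addn0 -xsS; move=> /(_ _ dSZ cn).
rewrite -setI_eq0 setI0 eqxx => /(_ isT); apply: le_trans.
apply: Ex_le => [|om]; first exact: wt_ge0.
by rewrite sub0set andbT ler_wpM2l // gprod_le.
Qed.

(** Clean pairs at one vertex have disjoint rests, and a clean edge contains no second vertex of
    [S]. So meeting rests come from distinct edges at distinct vertices, and these share exactly one
    vertex. *)
Lemma pair_bound S Z : forall q q', q \in clean E S Z -> q' \in clean E S Z -> q != q' ->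
  meets (rest q) (rest q') ->
  [/\ #|rest q :|: rest q'| = (k.-1 + k.-2)%N, [disjoint S :|: Z & rest q :|: rest q']
    & q.1 != q'.1].
Proof.
move=> q q' qG q'G qq' mt.
have dq := clean_disjoint qG; have dq' := clean_disjoint q'G.
move: qG q'G; rewrite !inE => /and3P[qS qE /eqP qc] /and3P[q'S q'E /eqP q'c].
have /set0Pn[u] : rest q :&: rest q' != set0 by rewrite setI_eq0.
rewrite !inE => /andP[/andP[uq ue] /andP[uq' ue']].
have fst_neq : q.1 != q'.1.
  apply: contraNneq qq' => e; rewrite (surjective_pairing q) (surjective_pairing q') e.
  by apply/eqP; congr pair; apply: (edges_at_eq lin uq' _ _ ue ue'); rewrite inE ?q'E // -e.
have sS : q'.1 \in q.2 -> False.
  move=> h; have /setP/(_ q'.1) := qc; rewrite !inE h q'S /= => /esym/eqP e.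
  by rewrite e eqxx in fst_neq.
have e_neq : q.2 != q'.2.
  by apply/eqP => e; apply: sS; rewrite e; case/andP: q'E.
have I1 : rest q :&: rest q' = [set u].
  apply/eqP; rewrite eq_sym eqEcard sub1set !inE uq ue uq' ue' /= cards1.
  case/andP: qE => qE1 _; case/andP: q'E => q'E1 _.
  apply: leq_trans (lin qE1 q'E1 e_neq); apply: subset_leq_card.
  by apply: setISS; apply: subsetDl.
split => //.
  rewrite cardsU I1 cards1 !card_rest ?inE //; last first.
  by rewrite -addnBA ?subn1 //; case: k k_ge2 => [|[]].
by rewrite -setI_eq0 setIUr setU_eq0 !setI_eq0 dq dq'.
Qed.

Lemma card_clean S Z : (#|clean E S Z| <= #|S| * D)%N.
Proof.
apply: (@leq_trans (\sum_(v in S) #|edges_at E v|)); last first.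
  by rewrite -sum_nat_const; apply: leq_sum.
rewrite -sum1_card (eq_bigr (fun v => \sum_(e in edges_at E v) 1)%N); last first.
  by move=> v _; rewrite sum1_card.
rewrite pair_big_dep /= [leqLHS]big_mkcond [leqRHS]big_mkcond.
apply: leq_sum => q _; rewrite [q \in _]inE.
by case: (q.1 \in S); case: (q.2 \in _); case: (_ == _).
Qed.

(** A partner is determined by its own vertex in [S] and by a shared vertex in [rest q]. *)
Lemma card_partners S Z q : q \in clean E S Z ->
  (#|[set q' in clean E S Z | (q != q') && meets (rest q) (rest q')]| <= #|S| * k.-1)%N.
Proof.
move=> qG; set B := [set _ in _ | _].
pose f (q' : V * {set V}) := (q'.1, odflt q.1 [pick u in rest q :&: rest q']).
have fP q' : q' \in B -> [/\ q' \in clean E S Z, (f q').2 \in rest q & (f q').2 \in rest q'].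
  rewrite inE => /andP[-> /andP[_]]; rewrite /meets -setI_eq0 => /set0Pn[u uI].
  rewrite /f /=; case: pickP => [a|/(_ u)]; last by rewrite uI.
  by rewrite inE => /andP[-> ->].
have finj : {in B &, injective f}.
  move=> [v e] [v' e'] /fP[h1 _ h2] /fP[h1' _ h2'] ef.
  have ev : v = v' by case: ef.
  rewrite -ef in h2'; congr pair => //.
  move: h1 h1'; rewrite ![_ \in clean _ _ _]inE => /and3P[_ vE _] /and3P[_ v'E _].
  move: h2 h2'; rewrite ![_ \in rest _]inE => /andP[uv ue] /andP[_ ue'].
  rewrite in_set1 in uv.
  by apply: (edges_at_eq lin uv vE _ ue ue'); rewrite [(v, e).1]ev.
have cr : #|rest q| = k.-1 by apply: card_rest; move: qG; rewrite inE => /and3P[].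
rewrite -cr -cardsX -(card_in_imset finj); apply: subset_leq_card.
apply/subsetP => y /imsetP[q' q'B ->]; have [h1 h2 _] := fP q' q'B.
by rewrite in_setX h2 andbT; move: h1; rewrite inE => /and3P[].
Qed.

(** Up to size [N0], a round multiplies the bound by at most [kap ^+ #|S|] times 1 + tht, apart from
    the passage to the next [xs]. One half of [tht] absorbs the unclean edges through [C1], the
    other the pairs of edges through [C2]. *)
Lemma correlation c i S Z : (i <= rounds.+1)%N -> [disjoint S & Z] ->
  Pr wt (mon c i S Z) <= corr i (#|S| + #|Z|) * lam i ^+ #|S| * xs i ^+ #|Z|.
Proof.
elim: i S Z => [|i IHi] S Z ir dSZ.
  have [->|Z0] := eqVneq Z set0.
    rewrite cards0 expr0 mulr1 addn0 /lam expr0 expr1n mulr1 /corr expr0 mul1r.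
    apply: (@le_trans _ _ 1); first by apply: Pr_le1; [exact: wt_ge0 | exact: wt_sum1].
    by rewrite lerDl divr_ge0 // exprn_ge0 // ltW.
  apply: (@le_trans _ _ 0); last exact: bound_ge0.
  rewrite -[leRHS](Ex_cst wt_sum1); apply: Ex_le => [|om]; first exact: wt_ge0.
  by rewrite /mon /st /= subset0 (negbTE Z0) andbF.
have [nN|Nn] := leqP (#|S| + #|Z|) N0; last exact: corr_crude (ltnW Nn).
have ir' := ltnW ir.
set n := (#|S| + #|Z|)%N.
have IH n' : forall S' Z', [disjoint S' & Z'] -> (#|S'| + #|Z'|)%N = n' ->
    Pr wt (mon c i S' Z') <= corr i n' * lam i ^+ #|S'| * xs i ^+ #|Z'|.
  by move=> S' Z' d' <-; apply: IHi.
rewrite /mon (Pr_round (F := fun s om => (S \subset (step c i s om).2) && (Z \subset (step c i s om).1))) //; last first.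
  by move=> s om om' e; rewrite (dep_step s ir e).
set A := kap ^+ #|S| / (1 - pi i) ^+ (#|S| * #|S :|: Z|).
apply: (@le_trans _ _ (Ex wt (fun om => A * ((S \subset Ai c i om)%:R *
   \prod_(u in Z) gfun (st c i om) (pi i) u) +
   \sum_(q in clean E S Z) \sum_(q' in clean E S Z | (q != q') && meets (rest q) (rest q'))
     ((S \subset Ai c i om)%:R * \prod_(u in Z :|: (rest q :|: rest q')) gfun (st c i om) (pi i) u)))).
  apply: Ex_le => [|om]; first exact: wt_ge0.
  apply: le_trans (@Pr_step_le R V E m rounds N pi kap pi01 kap01 lin c i _ ir (@good_st c i om) S Z dSZ) _.
  rewrite mulrDr [_ * A]mulrC lerD2l mulr_sumr; apply: ler_sum => q qG.
  rewrite mulr_sumr; apply: ler_sum => q' /and3P[q'G qq' mt].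
  have [_ d _] := pair_bound qG q'G qq' mt.
  rewrite -mulrA -prod_setU //.
  by apply: disjointWl d; apply: subsetUr.
rewrite ExD ExZ.
have E1 := corr_Ex (IH n) dSZ erefl.
have E2 : Ex wt (fun om =>
   \sum_(q in clean E S Z) \sum_(q' in clean E S Z | (q != q') && meets (rest q) (rest q'))
     ((S \subset Ai c i om)%:R * \prod_(u in Z :|: (rest q :|: rest q')) gfun (st c i om) (pi i) u)) <=
   (#|S| * D)%:R * ((#|S| * k.-1)%:R * (corr i (n + npair) * lam i ^+ #|S| * xs i.+1 ^+ (#|Z| + npair))).
  rewrite Ex_sum; under eq_bigr do rewrite Ex_sum.
  set b := corr i (n + npair) * _ * _.
  have b0 : 0 <= b by exact: bound_ge0.
  apply: (@le_trans _ _ (\sum_(a in clean E S Z) (#|S| * k.-1)%:R * b)).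
    apply: ler_sum => a aG.
    apply: (@le_trans _ _ (\sum_(a' in clean E S Z | (a != a') && meets (rest a) (rest a')) b)).
      apply: ler_sum => a' /and3P[a'G aa' mt].
      have [cu d _] := pair_bound aG a'G aa' mt.
      have dZ : [disjoint Z & rest a :|: rest a'] by apply: disjointWl d; apply: subsetUr.
      have cZ : #|Z :|: (rest a :|: rest a')| = (#|Z| + npair)%N.
        by rewrite cardsU cu; move: dZ; rewrite -setI_eq0 => /eqP ->; rewrite cards0 subn0.
      rewrite /b -cZ; apply: (corr_Ex (IH (n + npair)%N)); last by rewrite cZ addnA.
      rewrite -setI_eq0 setIUr setU_eq0 !setI_eq0 dSZ /=.
      by apply: disjointWl d; apply: subsetUl.
    rewrite sumr_const -[leLHS]mulr_natl ler_wpM2r // ler_nat.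
    apply: leq_trans (card_partners aG); rewrite leq_eqVlt; apply/orP; left.
    by apply/eqP; apply: eq_card => a'; rewrite [RHS]inE.
  rewrite sumr_const -[leLHS]mulr_natl; apply: ler_wpM2r; first by rewrite mulr_ge0.
  by rewrite ler_nat card_clean.
set X := corr i n in E1; set l := lam i ^+ #|S|; set y := xs i.+1 ^+ #|Z|; set K := kap ^+ #|S|.
have /andP[k0 k1] := kap01.
have K0 : 0 < K by apply: exprn_gt0.
have KN : kap ^+ N0 <= K.
  by rewrite /K; apply: (ler_wiXn2l (ltW k0) k1); apply: leq_trans nN; apply: leq_addr.
have -> : corr i.+1 n * lam i.+1 ^+ #|S| * y = (1 + tht) * X * (K * l) * y.
  by rewrite /X /corr exprS /lam exprS exprMn -!mulrA.
have Xly : 0 <= X * l * y by apply: bound_ge0.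
have A_le : A <= K * (1 + tht / 2).
  have /andP[p0 p1] := pi01 i.
  rewrite /A ler_pdivrMr ?exprn_gt0 ?subr_gt0 // -mulrA ler_peMr //; first exact: ltW.
  apply: le_trans (C1 i) _; rewrite ler_wpM2l //; first by rewrite addr_ge0 // divr_ge0.
  apply: ler_wiXn2l; rewrite ?subr_ge0 ?gerBl ?(ltW p1) //.
  apply: leq_mul; first by apply: leq_trans nN; apply: leq_addr.
  by rewrite cardsU; apply: leq_trans nN; apply: leq_subr.
have T1 : A * Ex wt (fun om => (S \subset Ai c i om)%:R * \prod_(u in Z) gfun (st c i om) (pi i) u)
    <= K * (1 + tht / 2) * (X * l * y).
  apply: ler_pM => //; first by rewrite divr_ge0 ?exprn_ge0 ?subr_ge0 ?(ltW k0) //; case/andP: (pi01 i) => _ /ltW.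
  apply: Ex_ge0 => [|om]; first exact: wt_ge0.
  by rewrite mulr_ge0 // prodr_ge0 // => u _; case/andP: (gfun01 pi01 i (st c i om) u).
apply: le_trans (lerD T1 E2) _.
(* The pair terms come without the factor [kap ^+ #|S|], which is at least [kap ^+ N0]; hence that
   factor on the right of [C2]. *)
have T2 : (#|S| * D)%:R * ((#|S| * k.-1)%:R * (corr i (n + npair) * l * xs i.+1 ^+ (#|Z| + npair)))
   <= K * (tht / 2) * (X * l * y).
  have sN : (#|S| <= N0)%N by apply: leq_trans nN; apply: leq_addr.
  apply: (@le_trans _ _ ((N0 * N0 * D * k)%:R * ((X * (M ^+ 2) ^+ npair) * l * (y * xmax ^+ npair)))).
    rewrite mulrA -natrM; apply: ler_pM => //.
    - by rewrite bound_ge0.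
    - rewrite ler_nat; apply: (@leq_trans (N0 * D * (N0 * k))%N); last by rewrite mulnACA mulnA.
      by rewrite leq_mul // leq_mul // leq_pred.
    - apply: ler_pM; rewrite ?exprn_ge0 ?xs_ge0 //.
      + by rewrite mulr_ge0 ?lamX_ge0.
      + by rewrite ler_wpM2r ?lamX_ge0 // corr_shift.
      + rewrite exprD ler_wpM2l ?exprn_ge0 ?xs_ge0 //; apply: lerXn2r; rewrite ?nnegrE ?xs_ge0 //.
          by apply: le_trans xs_xmax; apply: xs_ge0.
        by apply: le_trans xs_xmax; apply: xs_le.
  have -> : (N0 * N0 * D * k)%:R * (X * (M ^+ 2) ^+ npair * l * (y * xmax ^+ npair)) =
      ((N0 * N0 * D * k)%:R * (xmax * M ^+ 2) ^+ npair) * (X * l * y).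
    have AC (a1 a2 a3 x1 l1 y1 : R) :
      a1 * (x1 * a3 * l1 * (y1 * a2)) = a1 * (a2 * a3) * (x1 * l1 * y1) by ring.
    by rewrite AC [(xmax * _) ^+ _]exprMn.
  apply: ler_wpM2r => //; apply: le_trans C2 _; rewrite mulrC ler_wpM2r //.
  by rewrite divr_ge0.
apply: le_trans (lerD (lexx _) T2) _.
have AC (a1 t x1 l1 y1 : R) : a1 * (1 + t / 2) * (x1 * l1 * y1) + a1 * (t / 2) * (x1 * l1 * y1) =
  (1 + t) * x1 * (a1 * l1) * y1 by field.
by rewrite AC.
Qed.

(** * Lower bounds for availability and for the colour classes *)

Section Density.
Variables (gam e1 pm : R) (r : nat).
Hypothesis gam_gt0 : 0 < gam.
Hypothesis kapE : kap = 1 - (1 + e1) * gam.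
Hypothesis kap_half : 1 / 2 <= kap.
Hypothesis incr : forall i, (i <= rounds)%N -> D%:R * (xs i.+1 ^+ k.-1 - xs i ^+ k.-1) <= gam.
Hypothesis pi_pm : forall i, pi i <= pm.
Hypothesis r_pm : r%:R * pm < (1 + e1) * gam.
Hypothesis tht_small : (1 + tht) ^+ rounds.+1 <= 2.
Hypothesis r_N0 : (2 * (1 + r * k.-1) <= N0)%N.

(** The output of [factorial_markov] when loads with total at most [gam] have to reach (1 + e1) gam;
    the 4 bounds [corr]. *)
Definition del0 : R := 4 * (gam / ((1 + e1) * gam - r%:R * pm)) ^+ r.
Hypothesis N_large : 1 / N.+1%:R <= del0 * lam rounds.+1.

Let den_gt0 : 0 < (1 + e1) * gam - r%:R * pm. Proof. by rewrite subr_gt0. Qed.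

Lemma del0_ge0 : 0 <= del0.
Proof. by rewrite mulr_ge0 // exprn_ge0 // divr_ge0 // ltW. Qed.

Lemma corr_le4 i n : (i <= rounds.+1)%N -> (2 * n <= N0)%N -> corr i n <= 4.
Proof.
move=> ir nN; have -> : 4 = 2 * 2 :> R by rewrite -natrM.
rewrite /corr.
apply: ler_pM; rewrite ?exprn_ge0 ?addr_ge0 ?divr_ge0 ?exprn_ge0 ?(ltW M_gt0) //.
  by apply: le_trans tht_small; apply: ler_weXn2l => //; rewrite lerDl.
rewrite -[leRHS]/(1 + 1) lerD2l ler_pdivrMr ?exprn_gt0 // mul1r.
exact: ler_weXn2l.
Qed.

Let rest_disjoint_at v : {in edges_at E v &, forall e f, e != f -> [disjoint e :\ v & f :\ v]}.
Proof. by move=> e f eE fE ef; apply: (rest_disjoint lin _ _ ef); rewrite mem_enum. Qed.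

(** If [keep] is below [kap], then by [sum_prod_le1] the loads [edgep] sum to at least 1 - kap = (1
    + e1) gam. On the event that [v] is available, a product of q of them has expectation at most 4
    lam b^q, where D b <= gam. *)
Lemma overload c i v : (i <= rounds)%N ->
  Pr wt (fun om => (v \in Ai c i om) && (keep E (st c i om) (pi i) v < kap)%R) <= del0 * lam i.
Proof.
move=> ir; have ir1 : (i <= rounds.+1)%N := leqW ir.
pose g e om : R := (v \in Ai c i om)%:R * edgep (st c i om) (pi i) v e.
(* Cut off outside the edges at [v]: the bound by [pi i] is required for every [e], and [edgep_le]
   gives it only at [v]. *)
pose g' e om : R := if e \in edges_at E v then g e om else 0.
pose b := xs i.+1 ^+ k.-1 - xs i ^+ k.-1.
have b_ge0 : 0 <= b.
  by rewrite subr_ge0; apply: lerXn2r; rewrite ?nnegrE ?xs_ge0 // xs_le.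
have g_ge0 e om : 0 <= g e om by rewrite mulr_ge0 // edgep_ge0.
have g'_ge0 e om : 0 <= g' e om by rewrite /g'; case: ifP.
have g'_le e om : g' e om <= pi i.
  rewrite /g' /g; case: ifP => eE; last exact: pi_ge0.
  case: (boolP (v \in _)) => vA; last by rewrite mul0r pi_ge0.
  by rewrite mul1r; apply: (edgep_le pi01 i (@good_st c i om) vA eE).
have r_pi : r%:R * pi i < (1 + e1) * gam.
  by apply: le_lt_trans r_pm; rewrite ler_wpM2l.
have mom (Q : {set {set V}}) : Q \subset edges_at E v -> (#|Q| <= r)%N ->
    Ex wt (fun om => (v \in Ai c i om)%:R * \prod_(e in Q) g' e om) <= (4 * lam i) * b ^+ #|Q|.
  move=> QE Qr; set n := (#|[set v]| + #|(set0 : {set V})| + #|Q| * k.-1)%N.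
  have mono S Z : [disjoint S & Z] -> (#|S| + #|Z|)%N = n ->
    Pr wt (fun om => (S \subset Ai c i om) && (Z \subset Xi c i om)) <=
    corr i n * lam i ^+ #|S| * xs i ^+ #|Z|.
    by move=> dSZ <-; apply: correlation.
  have dv e : e \in Q -> [disjoint [set v] :|: set0 & e :\ v].
    by move=> _; rewrite setU0 disjoints1 !inE eqxx.
  have d0 : [disjoint [set v] & (set0 : {set V})] by rewrite -setI_eq0 setI0.
  have hc e : e \in Q -> #|e :\ v| = k.-1 by move=> eQ; apply: card_rest (subsetP QE e eQ).
  have dQ : {in Q &, forall e f, e != f -> [disjoint e :\ v & f :\ v]}.
    by move=> e f eQ fQ; apply: rest_disjoint_at; apply: (subsetP QE).
  have := @Ex_edges_le _ _ _ _ wt _ _ _ _ _ _ _ (pi_ge0 i) mono _ (fun e => e :\ v) k.-1 Q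
    [set v] set0 hc dQ dv d0 erefl (ltW (lam_gt0 i)) (xs_ge0 i).
  rewrite -xsS -/b cards1 cards0 !expr1 expr0 mulr1 => hE.
  apply: le_trans (le_trans hE _); last first.
    rewrite ler_wpM2r ?exprn_ge0 // ler_wpM2r ?(ltW (lam_gt0 i)) //.
    apply: corr_le4 => //; rewrite /n cards1 cards0 addn0.
    apply: leq_trans r_N0; rewrite leq_mul2l /= leq_add2l.
    by apply: leq_mul.
  apply: Ex_le => [|om]; first exact: wt_ge0.
  rewrite sub1set sub0set andbT; case: (boolP (v \in _)) => vA; last by rewrite !mul0r.
  rewrite !mul1r; apply: ler_prod => e eQ; rewrite g'_ge0 /=.
  have eE := subsetP QE e eQ; rewrite /g' eE /g vA mul1r.
  (* [good] makes this product vanish, so the subtraction in [Ex_edges_le] is free. *)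
  have -> : \prod_(u in e :\ v) (u \in Xi c i om)%:R = 0 :> R.
    by rewrite -indicator_prod (negbTE (good_st vA eE)).
  by rewrite subr0 /edgep gprod_le.
have C0 : 0 <= 4 * lam i by rewrite mulr_ge0 // ltW // lam_gt0.
have hF := @factorial_markov _ _ _ wt wt_ge0 _ (edges_at E v) g' (fun om => (v \in Ai c i om)%:R)
  (pi i) b (4 * lam i) ((1 + e1) * gam) r (fun om => ler0n _ _) g'_ge0 g'_le (pi_ge0 i) mom r_pi b_ge0 C0.
apply: le_trans (le_trans hF _); last first.
  rewrite /del0 mulrAC ler_wpM2r ?(ltW (lam_gt0 i)) // ler_wpM2l //.
  have den_i : 0 < (1 + e1) * gam - r%:R * pi i by rewrite subr_gt0.
  apply: lerXn2r; rewrite ?nnegrE ?divr_ge0 ?mulr_ge0 ?(ltW den_i) ?(ltW gam_gt0) ?(ltW den_gt0) //.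
  apply: ler_pM; rewrite ?mulr_ge0 ?invr_ge0 ?(ltW den_i) //.
    apply: le_trans (incr ir); rewrite ler_wpM2r // ler_nat; exact: degE.
  by rewrite lef_pV2 ?posrE // lerD2l lerN2 ler_wpM2l.
apply: Ex_le => [|om]; first exact: wt_ge0.
case: (boolP (v \in _)) => vA /=; last by rewrite mul0r.
rewrite mul1r ler_nat; case: ltP => // kl /=.
rewrite (_ : (_ <= _)%R = true) //.
have -> : \sum_(e in edges_at E v) g' e om = \sum_(e <- enum (edges_at E v)) edgep (st c i om) (pi i) v e.
  by rewrite big_enum /=; apply: eq_bigr => e eE; rewrite /g' eE /g vA mul1r.
have g01 e : 0 <= edgep (st c i om) (pi i) v e <= 1.
  by rewrite edgep_ge0 //=; apply: prodr_ile1 => u _; apply: gfun01.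
have /andP[h _] := @sum_prod_le1 R _ (enum (edges_at E v)) (edgep (st c i om) (pi i) v) g01.
 have : keep E (st c i om) (pi i) v < 1 - (1 + e1) * gam by rewrite -kapE.
by move: h; rewrite /keep [X in _ <= X]big_enum /=; lra.
Qed.

Lemma Pr_step_st c i (P : state V -> bool) : (i <= rounds)%N ->
  Pr wt (fun om => P (st c i.+1 om)) =
  Ex wt (fun om => Pr wt (fun om' => P (step c i (st c i om) om'))).
Proof.
move=> ir; rewrite (Pr_round (F := fun s om => P (step c i s om))) ?leqW //.
by move=> s om om' e; rewrite (dep_step s ir e).
Qed.

(** A round costs the factor [kap], the overloaded states and the rounding of the coin. The last two
    are at most del0 lam i each; since kap >= 1/2, they fit into one further 4 del0. *)
Lemma Pr_avail_ge c i v : (i <= rounds.+1)%N ->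
  lam i * (1 - 4 * del0 * i%:R) <= Pr wt (fun om => v \in Ai c i om).
Proof.
elim: i => [|i IHi] ir.
  rewrite /lam expr0 mulr0 subr0 mulr1 -{1}[1](Ex_cst wt_sum1).
  by apply: Ex_le => [|om]; [exact: wt_ge0 | rewrite /st /= inE].
have ir' : (i <= rounds)%N by [].
rewrite (@Pr_step_st c i (fun s => v \in s.2) ir').
apply: (@le_trans _ _ (Ex wt (fun om => kap * (v \in Ai c i om)%:R
   - ((v \in Ai c i om) && (keep E (st c i om) (pi i) v < kap)%R)%:R - 1 / N.+1%:R))); last first.
  apply: Ex_le => [|om]; first exact: wt_ge0.
  have N_ge0 : 0 <= 1 / N.+1%:R :> R by rewrite divr_ge0.
  have P0 : 0 <= Pr wt (fun om' => v \in (step c i (st c i om) om').2) by apply: Pr_ge0; exact: wt_ge0.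
  case: (boolP (v \in _)) => vA /=; last by apply: le_trans P0; rewrite mulr0 subr0 sub0r oppr_le0.
  apply: le_trans (Pr_step2_ge N pi01 kap01 lin c ir' (@good_st c i om) vA).
  rewrite lerD2r mulr1; have /andP[k0 _] := keep_bounds pi01 i (@good_st c i om) vA.
  by case: ltP => _; rewrite /= ?subr0 // lerBlDr; have /andP[_ k1] := kap01; lra.
rewrite !ExB ExZ (Ex_cst wt_sum1).
have h1 := overload c v ir'; rewrite /Pr in h1.
have h2 := IHi (ltnW ir); rewrite /Pr in h2.
have l0 := lam_gt0 i; have d0 := del0_ge0.
have h3 : 1 / N.+1%:R <= del0 * lam i.
  apply: le_trans N_large _; rewrite ler_wpM2l //.
  by have /andP[k0 k1] := kap01; apply: (ler_wiXn2l (ltW k0) k1); apply: leqW.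
have /andP[k0 k1] := kap01.
have h4 := ler_wpM2l (ltW k0) h2.
have h5 : 2 * (del0 * lam i) <= kap * (4 * del0 * lam i).
  have : 0 <= del0 * lam i by rewrite mulr_ge0 // ltW.
  have := kap_half; nra.
rewrite [lam i.+1]exprS -/(lam i) -[i.+1%:R]natr1.
have fin (kp l n d a1 a2 a3 : R) : a2 <= d * l -> a3 <= d * l ->
    kp * (l * (1 - 4 * d * n)) <= kp * a1 -> 2 * (d * l) <= kp * (4 * d * l) ->
    kp * l * (1 - 4 * d * (n + 1)) <= kp * a1 - a2 - a3 by lra.
exact: fin h1 h3 h4 h5.
Qed.

(** Being selected is not enough: the vertex must survive the very round in which it is proposed. *)
Definition class c om : {set V} :=
  [set v | [exists i : 'I_rounds.+1, prop_at c i v om && (v \in Ai c i.+1 om)]].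

Lemma avail_sub c i om v : v \in Ai c i.+1 om -> v \in Ai c i om.
Proof. by rewrite stS mem_step2 => /and3P[]. Qed.

Lemma selected_mono c i j om : (i <= j)%N -> Xi c i om \subset Xi c j om.
Proof.
elim: j => [|j IHj]; first by rewrite leqn0 => /eqP ->.
rewrite leq_eqVlt => /predU1P[->//|/IHj h]; apply: subset_trans h _.
by rewrite stS /step /= subsetUl.
Qed.

Lemma class_independent c om e : e \in E -> ~~ (e \subset class c om).
Proof.
move=> eE; apply/negP => /subsetP eX.
pose ok v (i : 'I_rounds.+1) := prop_at c i v om && (v \in Ai c i.+1 om).
pose f v : nat := if [pick i | ok v i] is Some i then i : nat else 0%N.
have fP v : v \in e -> prop_at c (f v) v om /\ v \in Ai c (f v).+1 om.
  move=> /eX; rewrite inE => /existsP[i oki]; rewrite /f; case: pickP => [j /andP[] //|/(_ i)].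
  by rewrite /ok oki.
have [v0 v0e] : exists v, v \in e by apply/card_gt0P; rewrite (unif eE); apply: ltnW.
pose v := [arg max_(u > v0 in e) f u].
have [ve vmax] : v \in e /\ forall u, u \in e -> (f u <= f v)%N.
  by rewrite /v; case: arg_maxnP.
have [_ vA] := fP v ve.
have : e \in edges_at E v by rewrite inE eE ve.
move=> /(good_st vA)/negP; apply; apply/subsetP => u /setD1P[_ ue].
have [pu uA] := fP u ue; apply: (subsetP (selected_mono c om (vmax u ue : (f u).+1 <= (f v).+1)%N)).
by rewrite stS /step /= !inE pu (avail_sub uA) orbT.
Qed.

Lemma Pr_prop2 c i j u v : (i <= rounds)%N -> (j <= rounds)%N -> (i, u) != (j, v) ->
  Pr wt (fun om => prop_at c i u om && prop_at c j v om) = pi i * pi j.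
Proof.
move=> ir jr ne; rewrite -(Pr_prop N pi c u ir) -(Pr_prop N pi c v jr).
apply: (@Pr_indep _ _ _ _ wt_sum1 [set (c, inord i, u, false)] [set (c, inord j, v, false)]).
- by move=> om om' e; rewrite /prop_at e ?inE.
- by move=> om om' e; rewrite /prop_at e ?inE.
rewrite disjoints1 inE; apply: contraNneq ne => -[/(congr1 val) /= + ->].
by rewrite !inordK // => ->.
Qed.

Local Notation T := (M * xs rounds.+1).

Lemma Pr_class_pair c u v : u != v ->
  Pr wt (fun om => (u \in class c om) && (v \in class c om)) <= T ^+ 2.
Proof.
move=> uv; apply: (@le_trans _ _ ((\sum_(i < rounds.+1) pi i) ^+ 2)); last first.
  apply: lerXn2r; rewrite ?nnegrE ?sum_pi_le //; first by apply: sumr_ge0 => i _; apply: pi_ge0.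
  by rewrite mulr_ge0 ?xs_ge0 // ltW.
rewrite expr2 mulr_suml; under eq_bigr do rewrite mulr_sumr.
rewrite (eq_bigr (fun i : 'I_rounds.+1 => \sum_(j < rounds.+1)
    Pr wt (fun om => prop_at c i u om && prop_at c j v om))); last first.
  move=> i _; apply: eq_bigr => j _; rewrite Pr_prop2 ?leq_ord //.
  by apply: contraNneq uv => -[_ ->].
rewrite /Pr -(eq_bigr _ (fun i _ => Ex_sum wt _ _ _)) -Ex_sum.
apply: Ex_le => [|om]; first exact: wt_ge0.
case: andP => [[]|_]; last by apply: sumr_ge0 => i _; apply: sumr_ge0.
rewrite !inE => /existsP[i /andP[pi_u _]] /existsP[j /andP[pj_v _]].
rewrite (bigD1 i) //= (bigD1 j) //= pi_u pj_v -addrA lerDl.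
by rewrite addr_ge0 // sumr_ge0 // => i' _; apply: sumr_ge0.
Qed.

Lemma Pr_prop_avail c i v : (i <= rounds)%N ->
  Pr wt (fun om => prop_at c i v om && (v \in Ai c i.+1 om)) =
  pi i * Pr wt (fun om => v \in Ai c i.+1 om).
Proof.
move=> ir; rewrite (Pr_round (F := fun s om => prop_at c i v om && (v \in (step c i s om).2))) ?leqW //; last first.
  by move=> s om om' e; rewrite (dep_step s ir e) /prop_at e // !inE /= inordK // ltnn andbF.
rewrite (@Pr_step_st c i (fun s => v \in s.2) ir) -ExZ.
by apply: eq_Ex => om; rewrite (@Pr_prop_step2 R V E m rounds N pi kap c i _ ir v).
Qed.

(** If n rounds succeed for [v], the indicator of membership is at least n - (n^2 - n), because (n -
    1)^2 >= 0; the correction is at most the number of ordered pairs of proposals. *)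
Lemma Pr_class_ge c v :
  kap * (1 - 4 * del0 * rounds.+1%:R) * xs rounds.+1 - T ^+ 2 <=
  Pr wt (fun om => v \in class c om).
Proof.
pose a i om := prop_at c i v om && (v \in Ai c i.+1 om).
apply: (@le_trans _ _ (Ex wt (fun om => \sum_(i < rounds.+1) (a i om)%:R -
   \sum_(i < rounds.+1) \sum_(j < rounds.+1 | i != j) (prop_at c i v om && prop_at c j v om)%:R))).
  rewrite ExB !Ex_sum; apply: lerB.
    rewrite /xs mulr_sumr; apply: ler_sum => i _.
    have ir : (i <= rounds)%N by rewrite -ltnS.
    rewrite -[Ex _ _]/(Pr wt (a i)) Pr_prop_avail // mulrCA ler_wpM2l ?pi_ge0 //.
    apply: le_trans (Pr_avail_ge c v (ltn_ord i)).
    rewrite [lam i.+1]exprS -/(lam i) mulrAC ler_wpM2l //.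
      by rewrite mulr_ge0 // ltW ?lam_gt0 //; case/andP: kap01.
    rewrite lerD2l lerN2; apply: ler_wpM2l; first by rewrite mulr_ge0 // del0_ge0.
    by rewrite ler_nat.
  apply: (@le_trans _ _ ((\sum_(i < rounds.+1) pi i) ^+ 2)); last first.
    apply: lerXn2r; rewrite ?nnegrE ?sum_pi_le //; first by apply: sumr_ge0 => i _; apply: pi_ge0.
    by rewrite mulr_ge0 ?xs_ge0 // ltW.
  rewrite expr2 mulr_suml; apply: ler_sum => i _; rewrite mulr_sumr Ex_sum.
  rewrite [leRHS](bigID (fun j => i != j)) /= -[leLHS]addr0; apply: lerD; last first.
    by apply: sumr_ge0 => j _; rewrite mulr_ge0 ?pi_ge0.
  apply: ler_sum => j ij; rewrite -[Ex _ _]/(Pr wt _) Pr_prop2 ?leq_ord //.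
  by apply: contraNneq ij => -[/val_inj ->].
apply: Ex_le => [|om]; first exact: wt_ge0.
pose n : R := \sum_(i < rounds.+1) (a i om)%:R.
have sq : n * n - n <= \sum_(i < rounds.+1) \sum_(j < rounds.+1 | i != j) (prop_at c i v om && prop_at c j v om)%:R.
  rewrite {1}/n mulr_suml -sumrB; apply: ler_sum => i _.
  rewrite {1}/n mulr_sumr (bigD1 i) //= addrAC.
  have -> : (a i om)%:R * (a i om)%:R - (a i om)%:R = 0 :> R by case: (a i om); rewrite ?mulr1 ?mul0r subrr.
  rewrite add0r; under eq_bigl do rewrite eq_sym.
  apply: ler_sum => j _; rewrite /a -natrM mulnb ler_nat.
  by case: (prop_at c i v om); case: (prop_at c j v om); case: (v \in _); case: (v \in _).
have : (v \in class c om)%:R >= n - (n * n - n).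
  case: (boolP (v \in class c om)) => vX.
    have : 0 <= (n - 1) * (n - 1) by rewrite -expr2 sqr_ge0.
    by rewrite /=; lra.
  suff -> : n = 0 by rewrite mul0r !subr0.
  apply: big1 => i _; case: (boolP (a i om)) => // ai.
  by case/negP: vX; rewrite inE; apply/existsP; exists i.
by rewrite -/n; lra.
Qed.

End Density.

End Correlation.
End Rounds.

(** * One batch of colours *)

Section Balls.
Variables (V : finType) (E : {set {set V}}) (k D : nat).
Hypothesis unif : uniform k E.
Hypothesis degE : forall v, (#|edges_at E v| <= D)%N.

Definition nbh1 v : {set V} := v |: \bigcup_(e in edges_at E v) e.
Definition nbh (S : {set V}) : {set V} := \bigcup_(v in S) nbh1 v.
Definition ball n v : {set V} := iter n nbh [set v].

Lemma card_bigcup_leq (J : finType) (A : {set J}) (F : J -> {set V}) (B : nat) :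
  (forall j, j \in A -> #|F j| <= B)%N -> (#|\bigcup_(j in A) F j| <= #|A| * B)%N.
Proof.
move=> FB; apply: (@leq_trans (\sum_(j in A) #|F j|)); last first.
  by rewrite -sum_nat_const; apply: leq_sum.
elim/big_ind2: _ => [|x1 x2 y1 y2 h1 h2|//]; first by rewrite cards0.
by apply: leq_trans (leq_add h1 h2); rewrite cardsU leq_subr.
Qed.

Lemma card_nbh1 v : (#|nbh1 v| <= (k * D).+1)%N.
Proof.
rewrite /nbh1 cardsU1 -add1n; apply: leq_add; first by case: (_ \notin _).
apply: (@leq_trans (#|edges_at E v| * k)); last by rewrite mulnC leq_mul2l degE orbT.
by apply: card_bigcup_leq => e; rewrite inE => /andP[/unif ->].
Qed.

Lemma card_ball n v : (#|ball n v| <= (k * D).+1 ^ n)%N.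
Proof.
elim: n => [|n IHn]; first by rewrite cards1.
apply: (@leq_trans (#|ball n v| * (k * D).+1)).
  by apply: card_bigcup_leq => u _; apply: card_nbh1.
by rewrite expnSr leq_mul2r IHn orbT.
Qed.

Lemma nbhS (A B : {set V}) : A \subset B -> nbh A \subset nbh B.
Proof.
move=> /subsetP AB; apply/subsetP => u /bigcupP[v /AB vB uv].
by apply/bigcupP; exists v.
Qed.

Lemma iter_nbhS n (A B : {set V}) : A \subset B -> iter n nbh A \subset iter n nbh B.
Proof. by move=> AB; elim: n => //= n; apply: nbhS. Qed.

Lemma iter_nbh_self n (A : {set V}) : A \subset iter n nbh A.
Proof.
elim: n => //= n IHn; apply: subset_trans IHn _; apply/subsetP => u uA.
by apply/bigcupP; exists u; rewrite // !inE eqxx.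
Qed.

Lemma nbh_set1 v : nbh [set v] = nbh1 v.
Proof. by rewrite /nbh big_set1. Qed.

Lemma nbh1_sym u v : (u \in nbh1 v) = (v \in nbh1 u).
Proof.
suff H a b : a \in nbh1 b -> b \in nbh1 a by apply/idP/idP; apply: H.
rewrite !inE => /orP[/eqP -> | /bigcupP[e]]; first by rewrite eqxx.
rewrite inE => /andP[eE be] ae; apply/orP; right; apply/bigcupP; exists e => //.
by rewrite inE eE ae.
Qed.

Lemma ball_sub n u v : u \in nbh1 v -> ball n u \subset ball n.+1 v.
Proof.
by move=> uv; rewrite /ball iterSr; apply: iter_nbhS; rewrite sub1set nbh_set1.
Qed.

Lemma ball_self n v : v \in ball n v.
Proof. by rewrite -sub1set iter_nbh_self. Qed.

Lemma ball_mono n n' v : (n <= n')%N -> ball n v \subset ball n' v.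
Proof.
by move=> nn'; rewrite -(subnK nn') /ball iterD; apply: iter_nbh_self.
Qed.

Lemma ball_sym n u v : (u \in ball n v) = (v \in ball n u).
Proof.
suff H m a b : a \in ball m b -> b \in ball m a by apply/idP/idP; apply: H.
elim: m a b => [|m IHm] a b; first by rewrite !inE eq_sym.
case/bigcupP => x /IHm bx ax; apply: (subsetP (@ball_sub m x a _)) => //.
by rewrite nbh1_sym.
Qed.

Lemma ball_meet n u v : ~~ [disjoint ball n u & ball n v] -> v \in ball (n + n) u.
Proof.
rewrite -setI_eq0 => /set0Pn[x /setIP[xu xv]]; rewrite ball_sym in xv.
have : v \in iter n nbh [set x] := xv.
rewrite /ball iterD; apply: (subsetP (iter_nbhS _ _)).
by rewrite sub1set.
Qed.

End Balls.

Lemma forall_prod (R : comNzRingType) (C : finType) (P : C -> bool) :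
  [forall c, P c]%:R = \prod_c (P c)%:R :> R.
Proof.
case: (boolP [forall c, P c]) => [/forallP H|/forallPn[c Pc]].
  by rewrite big1 // => c _; rewrite H.
by rewrite (bigD1 c) //= (negbTE Pc) mul0r.
Qed.

(** * Locality of the classes and the degree left by a batch *)

Section Batch.
Variables (R : realFieldType) (V : finType) (E : {set {set V}}) (k D : nat).
Variables (m rounds N : nat) (pi : nat -> R) (kap : R).
Hypothesis pi01 : forall i, 0 <= pi i < 1.
Hypothesis k_ge2 : (1 < k)%N.
Hypothesis lin : linear_hypergraph E.
Hypothesis unif : uniform k E.
Hypothesis degE : forall v, (#|edges_at E v| <= D)%N.

Local Notation Om := {ffun index V m rounds -> coord N}.
Local Notation wt := (@wt R V m rounds N pi).
Local Notation wt_ge0 := (wt_ge0 pi01).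
Local Notation wt_sum1 := (@wt_sum1 R V m rounds N pi).
Local Notation st := (@st R V E m rounds N pi kap).
Local Notation class := (@class R V E m rounds N pi kap).
Local Notation ball := (ball E).
Implicit Types (c : 'I_m) (om : Om) (S Z W : {set V}).

Definition agree W om om' := forall j : index V m rounds, j.1.2 \in W -> om j = om' j.

Lemma agreeS W W' om om' : W \subset W' -> agree W' om om' -> agree W om om'.
Proof. by move=> /subsetP WW' ag j /WW'; apply: ag. Qed.

(** A round looks only at neighbours, so the radius grows by one per round. *)
Lemma st_local c i v om om' : agree (ball i v) om om' ->
  (v \in (st c i om).1) = (v \in (st c i om').1) /\
  (v \in (st c i om).2) = (v \in (st c i om').2).
Proof.
elim: i v => [|i IHi] v ag; first by [].
have IH u : u \in nbh1 E v -> (u \in (st c i om).1) = (u \in (st c i om').1) /\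
    (u \in (st c i om).2) = (u \in (st c i om').2).
  by move=> uv; apply: IHi; apply: agreeS ag; apply: ball_sub.
have sel u : u \in nbh1 E v -> selected c i (st c i om) u om = selected c i (st c i om') u om'.
  move=> uv; have [h1 h2] := IH u uv; rewrite /selected h1 h2 /prop_at ag //.
  by apply: (subsetP (ball_sub i uv)); apply: ball_self.
have vv : v \in nbh1 E v by rewrite !inE eqxx.
have nb e u : e \in edges_at E v -> u \in e -> u \in nbh1 E v.
  by move=> eE ue; rewrite !inE; apply/orP; right; apply/bigcupP; exists e.
split; first by rewrite !stS !step1E !inE; apply: sel.
rewrite !stS !mem_step2; have [_ ->] := IH v vv; congr [&& _, _ & _].
  apply: eq_in_all => e; rewrite mem_enum => eE; congr (~~ _).
  by apply: eq_forallb_in => u /setD1P[_ ue]; apply: sel (nb _ _ eE ue).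
rewrite /passes; have -> : ratio E kap (st c i om) (pi i) v = ratio E kap (st c i om') (pi i) v.
  rewrite /ratio; suff -> : keep E (st c i om) (pi i) v = keep E (st c i om') (pi i) v by [].
  apply: eq_bigr => e eE; congr (1 - _); apply: eq_bigr => u /setD1P[_ ue].
  by have [h1 h2] := IH u (nb _ _ eE ue); rewrite /gfun h1 h2.
by rewrite /coin_at ag //; apply: ball_self.
Qed.

Lemma class_local c v om om' : agree (ball rounds.+1 v) om om' ->
  (v \in class c om) = (v \in class c om').
Proof.
move=> ag; rewrite [LHS]inE [RHS]inE; apply: eq_existsb => i.
have sub : ball i.+1 v \subset ball rounds.+1 v by apply: ball_mono; apply: ltn_ord.
have [_ ->] := @st_local c i.+1 v om om' (agreeS sub ag).
by rewrite /prop_at ag //; apply: ball_self.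
Qed.

Lemma class_dep c om om' : (forall j, j.1.1.1 == c -> om j = om' j) -> class c om = class c om'.
Proof.
move=> e; apply/setP => v; rewrite [LHS]inE [RHS]inE; apply: eq_existsb => i.
rewrite (@dep_st _ V E m rounds N pi kap c i.+1 (ltn_ord i) om om') => [|j].
  by rewrite /prop_at e.
by rewrite inE => /andP[jc _]; apply: e.
Qed.

Definition uncovered om : {set V} := ~: \bigcup_c class c om.

Lemma uncoveredE Z om : (Z \subset uncovered om) = [forall c, [disjoint Z & class c om]].
Proof.
rewrite /uncovered -disjoints_subset.
apply/idP/forallP => [d c|d].
  by apply: disjointWr d; apply/subsetP => u uc; apply/bigcupP; exists c.
by apply/bigcup_disjointP => c _; apply: d.
Qed.

Variables (p T2 : R).
Hypothesis p_le : forall c v, p <= Pr wt (fun om => v \in class c om).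
Hypothesis T2_ge0 : 0 <= T2.
Hypothesis T2_ge : forall c u v, u != v ->
  Pr wt (fun om => (u \in class c om) && (v \in class c om)) <= T2.

(** With n vertices of [Z] in the class, the indicator of n = 0 is at most 1 - n + (n^2 - n). *)
Lemma Pr_disjoint_class c Z :
  Pr wt (fun om => [disjoint Z & class c om]) <= 1 - #|Z|%:R * p + (#|Z| * #|Z|)%:R * T2.
Proof.
pose n om : R := \sum_(u in Z) (u \in class c om)%:R.
apply: (@le_trans _ _ (Ex wt (fun om => 1 - n om +
   \sum_(u in Z) \sum_(v in Z | u != v) ((u \in class c om) && (v \in class c om))%:R))).
  apply: Ex_le => [|om]; first exact: wt_ge0.
  have -> : \sum_(u in Z) \sum_(v in Z | u != v) ((u \in class c om) && (v \in class c om))%:R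
      = n om * n om - n om.
    rewrite {1}/n mulr_suml -sumrB; apply: eq_bigr => u uZ.
    rewrite {1}/n mulr_sumr [X in X - _](bigD1 u) //= addrAC.
    have -> : (u \in class c om)%:R * (u \in class c om)%:R - (u \in class c om)%:R = 0 :> R.
      by case: (u \in _); rewrite ?mulr1 ?mul0r subrr.
    rewrite add0r; apply: eq_big => [v|v _]; first by rewrite [u == v]eq_sym.
    by rewrite -natrM mulnb.
  case: (boolP [disjoint Z & _]) => dZ; last first.
    have : 0 <= (n om - 1) * (n om - 1) by rewrite -expr2 sqr_ge0.
    by rewrite /=; lra.
  suff -> : n om = 0 by rewrite mul0r !subr0 addr0.
  by apply: big1 => u uZ; rewrite (disjointFr dZ uZ).
rewrite ExD ExB (Ex_cst wt_sum1) !Ex_sum; apply: lerD.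
  rewrite lerD2l lerN2 mulr_natl -sumr_const; apply: ler_sum => u _; exact: p_le.
apply: (@le_trans _ _ (\sum_(u in Z) #|Z|%:R * T2)); last first.
  by rewrite sumr_const -[leLHS]mulr_natl mulrA -natrM.
apply: ler_sum => u uZ; rewrite Ex_sum.
apply: (@le_trans _ _ (\sum_(v in Z | u != v) T2)).
  by apply: ler_sum => v /andP[_ uv]; apply: T2_ge.
rewrite mulr_natl -[leRHS]sumr_const big_mkcondr /=; apply: ler_sum => v _.
by case: ifP.
Qed.

Lemma Pr_uncovered Z :
  Pr wt (fun om => Z \subset uncovered om) <=
  (1 - #|Z|%:R * p + (#|Z| * #|Z|)%:R * T2) ^+ m.
Proof.
rewrite /Pr.
have -> : Ex wt (fun om => (Z \subset uncovered om)%:R) =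
    Ex wt (fun om => \prod_(c <- index_enum 'I_m) ([disjoint Z & class c om])%:R).
  by apply: eq_Ex => om; rewrite uncoveredE forall_prod.
pose J c := [set j : index V m rounds | j.1.1.1 == c].
pose F c om : R := ([disjoint Z & class c om])%:R.
have dF c : depends_on (J c) (F c).
  by move=> om om' e; rewrite /F (@class_dep c om om') // => j jc; apply: e; rewrite inE.
have dJ : {in index_enum 'I_m &, forall c c', c != c' -> [disjoint J c & J c']}.
  move=> c c' _ _ cc'; rewrite -setI_eq0; apply/eqP/setP => j; rewrite !inE.
  by apply/negP => /andP[/eqP e1 /eqP e2]; rewrite -e1 -e2 eqxx in cc'.
rewrite (@Ex_indep_prod R _ _ wt wt_sum1 _ (index_enum 'I_m) J F (index_enum_uniq _) dF dJ).
apply: (@le_trans _ _ (\prod_(c < m) (1 - #|Z|%:R * p + (#|Z| * #|Z|)%:R * T2))); last first.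
  by rewrite prodr_const card_ord.
apply: ler_prod => c _; apply/andP; split; last exact: Pr_disjoint_class.
by apply: Pr_ge0; exact: wt_ge0.
Qed.

Variables (C b w0 : R) (r : nat).
Hypothesis C_ge0 : 0 <= C.
Hypothesis b_ge0 : 0 <= b.
Hypothesis moment : forall j, (j <= r)%N ->
  (1 - (j * k.-1)%:R * p + ((j * k.-1) * (j * k.-1))%:R * T2) ^+ m <= C * b ^+ j.
Hypothesis r_w0 : r%:R < w0.
Hypothesis lll : 4 * (C * (D%:R * b / (w0 - r%:R)) ^+ r) *
  ((k * D).+1 ^ (rounds.+2 + rounds.+2))%:R <= 1.

(** Leaving out [v] overestimates the remaining degree, but makes the sets that belong to different
    edges disjoint. *)
Definition surviving v om : {set {set V}} :=
  [set e in edges_at E v | e :\ v \subset uncovered om].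

(** A factorial moment of order [r] bounds the probability of a bad vertex. The event depends on a
    ball of radius one more than a class does, and two such balls meet only within twice the
    radius. *)
Lemma batch_exists : exists om, forall v, (#|surviving v om|)%:R < w0.
Proof.
pose bad v om := (w0 <= (#|surviving v om|)%:R)%R.
pose vbl v := [set j : index V m rounds | j.1.2 \in ball rounds.+2 v].
pose q := C * (D%:R * b / (w0 - r%:R)) ^+ r.
have q_ge0 : 0 <= q.
  by rewrite mulr_ge0 // exprn_ge0 // divr_ge0 ?mulr_ge0 // subr_ge0 ltW.
have deg_le v : (#|[set u | ~~ [disjoint vbl v & vbl u]]| <= (k * D).+1 ^ (rounds.+2 + rounds.+2))%N.
  apply: leq_trans (card_ball unif degE (rounds.+2 + rounds.+2) v).
  apply: subset_leq_card; apply/subsetP => u; rewrite inE => nd; apply: ball_meet.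
  apply: contra nd; rewrite -!setI_eq0 => /eqP uv; apply/eqP/setP => j.
  by have /setP/(_ j.1.2) := uv; rewrite !inE.
have bad_le v : Pr wt (bad v) <= q.
  pose g e om : R := (e :\ v \subset uncovered om)%:R.
  have h1 om : 0 <= (fun=> 1 : R) om by [].
  have h2 e om : 0 <= g e om by [].
  have h3 e om : g e om <= 1 by rewrite lern1 leq_b1.
  have h4 (Q : {set {set V}}) : Q \subset edges_at E v -> (#|Q| <= r)%N ->
      Ex wt (fun om => 1 * \prod_(e in Q) g e om) <= C * b ^+ #|Q|.
    move=> QE Qr; apply: le_trans (moment Qr).
    pose Z := \bigcup_(e in Q) (e :\ v).
    have cZ : #|Z| = (#|Q| * k.-1)%N.
      rewrite /Z; have tr : trivIset [set e :\ v | e in Q].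
        apply/trivIsetP => A B /imsetP[e eQ ->] /imsetP[f fQ ->] ef.
        apply: (rest_disjoint lin); rewrite ?mem_enum ?(subsetP QE) //.
        by apply: contraNneq ef => ->.
      have inj : {in Q &, injective (fun e => e :\ v)}.
        move=> e f eQ fQ ef; apply/eqP; apply: contraTT isT => nef.
        have := @rest_disjoint V E lin v e f; rewrite !mem_enum !(subsetP QE) // => /(_ isT isT nef).
        rewrite -ef -setI_eq0 setIid -cards_eq0 (card_rest unif (subsetP QE _ eQ)).
        by case: (k) k_ge2 => [|[]].
      have -> : \bigcup_(e in Q) (e :\ v) = cover [set e :\ v | e in Q].
        by rewrite /cover big_imset.
      rewrite -(eqP tr) big_imset //= -sum_nat_const; apply: eq_bigr => e eQ.
      exact: (card_rest unif (subsetP QE _ eQ)).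
    rewrite -cZ; apply: le_trans (Pr_uncovered Z); apply: Ex_le => [|om]; first exact: wt_ge0.
    rewrite mul1r; case: (boolP (Z \subset _)) => ZU.
      by apply: prodr_ile1 => e _; rewrite h2 h3.
    have [e eQ ne] : exists2 e, e \in Q & ~~ (e :\ v \subset uncovered om).
      apply/exists_inP; apply: contraR ZU; rewrite negb_exists_in => /forall_inP H.
      by apply/bigcupsP => e /H; rewrite negbK.
    by rewrite (bigD1 e eQ) /= /g (negbTE ne) mul0r.
  have h5 : r%:R * 1 < w0 by rewrite mulr1.
  have := factorial_markov wt_ge0 h1 h2 h3 ler01 h4 h5 b_ge0 C_ge0.
  rewrite mulr1 => hF; apply: le_trans (le_trans hF _); last first.
    rewrite ler_wpM2l //; apply: lerXn2r; rewrite ?nnegrE ?divr_ge0 ?mulr_ge0 ?subr_ge0 ?(ltW r_w0) //.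
    rewrite ler_wpM2r ?invr_ge0 ?subr_ge0 ?(ltW r_w0) // ler_wpM2r // ler_nat.
    exact: degE.
  apply: Ex_le => [|om]; first exact: wt_ge0.
  rewrite mul1r /bad; suff -> : (#|surviving v om|)%:R = \sum_(e in edges_at E v) g e om :> R by [].
  rewrite -sum1_card natr_sum [LHS]big_mkcond [RHS]big_mkcond /=.
  apply: eq_bigr => e _; rewrite [e \in surviving _ _]inE /g.
  by case: (e \in edges_at E v); case: (e :\ v \subset _).
have dep_bad v : depends_on (vbl v) (bad v).
  move=> om om' e; rewrite /bad; suff -> : surviving v om = surviving v om' by [].
  apply/setP => f; rewrite [LHS]inE [RHS]inE.
  apply: andb_id2l => fE.
  rewrite [LHS]uncoveredE [RHS]uncoveredE; apply: eq_forallb => c.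
  have key : (f :\ v) :&: class c om = (f :\ v) :&: class c om'.
    apply/setP => u; rewrite [LHS]in_setI [RHS]in_setI; apply: andb_id2l => /setD1P[_ uf].
    apply: class_local => j ju; apply: e; rewrite inE.
    apply: (subsetP (ball_sub _ _)) ju; rewrite in_setU1; apply/orP; right.
    by apply/bigcupP; exists f.
  by rewrite -[LHS]setI_eq0 -[RHS]setI_eq0 key.
have d_gt0 : (0 < (k * D).+1 ^ (rounds.+2 + rounds.+2))%N by rewrite expn_gt0.
have [om H] := local_lemma wt_ge0 wt_sum1 dep_bad bad_le q_ge0 d_gt0 deg_le lll.
by exists om => v; have := H v; rewrite /bad -ltNge.
Qed.

End Batch.

(** * Combining the classes with a colouring of the remainder *)

Section Assembly.
Variables (R : realFieldType) (V : finType) (E : {set {set V}}) (k D : nat).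
Hypothesis k_ge2 : (1 < k)%N.
Hypothesis lin : linear_hypergraph E.
Hypothesis unif : uniform k E.
Hypothesis degE : (max_degree E <= D)%N.

Lemma card_edges_at v : (#|edges_at E v| <= D)%N.
Proof. by apply: leq_trans degE; apply: (leq_bigmax (F := degree E)). Qed.

(** Classes may overlap, so a covered vertex takes the colour of any one class containing it. A
    monochromatic edge would lie inside one class or be entirely uncovered. *)
Lemma combine_coloring m q (cl : 'I_m -> {set V}) :
  (forall c e, e \in E -> ~~ (e \subset cl c)) ->
  colorable [set e in E | e \subset ~: \bigcup_c cl c] q -> colorable E (m + q).
Proof.
move=> indep /existsP[col /forall_inP colP].
pose f v : 'I_(m + q) := if [pick c | v \in cl c] is Some c then lshift q c else rshift m (col v).
apply/existsP; exists [ffun v => f v]; apply/forall_inP => e eE; apply/negP => /forall_inP mono.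
have [v0 v0e] : exists v, v \in e by apply/card_gt0P; rewrite (unif eE); apply: ltnW.
have mono0 u : u \in e -> f u = f v0.
  by move=> ue; have /forall_inP/(_ _ v0e) := mono u ue; rewrite !ffunE => /eqP.
have fP v : (exists2 c, v \in cl c & f v = lshift q c) \/
    ((v \in ~: \bigcup_c cl c) /\ f v = rshift m (col v)).
  rewrite /f; case: pickP => [c vc|none]; [by left; exists c | right; split=> //].
  by rewrite inE; apply/negP => /bigcupP[c _]; rewrite none.
have [[c _ f0]|[_ f0]] := fP v0.
  case/negP: (indep c e eE); apply/subsetP => u ue.
  have [[c' uc fu]|[_ fu]] := fP u.
    by move: (mono0 u ue); rewrite f0 fu => /lshift_inj <-.
  by move: (mono0 u ue) => /eqP; rewrite f0 fu eq_rlshift.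
have fr u : u \in e -> (u \in ~: \bigcup_c cl c) /\ col u = col v0.
  move=> ue; have [[c' uc fu]|[uU fu]] := fP u.
    by move: (mono0 u ue) => /eqP; rewrite f0 fu eq_lrshift.
  by move: (mono0 u ue); rewrite f0 fu => /rshift_inj.
have eU : e \in [set e in E | e \subset ~: \bigcup_c cl c].
  by rewrite inE eE; apply/subsetP => u /fr[].
move/negP: (colP e eU); apply; apply/forall_inP => x xe; apply/forall_inP => y ye.
by have [_ ->] := fr x xe; have [_ ->] := fr y ye.
Qed.

Section Batch.
Variables (m rounds N : nat) (pi : nat -> R) (kap : R).
Hypothesis m_gt0 : (0 < m)%N.
Hypothesis pi01 : forall i, 0 <= pi i < 1.
Hypothesis kap01 : 0 < kap <= 1.
Variables (M tht : R) (N0 : nat).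
Let X := xs pi kap rounds.+1.
Hypothesis M_ge1 : 1 <= M.
Hypothesis M_lam : 1 <= M * kap ^+ rounds.+1.
Hypothesis tht_ge0 : 0 <= tht.
Hypothesis C1 : forall i, 1 <= (1 + tht / 2) * (1 - pi i) ^+ (N0 * N0).
Hypothesis C2 : (N0 * N0 * D * k)%:R * (X * M ^+ 2) ^+ (k.-1 + k.-2) <= tht / 2 * kap ^+ N0.
Variables (gam e1 pm : R) (r : nat).
Hypothesis gam_gt0 : 0 < gam.
Hypothesis kapE : kap = 1 - (1 + e1) * gam.
Hypothesis kap_half : 1 / 2 <= kap.
Hypothesis incr : forall i, (i <= rounds)%N ->
  D%:R * (xs pi kap i.+1 ^+ k.-1 - xs pi kap i ^+ k.-1) <= gam.
Hypothesis pi_pm : forall i, pi i <= pm.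
Hypothesis r_pm : r%:R * pm < (1 + e1) * gam.
Hypothesis tht_small : (1 + tht) ^+ rounds.+1 <= 2.
Hypothesis r_N0 : (2 * (1 + r * k.-1) <= N0)%N.
Let del := del0 gam e1 pm r.
Hypothesis N_large : 1 / N.+1%:R <= del * kap ^+ rounds.+1.
Variables (p C b w0 : R) (r2 : nat).
Hypothesis p_le : p <= kap * (1 - 4 * del * rounds.+1%:R) * X - (M * X) ^+ 2.
Hypothesis C_ge0 : 0 <= C.
Hypothesis b_ge0 : 0 <= b.
Hypothesis moment : forall j, (j <= r2)%N ->
  (1 - (j * k.-1)%:R * p + ((j * k.-1) * (j * k.-1))%:R * (M * X) ^+ 2) ^+ m <= C * b ^+ j.
Hypothesis r_w0 : r2%:R < w0.
Hypothesis lll : 4 * (C * (D%:R * b / (w0 - r2%:R)) ^+ r2) *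
  ((k * D).+1 ^ (rounds.+2 + rounds.+2))%:R <= 1.

Lemma batch : exists cl : 'I_m -> {set V},
  (forall c e, e \in E -> ~~ (e \subset cl c)) /\
  forall v, (degree [set e in E | e \subset ~: \bigcup_c cl c] v)%:R < w0.
Proof.
have hp c v : p <= Pr (wt (m := m) (rounds := rounds) (N := N) pi)
    (fun om => v \in class E pi kap c om).
  apply: le_trans p_le _.
  exact: (Pr_class_ge pi01 kap01 k_ge2 lin unif card_edges_at M_ge1 M_lam tht_ge0 C1
    (lexx X) C2 gam_gt0 kapE kap_half incr pi_pm r_pm tht_small r_N0 N_large).
have hT c u v : u != v -> Pr (wt (m := m) (rounds := rounds) (N := N) pi)
    (fun om => (u \in class E pi kap c om) && (v \in class E pi kap c om)) <= (M * X) ^+ 2.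
  exact: (Pr_class_pair E N pi01 kap01 M_ge1 M_lam).
have [om H] := batch_exists pi01 k_ge2 lin unif card_edges_at hp (sqr_ge0 (M * X)) hT
  C_ge0 b_ge0 moment r_w0 lll.
exists (fun c => class E pi kap c om); split.
  by move=> c e; apply: (class_independent pi kap k_ge2 unif).
move=> v; apply: le_lt_trans (H v); rewrite ler_nat; apply: subset_leq_card.
apply/subsetP => e /setIdP[/setIdP[eE eU] ve]; apply/setIdP; split.
  by apply/setIdP.
by apply: subset_trans eU; apply: subsetDl.
Qed.

Lemma batch_color : exists E' : {set {set V}},
  [/\ uniform k E', linear_hypergraph E', (max_degree E')%:R < w0
    & forall q, colorable E' q -> colorable E (m + q)].
Proof.
have [cl [indep surv]] := batch.
exists [set e in E | e \subset ~: \bigcup_c cl c]; split.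
- by move=> e; rewrite inE => /andP[/unif].
- by move=> e f; rewrite !inE => /andP[eE _] /andP[fE _]; apply: lin.
- rewrite /max_degree; elim/big_ind: _ => [|x y xw yw|v _]; last exact: surv.
    by apply: le_lt_trans r_w0; rewrite ler_nat.
  by rewrite /maxn; case: ifP.
- by move=> q; apply: combine_coloring.
Qed.

End Batch.
End Assembly.

(** * Uniformly random colouring *)

Section UniformColoring.
Variables (V : finType) (E : {set {set V}}) (k D q : nat).
Hypothesis k_ge2 : (1 < k)%N.
Hypothesis unif : uniform k E.
Hypothesis degE : (max_degree E <= D)%N.
Hypothesis q_large : (4 * (k * D).+1 <= q ^ k.-1)%N.

Let R := rat.
Let w (v : V) (t : 'I_q) : R := 1 / q%:R.

Let q_gt0 : (0 < q)%N.
Proof. by case: q q_large => //; rewrite exp0n //; case: k k_ge2 => [|[]]. Qed.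

Let w_ge0 v t : 0 <= w v t. Proof. by rewrite divr_ge0. Qed.
Let w_sum1 v : \sum_t w v t = 1.
Proof.
by rewrite sumr_const card_ord -[LHS]mulr_natl mul1r divff // pnatr_eq0 -lt0n.
Qed.

(** The local lemma is indexed by all subsets; a non-edge gets an impossible event and no
    variables. *)
Let bad e (om : {ffun V -> 'I_q}) := (e \in E) && monochromatic om e.
Let vbl (e : {set V}) := if e \in E then e else set0.

Let dep_bad e : depends_on (vbl e) (bad e).
Proof.
rewrite /vbl /bad; case: ifP => //= _ om om' h.
apply: eq_forallb_in => x xe; apply: eq_forallb_in => y ye.
by rewrite !h.
Qed.

Let bad_le e : Pr w (bad e) <= 1 / (q ^ k.-1)%:R.
Proof.
have RHS0 : 0 <= 1 / (q ^ k.-1)%:R :> R by rewrite divr_ge0.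
have [eE|eE] := boolP (e \in E); last first.
  apply: le_trans RHS0; rewrite -[leRHS](Ex_cst w_sum1 0); apply: Ex_le => // om.
  by rewrite /bad (negbTE eE).
have [v0 v0e] : exists v, v \in e by apply/card_gt0P; rewrite (unif eE); apply: ltnW.
pose xin (c : 'I_q) (v : V) (om : {ffun V -> 'I_q}) := om v == c.
have dx c v : depends_on [set v] (xin c v) by move=> om om' h; rewrite /xin h ?inE.
have Pc c : Pr w (in_all (xin c) e) = 1 / q%:R ^+ k.
  rewrite (Pr_in_all w_sum1 (ix := id)) //= /pall.
  rewrite (eq_bigr (fun=> 1 / q%:R)) => [|v _].
    by rewrite prodr_const (unif eE) expr_div_n expr1n.
  rewrite /Pr /xin (Ex_coord w_sum1 v (fun t => (t == c)%:R)).
  rewrite (bigD1 c) //= eqxx mulr1 big1 ?addr0 // => t /negbTE ->.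
  by rewrite mulr0.
apply: (@le_trans _ _ (\sum_(c <- index_enum 'I_q | true) Pr w (fun om => true && in_all (xin c) e om))).
  apply: le_trans (Pr_union_bound w_ge0 _ _ _ _); apply: Pr_le => // om /andP[_ /forall_inP mono].
  apply/hasP; exists (om v0); rewrite ?mem_index_enum //=.
  by apply/forall_inP => v /mono/forall_inP/(_ _ v0e).
rewrite (eq_bigr (fun=> 1 / q%:R ^+ k)) => [|c _]; last by rewrite -(Pc c).
rewrite sumr_const card_ord -[leLHS]mulr_natl -[in leLHS](prednK (ltnW k_ge2)) exprS natrX.
by rewrite mulrA mulr1 invfM mulrA divff ?pnatr_eq0 -?lt0n // !mul1r.
Qed.

Lemma uniform_coloring : colorable E q.
Proof.
have d_gt0 : (0 < (k * D).+1)%N by [].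
have p_ge0 : 0 <= 1 / (q ^ k.-1)%:R :> R by rewrite divr_ge0.
have deg e : (#|[set f | ~~ [disjoint vbl e & vbl f]]| <= (k * D).+1)%N.
  apply: leqW; rewrite {1}/vbl; case: ifP => eE; last first.
    by rewrite (_ : [set _ | _] = set0) ?cards0 //; apply/setP => f; rewrite !inE -setI_eq0 set0I eqxx.
  apply: (@leq_trans #|\bigcup_(v in e) edges_at E v|).
    apply: subset_leq_card; apply/subsetP => f; rewrite inE -setI_eq0 => /set0Pn[v].
    rewrite inE /vbl; case: ifP => fE; last by rewrite inE andbF.
    by move=> /andP[ve vf]; apply/bigcupP; exists v; rewrite // inE fE vf.
  apply: (@leq_trans (\sum_(v in e) #|edges_at E v|)).
    elim/big_ind2: _ => [|x1 x2 y1 y2 h1 h2|//]; first by rewrite cards0.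
    by apply: leq_trans (leq_add h1 h2); rewrite cardsU leq_subr.
  rewrite -(unif eE) -sum_nat_const; apply: leq_sum => v _.
  by apply: leq_trans degE; apply: (leq_bigmax (F := degree E)).
have lll : 4 * (1 / (q ^ k.-1)%:R) * (k * D).+1%:R <= 1 :> R.
  rewrite mul1r mulrAC ler_pdivrMr ?ltr0n ?expn_gt0 ?q_gt0 //.
  by rewrite mul1r -natrM ler_nat.
have [om H] := local_lemma w_ge0 w_sum1 dep_bad bad_le p_ge0 d_gt0 deg lll.
apply/existsP; exists om; apply/forall_inP => e eE.
by have := H e; rewrite /bad eE.
Qed.

End UniformColoring.

From mathcomp Require Import all_classical all_reals all_analysis.

(** * Estimates for large arguments and real roots *)

Section Eventually.
Variable R : realType.

Definition for_large (P : R -> Prop) : Prop := exists L0, forall L, L0 <= L -> P L.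

Lemma for_large_and (P Q : R -> Prop) : for_large P -> for_large Q -> for_large (fun L => P L /\ Q L).
Proof.
move=> [a Ha] [b Hb]; exists (Num.max a b) => L; rewrite ge_max => /andP[aL bL].
by split; [apply: Ha | apply: Hb].
Qed.

Lemma for_large_ge (K : R) : for_large (fun L => K <= L).
Proof. by exists K. Qed.

(** exp(c L) is the (j+1)-st power of exp(c L / (j+1)), which is at least d (1 + L); one factor 1 +
    L is left over and outgrows [K]. *)
Lemma for_large_poly_exp (K c : R) j : 0 <= K -> 0 < c ->
  for_large (fun L => K * (1 + L) ^+ j * expR (- (c * L)) <= 1).
Proof.
move=> K0 c0; pose j1 : R := j.+1%:R.
have j1_gt0 : 0 < j1 by rewrite ltr0n.
pose d := c / (c + j1).
have cj : 0 < c + j1 by rewrite addr_gt0.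
have d0 : 0 < d by rewrite divr_gt0.
have d1 : d <= 1 by rewrite ler_pdivrMr // mul1r lerDl ltW.
have d2 : d <= c / j1.
  by rewrite ler_wpM2l ?(ltW c0) // lef_pV2 ?posrE // lerDr ltW.
clearbody d; exists (K / d ^+ j.+1) => L HL.
have dj : 0 < d ^+ j.+1 by rewrite exprn_gt0.
have L0 : 0 <= L by apply: le_trans HL; rewrite divr_ge0 // ltW.
have L1 : 0 < 1 + L by rewrite ltr_wpDr.
have low : (d * (1 + L)) ^+ j.+1 <= expR (c * L).
  have -> : expR (c * L) = expR (c * L / j1) ^+ j.+1.
    by rewrite -expRM_natr -mulrA mulVf ?mulr1 // gt_eqF.
  apply: lerXn2r; rewrite ?nnegrE ?expR_ge0 ?mulr_ge0 ?(ltW d0) ?(ltW L1) //.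
  apply: le_trans (expR_ge1Dx _).
  have : d * L <= c / j1 * L by rewrite ler_wpM2r.
  rewrite [c * L / j1]mulrAC => h; rewrite mulrDr mulr1.
  exact: lerD.
rewrite expRN ler_pdivrMr ?expR_gt0 // mul1r; apply: le_trans low.
rewrite exprMn [(1 + L) ^+ j.+1]exprS mulrA ler_wpM2r ?exprn_ge0 ?(ltW L1) //.
rewrite ler_pdivrMr // mulrC in HL.
by apply: le_trans HL _; rewrite ler_wpM2l ?(ltW dj) // lerDr.
Qed.

End Eventually.

Section Root.
Variables (R : realType) (n : nat).
Hypothesis rounds_gt0 : (0 < n)%N.

Definition nroot (y : R) : R := y `^ (1 / n%:R).

Let n0 : n%:R != 0 :> R. Proof. by rewrite pnatr_eq0 -lt0n. Qed.

Lemma nroot_ge0 y : 0 <= nroot y. Proof. exact: powR_ge0. Qed.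

Lemma nrootK y : 0 <= y -> nroot y ^+ n = y.
Proof.
by move=> y0; rewrite -powR_mulrn ?nroot_ge0 // /nroot -powRrM mul1r mulVf // powRr1.
Qed.

Lemma nrootX y : 0 <= y -> nroot (y ^+ n) = y.
Proof.
by move=> y0; rewrite /nroot -powR_mulrn // -powRrM mul1r divff // powRr1.
Qed.

Lemma nroot_le x y : 0 <= x -> x <= y -> nroot x <= nroot y.
Proof.
move=> x0 xy; apply: ge0_ler_powR; rewrite ?nnegrE ?divr_ge0 //.
exact: le_trans xy.
Qed.

Lemma nrootM x y : 0 <= x -> 0 <= y -> nroot (x * y) = nroot x * nroot y.
Proof. exact: powRM. Qed.

Lemma nroot_le1D y : 0 <= y -> nroot y <= 1 + y.
Proof.
move=> y0; have h : 0 <= 1 + y by rewrite addr_ge0.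
rewrite -[leRHS]nrootX //; apply: nroot_le => //.
apply: (@le_trans _ _ (1 + y)); first by rewrite lerDr.
by rewrite -{1}[1 + y]expr1; apply: ler_weXn2l => //; rewrite lerDl.
Qed.

Lemma nroot_scale t y : 0 <= t <= 1 -> 0 <= y -> t * nroot y <= nroot (t * y).
Proof.
move=> /andP[t0 t1] y0; rewrite nrootM // ler_wpM2r ?nroot_ge0 //.
rewrite -{1}[t]nrootX //; apply: nroot_le; first by rewrite exprn_ge0.
by rewrite -[leRHS]expr1; apply: ler_wiXn2l.
Qed.

Lemma nroot_exp x : nroot (expR x) = expR (x / n%:R).
Proof. by rewrite /nroot -expRM mul1r. Qed.

End Root.

(** * Choice of the parameters *)

Lemma bernoulli_ge (R : realFieldType) (x : R) n : 0 <= x <= 1 -> 1 - n%:R * x <= (1 - x) ^+ n.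
Proof.
move=> /andP[x0 x1]; elim: n => [|n IHn]; first by rewrite mul0r subr0.
rewrite exprS -natr1; apply: le_trans (ler_wpM2l _ IHn); last by rewrite subr_ge0.
have n0 : 0 <= n%:R :> R by [].
have : 0 <= n%:R * x * x by rewrite !mulr_ge0.
by move: (n%:R) => y; lra.
Qed.

Lemma C1_arith (R : realFieldType) (t y q : R) :
  0 <= t <= 1 -> y <= t / 4 -> 1 - y <= q -> 1 <= (1 + t / 2) * q.
Proof.
move=> /andP[t0 t1] yt yq.
have h1 : (1 + t / 2) * (1 - t / 4) <= (1 + t / 2) * q.
  by rewrite ler_wpM2l //; lra.
have : t * t <= 1 * t by rewrite ler_wpM2r.
lra.
Qed.

Lemma power_le2 (R : realFieldType) (t : R) (n : nat) :
  0 <= t <= 1 -> n%:R * t <= 1 / 2 -> (1 + t) ^+ n <= 2.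
Proof.
move=> /andP[t0 t1] nt; have B := @bernoulli_ge R t n; rewrite t0 t1 in B.
have := B isT => {}B.
have h1 : (1 + t) ^+ n * (1 - t) ^+ n <= 1.
  rewrite -exprMn exprn_ile1 //; first by rewrite mulr_ge0 // ?subr_ge0 // addr_ge0.
  have : 0 <= t * t by rewrite mulr_ge0.
  lra.
have h3 : 0 <= (1 + t) ^+ n by rewrite exprn_ge0 // addr_ge0.
move: h1 h3 B; move: (_ ^+ n) ((1 - t) ^+ n) (n%:R * t) nt => a b c nt h1 h3 B.
have : a * (1 / 2) <= a * b by rewrite ler_wpM2l //; lra.
lra.
Qed.

(** The exponent in [lll_condition], with x = ln D, s = eta^2 and [a] the number of rounds. The
    cubic term beats the quadratic one from the dependency degree; 2 stands for 4 <= e^2 and 1 for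
    the constant C = e. *)
Lemma lll_arith (R : realFieldType) (a x s g kr : R) :
  0 < s -> 3 <= kr -> 1 <= x -> 1 <= g -> a <= x * g -> 8 * (4 * kr * g + 3) <= s * x ->
  2 + (1 + - (s / 2) * x ^+ 3) + (2 * a + 2) * (x + kr) <= 0.
Proof.
move=> s0 h3 x1 g1 ax hL; have x0 : 0 <= x by lra.
have x2 : 1 <= x * x by rewrite -[leLHS]mulr1; apply: ler_pM.
have h0 := ler_wpM2r (le_trans ler01 x2) hL.
have xg : x <= x * g by rewrite -[leLHS]mulr1 ler_wpM2l.
have kx : 3 * x <= kr * x by rewrite ler_wpM2r.
have kx1 : kr * 1 <= kr * x by rewrite ler_wpM2l //; lra.
have h1 : (2 * a + 2) * (x + kr) <= (4 * (x * g)) * (2 * (kr * x)).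
  apply: (@le_trans _ _ ((4 * (x * g)) * (x + kr))).
    by rewrite ler_wpM2r //; lra.
  by rewrite ler_wpM2l //; lra.
have : 0 <= kr * g * (x * x) by rewrite !mulr_ge0 //; lra.
lra.
Qed.

Section Constants.
Variables (R : realType) (k : nat) (eta : R).
Hypothesis hk : (3 <= k)%N.
Hypothesis eta_gt0 : 0 < eta.
Hypothesis eta_le : eta <= 1 / 10.

Local Notation kr := (k%:R : R).
(* The value for which D X^(2k-3) M^(4k-6), with M close to exp (alpha L), is still a
   negative power of D: see pair_correction. *)
Definition alpha : R := (kr - 2) / ((kr - 1) * (4 * kr - 5)).
(** Chosen so that slack (4k - 6) <= 1/2: in [pair_correction] it uses up half of the spare
    exponent. *)
Definition slack : R := 1 / (8 * kr).
(** The margin of 1 - kappa over the load of a round; the other half of [slack] pays for the passage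
    to an exponential in [kappa_inv]. *)
Definition half_slack : R := slack / 2.
(** Relative loss in the covering probability: (1 - delta)^2 is still at least 1 / (1 + eta/2). *)
Definition delta : R := eta / 16.
(** Growth of D x^(k-1) in one round, the [gam] of the nibble. *)
Definition increment : R := delta * slack / 8.
Definition zeta : R := alpha / (16 * kr).

Lemma kr_ge3 : 3 <= kr. Proof. by rewrite ler_nat. Qed.

Lemma alpha_gt0 : 0 < alpha.
Proof. by have := kr_ge3 => h; rewrite divr_gt0 ?mulr_gt0 //; lra. Qed.

Lemma alphaE : (kr - 2) / (kr - 1) = alpha * (4 * kr - 5).
Proof.
by have h := kr_ge3; rewrite /alpha; field; apply/andP; split; apply/eqP; lra.
Qed.

Lemma alpha_le1 : alpha <= 1.
Proof.
have h := kr_ge3; rewrite ler_pdivrMr ?mulr_gt0 //; try lra.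
by nra.
Qed.

(** Since 4 (k - 2) <= 4k - 5. With u = alpha ln D, the density is thus about exp(-4u) at most,
    against an inflation of at most exp(3u/2). *)
Lemma alpha4 : 4 * alpha <= 1 / (kr - 1).
Proof.
have h := kr_ge3; rewrite ler_pdivlMr; last lra.
have -> : 4 * alpha * (kr - 1) = 4 * (kr - 2) / (4 * kr - 5).
  by rewrite /alpha; field; apply/andP; split; apply/eqP; lra.
by rewrite ler_pdivrMr; lra.
Qed.

Lemma slack_gt0 : 0 < slack. Proof. by have h := kr_ge3; rewrite divr_gt0 //; lra. Qed.
Lemma slack_kr : slack * (8 * kr) = 1.
Proof. by have h := kr_ge3; rewrite /slack; field; lra. Qed.
Lemma slack_le : slack <= 1 / 24.
Proof. by have h := kr_ge3; have h2 := slack_kr; have h3 := slack_gt0; nra. Qed.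
Lemma half_slack_gt0 : 0 < half_slack. Proof. by rewrite divr_gt0 ?slack_gt0. Qed.
Lemma delta_gt0 : 0 < delta. Proof. by rewrite divr_gt0. Qed.
Lemma increment_gt0 : 0 < increment. Proof. by apply: divr_gt0 => //; apply: mulr_gt0 delta_gt0 slack_gt0. Qed.
Lemma zeta_gt0 : 0 < zeta.
Proof. by have h := kr_ge3; rewrite divr_gt0 ?alpha_gt0 //; lra. Qed.
Lemma delta_le : delta <= 1 / 160. Proof. by rewrite /delta; have := eta_le; lra. Qed.
Lemma increment_le : increment <= 1 / 1000.
Proof.
have h1 := slack_le; have h2 := slack_gt0; have h3 := delta_gt0; have h4 := delta_le.
have h5 : delta * slack <= 1 / 160 * (1 / 24) by apply: ler_pM => //; apply: ltW.
by rewrite /increment; lra.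
Qed.

Lemma increment_inv_ge1 : 1 <= increment^-1.
Proof. by rewrite invf_ge1 ?increment_gt0 //; apply: le_trans increment_le _; lra. Qed.

Definition kappa : R := 1 - (1 + half_slack) * increment.

Lemma kappa_ge : 1 - delta / 4 <= kappa.
Proof.
have h1 := slack_le; have h2 := slack_gt0; have h3 := delta_gt0; have h4 := delta_le.
have h5 : (1 + slack / 2) * slack <= 2 * 1 by apply: ler_pM; lra.
by have := ler_wpM2r (ltW h3) h5; rewrite /kappa /increment /half_slack; lra.
Qed.

Lemma kappa_half : 1 / 2 <= kappa.
Proof. by have := kappa_ge; have := delta_le; lra. Qed.

Lemma kappa_le1 : kappa <= 1.
Proof.
have h : 0 <= (1 + half_slack) * increment by rewrite mulr_ge0 ?ltW ?increment_gt0 // addr_gt0 // half_slack_gt0.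
by rewrite /kappa; lra.
Qed.

Lemma kappa_gt0 : 0 < kappa. Proof. by have := kappa_half; lra. Qed.

Lemma kappa_inv : kappa^-1 <= expR ((1 + slack) * increment).
Proof.
have h1 := slack_le; have h2 := slack_gt0; have h3 := increment_gt0; have h4 := increment_le.
set y := (1 + slack) * increment.
have y0 : 0 < y by rewrite mulr_gt0 //; lra.
apply: le_trans (expR_ge1Dx y).
rewrite -[leLHS]mul1r ler_pdivrMr ?kappa_gt0 // /y /kappa.
have h5 : (1 + half_slack) * (1 + slack) * increment <= slack - half_slack.
  have h6 := delta_le; have h7 := delta_gt0; rewrite /increment /half_slack; move: slack delta h1 h2 h6 h7 => a b.
  move=> *; have : b * a <= a / 160 by nra.
  by nra.
by have := ler_wpM2r (ltW h3) h5; lra.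
Qed.

(** * Parameters for a given degree *)

Section Degree.
Variables (D : nat).
Local Notation L := (ln (D%:R : R)).
Hypothesis D_gt0 : (0 < D)%N.
Hypothesis L_ge1 : 1 <= L.
(** Rounding the number of rounds down loses at most the fraction [delta], see [profile_n_ge]. *)
Hypothesis f0 : increment <= delta * (alpha * L).

Local Notation u := (alpha * L).
Local Notation n := (Num.truncn (u / increment)).
(** The values x_i prescribed by D x_i^(k-1) = i increment; [prob] is read off from them. *)
Definition profile i : R := nroot k.-1 (i%:R * increment / D%:R).
Definition density : R := nroot k.-1 (u / D%:R).
Local Notation X := (profile n).
Definition inflation : R := (kappa ^+ n)^-1.

Let D0 : 0 < D%:R :> R. Proof. by rewrite ltr0n. Qed.
Let expL : expR L = D%:R. Proof. by rewrite lnK // posrE. Qed.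
Let L_gt0 : 0 < L. Proof. exact: lt_le_trans L_ge1. Qed.
Let u_gt0 : 0 < u. Proof. exact: mulr_gt0 alpha_gt0 L_gt0. Qed.
Let u_le : u <= L. Proof. by rewrite ler_piMl ?alpha_le1 // ltW. Qed.
Let k1_gt0 : (0 < k.-1)%N. Proof. by case: k hk => [|[|]]. Qed.
Let k1E : (k.-1)%:R = kr - 1. Proof. by rewrite -subn1 natrB // (leq_trans _ hk). Qed.

Lemma rounds_bounds : n%:R * increment <= u < n.+1%:R * increment.
Proof.
have /andP[h1 h2] := truncn_itv (divr_ge0 (ltW u_gt0) (ltW increment_gt0)).
by rewrite -ler_pdivlMr ?increment_gt0 // h1 /= -ltr_pdivrMr ?increment_gt0.
Qed.

Lemma rounds_gt0 : (0 < n)%N.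
Proof.
rewrite truncn_gt0 ler_pdivlMr ?increment_gt0 // mul1r; apply: le_trans f0 _.
by rewrite ler_piMl ?(ltW u_gt0) //; have := delta_le; lra.
Qed.

Lemma profile_arg_ge0 i : 0 <= i%:R * increment / D%:R.
Proof. by apply: divr_ge0 => //; apply: mulr_ge0 (ltW increment_gt0). Qed.

Lemma profile_ge0 i : 0 <= profile i. Proof. exact: nroot_ge0. Qed.

Lemma profileX i : D%:R * profile i ^+ k.-1 = i%:R * increment.
Proof. by rewrite nrootK ?profile_arg_ge0 // mulrC divfK // gt_eqF. Qed.

Lemma profile0 : profile 0 = 0.
Proof.
have := profileX 0; rewrite mul0r => /eqP; rewrite mulf_eq0 gt_eqF //= expf_eq0.
by move=> /andP[_ /eqP].
Qed.

Lemma profile_le i j : (i <= j)%N -> profile i <= profile j.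
Proof.
move=> ij; apply: nroot_le => //; first exact: profile_arg_ge0.
by rewrite ler_wpM2r ?invr_ge0 // ler_wpM2r ?(ltW increment_gt0) // ler_nat.
Qed.

Lemma profile_n_le : X <= density.
Proof.
apply: nroot_le => //; first exact: profile_arg_ge0.
by rewrite ler_wpM2r ?invr_ge0 //; case/andP: rounds_bounds.
Qed.

Lemma profile_n_ge : (1 - delta) * density <= X.
Proof.
have d0 := delta_gt0; have d1 := delta_le.
apply: le_trans (nroot_scale k1_gt0 _ _) _; [lra | by rewrite divr_ge0 // ltW |].
apply: nroot_le => //; first by rewrite mulr_ge0 ?divr_ge0 ?(ltW u_gt0) //; lra.
rewrite mulrA ler_wpM2r ?invr_ge0 //.
by have /andP[_] := rounds_bounds; rewrite -natr1; have := f0; lra.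
Qed.

Lemma density_gt0 : 0 < density.
Proof. by apply: powR_gt0; rewrite divr_gt0. Qed.

Lemma density_le : density <= (1 + L) * expR (- (L / (kr - 1))).
Proof.
rewrite /density nrootM ?invr_ge0 ?(ltW u_gt0) //; apply: ler_pM; rewrite ?nroot_ge0 //.
  apply: le_trans (nroot_le1D k1_gt0 (ltW u_gt0)) _; by rewrite lerD2l.
by rewrite -[in leLHS]expL -expRN nroot_exp k1E mulNr.
Qed.

Lemma density_le4 : density <= (1 + L) * expR (- (4 * u)).
Proof.
apply: le_trans density_le _; rewrite ler_wpM2l ?addr_ge0 ?(ltW L_gt0) //.
rewrite ler_expR lerN2 mulrA [leRHS]mulrC -[(_ - _)^-1]mul1r.
exact: (ler_wpM2r (ltW L_gt0) alpha4).
Qed.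

Lemma inflation_gt0 : 0 < inflation. Proof. by rewrite invr_gt0 exprn_gt0 // kappa_gt0. Qed.
Lemma inflation_ge1 : 1 <= inflation.
Proof.
rewrite -[leLHS]invr1 lef_pV2 ?posrE ?exprn_gt0 ?kappa_gt0 //.
by rewrite exprn_ile1 ?kappa_le1 // ltW // kappa_gt0.
Qed.

Lemma inflation_le : inflation <= expR ((1 + slack) * u).
Proof.
rewrite /inflation -exprVn; apply: (@le_trans _ _ (expR ((1 + slack) * increment) ^+ n)).
  by apply: lerXn2r; rewrite ?nnegrE ?expR_ge0 ?invr_ge0 ?(ltW kappa_gt0) // kappa_inv.
rewrite -expRM_natl ler_expR mulrCA ler_wpM2l //; last by case/andP: rounds_bounds.
by rewrite addr_ge0 // ltW // slack_gt0.
Qed.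

Lemma inflation_le32 : inflation <= expR (3 / 2 * u).
Proof.
apply: le_trans inflation_le _; rewrite ler_expR ler_wpM2r ?(ltW u_gt0) //.
by have := slack_le; lra.
Qed.

Lemma inflation_profile_le : inflation * X <= (1 + L) * expR (- (2 * u)).
Proof.
apply: (@le_trans _ _ (expR (3 / 2 * u) * ((1 + L) * expR (- (4 * u))))).
  by apply: ler_pM; rewrite ?(ltW inflation_gt0) ?profile_ge0 ?inflation_le32 // (le_trans profile_n_le density_le4).
rewrite mulrCA -expRD ler_wpM2l ?addr_ge0 ?(ltW L_gt0) // ler_expR.
by have := u_gt0; lra.
Qed.

Lemma inflation2_profile_le : inflation ^+ 2 * X <= (1 + L) * expR (- u).
Proof.
apply: (@le_trans _ _ (expR (3 / 2 * u) ^+ 2 * ((1 + L) * expR (- (4 * u))))).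
  apply: ler_pM; rewrite ?exprn_ge0 ?(ltW inflation_gt0) ?profile_ge0 // ?(le_trans profile_n_le density_le4) //.
  by apply: lerXn2r; rewrite ?nnegrE ?expR_ge0 ?(ltW inflation_gt0) ?inflation_le32.
rewrite -expRM_natl mulrCA -expRD ler_wpM2l ?addr_ge0 ?(ltW L_gt0) // ler_expR.
by have := u_gt0; lra.
Qed.

(** Small enough for the product over all rounds to stay below 2, yet above the pair error, which is
    of order exp(-u/2) up to logarithms, even after division by kappa^window. *)
Definition theta : R := expR (- (u / 4)).
Definition moments : nat := (Num.truncn (zeta * L)).+1.
(** Twice the size of the largest monomial used in [overload], so that [corr] is bounded there. *)
Definition window : nat := (2 * (1 + moments * k.-1))%N.
(** Zero from round [n] on, so that the bounds required for every index hold. *)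
Definition prob i : R := if (i < n)%N then (profile i.+1 - profile i) / kappa ^+ i else 0.
(** Cubic in ln D, because the dependency degree of the local lemma is the exponential of a
    quadratic in ln D. *)
Definition deg_moments : nat := (Num.truncn (L ^+ 3)).+1.
Definition cover_prob : R := (1 - delta) ^+ 2 * density.
Definition batch_size : nat := (Num.truncn (eta / cover_prob)).+1.
(* 1 - eta + eta^2 bounds exp (- eta); the second eta^2 absorbs the deviation from the mean. *)
Definition shrink : R := 1 - eta + 2 * eta ^+ 2.
Definition new_degree : R := shrink ^+ k.-1 * D%:R.
Definition decay : R := expR (- (eta * (k.-1)%:R)).

(** This and the following conditions say that ln D is large, one for each estimate below;
    [large_degree_step] supplies them. *)
Hypothesis f1 : 64 * kr ^+ 2 * (1 + L) ^+ 3 * expR (- u) <= 1.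
Hypothesis f2 : 32 * kr ^+ 3 * expR (2 * kr) * (1 + L) ^+ k.+1 * expR (- (u / 8)) <= 1.
Hypothesis f3 : 2 / increment * (1 + L) * expR (- (u / 4)) <= 1.
Hypothesis f4 : 2 / (half_slack * increment) * (1 + L) ^+ 2 * expR (- u) <= 1.
Hypothesis f5 : 64 / (delta * increment) * (1 + L) * expR (- (zeta * half_slack / 4 * L)) <= 1.
Hypothesis f6 : 4 / delta * (1 + L) * expR (- u) <= 1.
Hypothesis f7 : 2 / eta ^+ 2 * (1 + L) * expR (- u) <= 1.
Hypothesis f8 : kr * (1 + L) ^+ 4 * expR (- u) <= 1.
Hypothesis f9 : 4 * kr ^+ 2 * (1 + L) ^+ 7 * expR (- u) <= 1.
Hypothesis f10 : 2 ^+ k / eta ^+ 2 * (1 + L) ^+ 3 * expR (- L) <= 1.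
Hypothesis f11 : 8 * (4 * kr / increment + 3) / eta ^+ 2 <= L.

Let oneL_ge0 : 0 <= 1 + L. Proof. by rewrite addr_ge0 // ltW. Qed.
Let exp_le1 (x : R) : 0 <= x -> expR (- x) <= 1. Proof. by move=> x0; rewrite expR_le1 oppr_le0. Qed.

Lemma kap01 : 0 < kappa <= 1. Proof. by rewrite kappa_gt0 kappa_le1. Qed.

Lemma xs_prob i : (i <= n)%N -> xs prob kappa i = profile i.
Proof.
elim: i => [|i IHi] ir; first by rewrite /xs big_ord0 profile0.
rewrite xsS IHi ?(ltnW ir) // /prob ir /lam divfK; first by rewrite addrC subrK.
by rewrite gt_eqF // exprn_gt0 // kappa_gt0.
Qed.

Lemma prob_ge0 i : 0 <= prob i.
Proof.
rewrite /prob; case: ifP => // _; rewrite divr_ge0 ?subr_ge0 ?profile_le //.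
by rewrite exprn_ge0 // ltW // kappa_gt0.
Qed.

Lemma prob_le i : prob i <= inflation * X.
Proof.
rewrite /prob; case: ifP => [ir|_]; last by rewrite mulr_ge0 ?profile_ge0 // ltW // inflation_gt0.
rewrite mulrC /inflation; apply: ler_pM.
- by rewrite invr_ge0 exprn_ge0 // ltW // kappa_gt0.
- by rewrite subr_ge0 profile_le.
- rewrite lef_pV2 ?posrE ?exprn_gt0 ?kappa_gt0 //.
  by apply: (ler_wiXn2l (ltW kappa_gt0) kappa_le1); apply: ltnW.
- by apply: le_trans (profile_le ir); rewrite gerBl profile_ge0.
Qed.

Lemma theta_bounds : 0 <= theta <= 1.
Proof. by rewrite expR_ge0 exp_le1 // divr_ge0 // ltW. Qed.

Lemma zeta_le : zeta * (16 * kr) = alpha.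
Proof. by have h := kr_ge3; rewrite /zeta divfK // gt_eqF //; lra. Qed.

Lemma moments_bounds : zeta * L <= moments%:R <= zeta * L + 1.
Proof.
have z0 : 0 <= zeta * L by rewrite mulr_ge0 // ltW // zeta_gt0.
have /andP[h1 h2] := truncn_itv z0.
by rewrite (ltW h2) /moments -natr1 lerD2r.
Qed.

Lemma moments_le : moments%:R <= 1 + L.
Proof.
have /andP[_ h] := moments_bounds; apply: le_trans h _; rewrite addrC lerD2l ler_piMl ?(ltW L_gt0) //.
have := zeta_le; have := alpha_le1; have := kr_ge3; have := zeta_gt0; nra.
Qed.

Lemma window_le : window%:R <= 2 * kr + u / 8.
Proof.
have /andP[_ h] := moments_bounds; rewrite /window natrM natrD natrM k1E.
have h3 := kr_ge3; have hk1 : 0 <= kr - 1 by lra.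
have h1 := ler_wpM2r hk1 h.
have h2 : zeta * L * (kr - 1) <= u / 16.
  have z0 : 0 <= zeta * L by rewrite mulr_ge0 ?(ltW zeta_gt0) ?(ltW L_gt0).
  have : zeta * L * (16 * kr) = u by rewrite mulrAC zeta_le.
  by lra.
by lra.
Qed.

Lemma window_le4 : window%:R <= 4 * kr * (1 + L).
Proof.
apply: le_trans window_le _; have h3 := kr_ge3; have h1 := u_le; have h2 := L_ge1.
have : 0 <= kr * L by rewrite mulr_ge0 // ltW.
have : 1 * L <= kr * L by rewrite ler_wpM2r ?(ltW L_gt0) //; lra.
lra.
Qed.

Lemma window2_le : (window * window)%:R <= 16 * kr ^+ 2 * (1 + L) ^+ 2.
Proof.
have h := window_le4; have := ler_pM (ler0n _ _) (ler0n _ _) h h.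
by rewrite -natrM => /le_trans; apply; rewrite le_eqVlt; apply/orP; left; apply/eqP; ring.
Qed.

Lemma inflation_profile_lt1 : inflation * X < 1.
Proof.
apply: le_lt_trans inflation_profile_le _; have h3 := kr_ge3.
have e0 : 0 < expR (- u) by apply: expR_gt0.
have : (1 + L) * expR (- (2 * u)) <= (1 + L) * expR (- u).
  by rewrite ler_wpM2l // ler_expR; have := u_gt0; lra.
move=> /le_lt_trans; apply.
have := f6; have d0 := delta_gt0; have d1 := delta_le.
have : 0 < (1 + L) * expR (- u) by rewrite mulr_gt0 // ltr_pwDl // ltW.
set x := (1 + L) * expR (- u); rewrite -mulrA -/x => x0.
rewrite mulrAC ler_pdivrMr // mul1r; lra.
Qed.

Lemma prob01 i : 0 <= prob i < 1.
Proof. by rewrite prob_ge0 /=; apply: le_lt_trans (prob_le i) inflation_profile_lt1. Qed.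

Lemma window2_prob_le i : (window * window)%:R * prob i <= theta / 4.
Proof.
apply: (@le_trans _ _ (16 * kr ^+ 2 * (1 + L) ^+ 2 * ((1 + L) * expR (- (2 * u))))).
  apply: ler_pM => //; [exact: prob_ge0 | exact: window2_le |].
  exact: (le_trans (prob_le i) inflation_profile_le).
rewrite ler_pdivlMr //.
have -> : - (2 * u) = - u + - u by ring.
rewrite expRD.
apply: (@le_trans _ _ (1 * expR (- u))); last first.
  by rewrite mul1r ler_expR lerN2; have := u_gt0; lra.
apply: le_trans (ler_wpM2r (expR_ge0 _) f1).
by rewrite le_eqVlt; apply/orP; left; apply/eqP; ring.
Qed.

Lemma window_correction i : 1 <= (1 + theta / 2) * (1 - prob i) ^+ (window * window).
Proof.
apply: C1_arith theta_bounds (window2_prob_le i) _; apply: bernoulli_ge.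
by have /andP[-> /ltW ->] := prob01 i.
Qed.

Lemma rounds_le : n%:R <= (1 + L) / increment.
Proof.
have /andP[h _] := rounds_bounds.
rewrite ler_pdivlMr ?increment_gt0 //; apply: le_trans h _; apply: le_trans u_le _.
by rewrite lerDr.
Qed.

Lemma theta_pow_le2 : (1 + theta) ^+ n <= 2.
Proof.
apply: power_le2 theta_bounds _; have /andP[t0 _] := theta_bounds.
apply: le_trans (ler_wpM2r t0 rounds_le) _; rewrite ler_pdivlMr //.
apply: le_trans f3; rewrite /theta.
by rewrite le_eqVlt; apply/orP; left; apply/eqP; ring.
Qed.

Lemma moments_inflation_profile_le : moments%:R * (inflation * X) <= half_slack * increment / 2.
Proof.
have eg : 0 < half_slack * increment by rewrite mulr_gt0 ?half_slack_gt0 ?increment_gt0.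
apply: (@le_trans _ _ ((1 + L) * ((1 + L) * expR (- u)))).
  apply: ler_pM; rewrite ?mulr_ge0 ?profile_ge0 ?(ltW inflation_gt0) ?moments_le //.
  apply: le_trans inflation_profile_le _; rewrite ler_wpM2l // ler_expR.
  by have := u_gt0; lra.
rewrite ler_pdivlMr //; have := f4.
have -> : 2 / (half_slack * increment) * (1 + L) ^+ 2 * expR (- u) =
   (1 + L) * ((1 + L) * expR (- u)) * 2 / (half_slack * increment) by ring.
by rewrite ler_pdivrMr // mul1r.
Qed.

Lemma moments_prob_lt : moments%:R * (inflation * X) < (1 + half_slack) * increment.
Proof.
apply: le_lt_trans moments_inflation_profile_le _.
have eg : 0 < half_slack * increment by rewrite mulr_gt0 ?half_slack_gt0 ?increment_gt0.
by have := increment_gt0; lra.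
Qed.

Local Notation d0 := (del0 increment half_slack (inflation * X) moments).

Lemma del0_gt0 : 0 < d0.
Proof.
rewrite mulr_gt0 // exprn_gt0 // divr_gt0 ?increment_gt0 // subr_gt0; exact: moments_prob_lt.
Qed.

(** [moments_inflation_profile_le] spends half of the margin, so each factor of [d0] is at most 1 /
    (1 + half_slack / 2), hence at most exp(-half_slack / 4). At least zeta ln D of them give a
    negative power of D, which beats the number of rounds. *)
Lemma del0_le : 4 * d0 * n%:R <= delta / 4.
Proof.
have g0 := increment_gt0; have e0 := half_slack_gt0; have dl0 := delta_gt0.
have eg : 0 < half_slack * increment by rewrite mulr_gt0.
have den : (1 + half_slack / 2) * increment <= (1 + half_slack) * increment - moments%:R * (inflation * X).
  by have := moments_inflation_profile_le; lra.
have den0 : 0 < (1 + half_slack / 2) * increment by rewrite mulr_gt0 // addr_gt0 // divr_gt0.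
have base : increment / ((1 + half_slack) * increment - moments%:R * (inflation * X)) <= expR (- (half_slack / 4)).
  apply: (@le_trans _ _ (increment / ((1 + half_slack / 2) * increment))).
    rewrite ler_wpM2l ?(ltW g0) // lef_pV2 ?posrE //.
    exact: lt_le_trans den.
  rewrite invfM mulrCA divff ?gt_eqF // mulr1.
  have p1 : 0 < 1 + half_slack / 2 by rewrite addr_gt0 // divr_gt0.
  rewrite -[leLHS]mul1r ler_pdivrMr //.
  have h1 := expR_ge1Dx (- (half_slack / 4)).
  have e1le : half_slack <= 1 by rewrite /half_slack; have := slack_le; have := slack_gt0; lra.
  apply: le_trans (ler_wpM2r (ltW p1) h1).
  have : half_slack * half_slack <= 1 * half_slack by rewrite ler_wpM2r // ltW.
  lra.
have d0le : d0 <= 4 * expR (- (zeta * half_slack / 4 * L)).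
  rewrite /del0 ler_wpM2l //.
  apply: (@le_trans _ _ (expR (- (half_slack / 4)) ^+ moments)).
    apply: lerXn2r; rewrite ?nnegrE ?expR_ge0 // divr_ge0 ?(ltW g0) //.
    by apply: ltW; apply: lt_le_trans den.
  rewrite -expRM_natl ler_expR mulrN lerN2.
  have /andP[h _] := moments_bounds; have q0 : 0 <= half_slack / 4 by rewrite divr_ge0 // ltW.
  have := ler_wpM2r q0 h; lra.
apply: (@le_trans _ _ (4 * (4 * expR (- (zeta * half_slack / 4 * L))) * ((1 + L) / increment))).
  apply: ler_pM => //; [by rewrite mulr_ge0 // ltW // del0_gt0 | by rewrite ler_wpM2l |].
  exact: rounds_le.
rewrite ler_pdivlMr //.
have fin (x y g d : R) : g != 0 -> d != 0 ->
    4 * (4 * x) * (y / g) * 4 = 64 / (d * g) * y * x * d.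
  by move=> ? ?; field; apply/andP; split.
rewrite (fin _ _ increment delta) ?gt_eqF //.
by rewrite -[leRHS]mul1r ler_wpM2r // ltW.
Qed.

(** Here the value of [alpha] enters. The factor D X^(k-1) is at most u; the other k - 2 factors X
    give exp(-u (4k - 5)) up to logarithms, and the inflation gives at most exp(u (1 + slack)(4k -
    6)), so exp(-u/2) is left. Of this, exp(-u/4) is [theta], one exp(-u/8) goes to kappa^window and
    the other absorbs the powers of ln D. *)
Lemma pair_correction :
  (window * window * D * k)%:R * (X * inflation ^+ 2) ^+ (k.-1 + k.-2) <= theta / 2 * kappa ^+ window.
Proof.
have h3 := kr_ge3; have M0 := inflation_gt0; have X0 := profile_ge0 n.
set g := 2 * ((1 + slack) * u); set h := L / (kr - 1).
have M2 : inflation ^+ 2 <= expR g.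
  rewrite /g expRM_natl; apply: lerXn2r; rewrite ?nnegrE ?expR_ge0 ?(ltW M0) //.
  exact: inflation_le.
have XM : X * inflation ^+ 2 <= (1 + L) * expR (g - h).
  rewrite [g - h]addrC expRD mulrA; apply: ler_pM M2 => //; first exact: exprn_ge0 (ltW M0).
  exact: le_trans profile_n_le density_le.
have k2E : (k.-2)%:R = kr - 2 by rewrite -subn2 natrB // (leq_trans _ hk).
have main : D%:R * (X * inflation ^+ 2) ^+ (k.-1 + k.-2) <= (1 + L) ^+ k.-1 * expR (- (u / 2)).
  rewrite exprD exprMn mulrA mulrA profileX.
  apply: (@le_trans _ _ ((1 + L) * expR g ^+ k.-1 * ((1 + L) * expR (g - h)) ^+ k.-2)).
    have nn := rounds_bounds; have g0 := increment_gt0.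
    apply: ler_pM.
    - by rewrite mulr_ge0 ?exprn_ge0 ?(ltW M0) // mulr_ge0 // ltW.
    - by rewrite exprn_ge0 // mulr_ge0 // exprn_ge0 // ltW.
    - apply: ler_pM; rewrite ?exprn_ge0 ?(ltW M0) //; first by rewrite mulr_ge0 // ltW.
        case/andP: nn => nn _; apply: le_trans nn _; apply: le_trans u_le _.
        by rewrite lerDr.
      by apply: lerXn2r; rewrite ?nnegrE ?expR_ge0 ?exprn_ge0 ?(ltW M0).
    - by apply: lerXn2r; rewrite ?nnegrE ?mulr_ge0 ?expR_ge0 ?exprn_ge0 ?(ltW M0).
  rewrite exprMn -!expRM_natl k1E k2E.
  have -> : (1 + L) * expR ((kr - 1) * g) * ((1 + L) ^+ k.-2 * expR ((kr - 2) * (g - h))) =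
     (1 + L) ^+ k.-1 * expR ((kr - 1) * g + (kr - 2) * (g - h)).
    have -> : (1 + L) ^+ k.-1 = (1 + L) * (1 + L) ^+ k.-2.
      by rewrite -exprS prednK // -ltnS prednK // ltnW.
    by rewrite expRD; ring.
  rewrite ler_wpM2l ?exprn_ge0 // ler_expR.
  have hh : (kr - 2) * h = u * (4 * kr - 5).
    by rewrite /h mulrCA mulrC -[(kr - 2) * _]/((kr - 2) / (kr - 1)) alphaE; ring.
  have -> : (kr - 1) * g + (kr - 2) * (g - h) = g * (2 * kr - 3) - u * (4 * kr - 5).
    by rewrite mulrBr hh; ring.
  have -> : g * (2 * kr - 3) - u * (4 * kr - 5) = u * (slack * (4 * kr - 6) - 1).
    by rewrite /g; ring.
  have e2k := slack_kr; have e20 := slack_gt0.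
  have : slack * (4 * kr - 6) - 1 <= - (1 / 2) by lra.
  by move=> /(ler_wpM2l (ltW u_gt0)); lra.
rewrite (_ : (window * window * D * k)%:R = (window * window)%:R * kr * D%:R); last by rewrite !natrM; ring.
rewrite -mulrA.
apply: (@le_trans _ _ (16 * kr ^+ 2 * (1 + L) ^+ 2 * kr * ((1 + L) ^+ k.-1 * expR (- (u / 2))))).
  apply: ler_pM => //; first by rewrite mulr_ge0 // exprn_ge0 // mulr_ge0 // exprn_ge0 // ltW.
  by rewrite ler_wpM2r // window2_le.
have kN : expR (- (2 * kr + u / 8)) <= kappa ^+ window.
  apply: (@le_trans _ _ (expR (- 1) ^+ window)).
    rewrite -expRM_natl ler_expR mulrN1 lerN2; exact: window_le.
  apply: lerXn2r; rewrite ?nnegrE ?expR_ge0 ?(ltW kappa_gt0) //.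
  apply: le_trans kappa_half; rewrite expRN -[leLHS]mul1r ler_pdivrMr ?expR_gt0 //.
  by have := expR_ge1Dx (1 : R); lra.
apply: (@le_trans _ _ (theta / 2 * expR (- (2 * kr + u / 8)))); last first.
  by rewrite ler_wpM2l // divr_ge0 // expR_ge0.
have -> : expR (- (u / 2)) = expR (- (u / 4)) * (expR (- (2 * kr + u / 8)) * (expR (2 * kr) * expR (- (u / 8)))).
  by rewrite -!expRD; congr expR; field.
rewrite -/theta.
have -> : 16 * kr ^+ 2 * (1 + L) ^+ 2 * kr * ((1 + L) ^+ k.-1 *
     (theta * (expR (- (2 * kr + u / 8)) * (expR (2 * kr) * expR (- (u / 8)))))) =
   (32 * kr ^+ 3 * expR (2 * kr) * (1 + L) ^+ k.+1 * expR (- (u / 8))) *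
     (theta / 2 * expR (- (2 * kr + u / 8))).
  have -> : (1 + L) ^+ k.+1 = (1 + L) ^+ 2 * (1 + L) ^+ k.-1.
    by rewrite -exprD; congr (_ ^+ _); case: k hk.
  by field.
by rewrite ler_piMl // mulr_ge0 ?divr_ge0 ?expR_ge0.
Qed.

Lemma profile_increment i : (i <= n.-1)%N ->
  D%:R * (xs prob kappa i.+1 ^+ k.-1 - xs prob kappa i ^+ k.-1) <= increment.
Proof.
move=> i_n; have i1_n : (i.+1 <= n)%N by rewrite -(prednK rounds_gt0) ltnS.
by rewrite (xs_prob i1_n) (xs_prob (ltnW i1_n)) mulrBr !profileX -natr1; lra.
Qed.

Definition coin_den : nat := Num.truncn (d0 * kappa ^+ n)^-1.

Lemma coin_den_large : 1 / coin_den.+1%:R <= d0 * kappa ^+ n.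
Proof.
have y0 : 0 < d0 * kappa ^+ n by apply: mulr_gt0 del0_gt0 _; apply: exprn_gt0 kappa_gt0.
have yV : 0 <= (d0 * kappa ^+ n)^-1 by rewrite invr_ge0 ltW.
have /andP[_ h] := truncn_itv yV.
by rewrite ler_pdivrMr // mulrC -ler_pdivrMr // mul1r ltW.
Qed.

Lemma sqr_inflation_profile_le : (inflation * X) ^+ 2 <= delta / 4 * X.
Proof.
rewrite exprMn [X ^+ 2]expr2 mulrA ler_wpM2r ?profile_ge0 //; apply: le_trans inflation2_profile_le _.
have := f6; have d0 := delta_gt0; rewrite -mulrA mulrAC ler_pdivrMr //; lra.
Qed.

(** Three losses of delta / 4, from [kappa], from failing availability and from repeated proposals,
    fit into one factor 1 - delta; [profile_n_ge] supplies the other. *)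
Lemma cover_prob_attained :
  cover_prob <= kappa * (1 - 4 * d0 * n%:R) * xs prob kappa n - (inflation * xs prob kappa n) ^+ 2.
Proof.
rewrite (xs_prob (leqnn _)) /cover_prob.
have fin (q kp d x m y : R) : 0 <= d <= 1 -> 0 <= x -> q <= d / 4 -> 1 - d / 4 <= kp ->
    m <= d / 4 * x -> (1 - d) * y <= x -> (1 - d) ^+ 2 * y <= kp * (1 - q) * x - m.
  move=> /andP[d_0 d_1] x_0 qd kd mx yx.
  have h1 : (1 - d / 4) * (1 - d / 4) <= kp * (1 - q) by apply: ler_pM; lra.
  have h2 := ler_wpM2r x_0 h1.
  have d1 : 0 <= 1 - d by lra.
  have h3 := ler_wpM2l d1 yx.
  have h4 : 0 <= d * d * x by rewrite !mulr_ge0.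
  have h5 : 0 <= d * x by rewrite mulr_ge0.
  lra.
have dl0 := delta_gt0; have dl1 := delta_le.
apply: fin (profile_ge0 n) del0_le kappa_ge sqr_inflation_profile_le profile_n_ge.
by rewrite ltW //=; lra.
Qed.

Lemma deg_moments_bounds : L ^+ 3 <= deg_moments%:R <= (1 + L) ^+ 3.
Proof.
have l0 : 0 <= L ^+ 3 by rewrite exprn_ge0 // ltW.
have /andP[h1 h2] := truncn_itv l0; rewrite (ltW h2) /= /deg_moments -natr1.
have l1 := L_gt0; apply: le_trans (lerD h1 (lexx 1)) _.
have l2 : 0 <= L ^+ 2 by rewrite exprn_ge0 // ltW.
by move: l1 l2; move: (ln _) => x x0 x2; rewrite !exprS expr0 in x2 *; lra.
Qed.

Lemma cover_prob_bounds : density / (1 + eta / 2) <= cover_prob <= density.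
Proof.
have x0 := density_gt0; have e0 := eta_gt0; have el := eta_le.
have p1 : 0 < 1 + eta / 2 by lra.
have eta2 : 0 <= eta ^+ 2 by rewrite exprn_ge0 // ltW.
have eta3 : eta * eta ^+ 2 <= 1 * eta ^+ 2 by rewrite ler_wpM2r //; lra.
rewrite /cover_prob [(1 - delta) ^+ 2 * _]mulrC; apply/andP; split.
  rewrite ler_wpM2l ?(ltW x0) // -[leLHS]mul1r ler_pdivrMr // /delta; nra.
by rewrite -[leRHS]mulr1 ler_wpM2l ?(ltW x0) // /delta; nra.
Qed.

Lemma cover_prob_gt0 : 0 < cover_prob.
Proof.
have /andP[h _] := cover_prob_bounds; apply: lt_le_trans h.
by apply: divr_gt0 density_gt0 _; have := eta_gt0; lra.
Qed.

Lemma batch_size_bounds : eta / cover_prob <= batch_size%:R <= eta / cover_prob + 1.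
Proof.
have /andP[h1 h2] := truncn_itv (divr_ge0 (ltW eta_gt0) (ltW cover_prob_gt0)).
by rewrite (ltW h2) /batch_size -natr1 lerD2r.
Qed.

Lemma batch_size_le : batch_size%:R <= eta * (1 + eta) / density.
Proof.
have x0 := density_gt0; have e0 := eta_gt0; have el := eta_le; have p0 := cover_prob_gt0.
have /andP[_ h] := batch_size_bounds; apply: le_trans h _.
have /andP[p1 _] := cover_prob_bounds.
have h1 : eta / cover_prob <= eta * (1 + eta / 2) / density.
  rewrite -mulrA ler_wpM2l ?(ltW e0) // -[_ / density]invrK invf_div lef_pV2 ?posrE //.
  by apply: divr_gt0 x0 _; lra.
have h2 : 1 <= eta ^+ 2 / 2 / density.
  rewrite ler_pdivlMr // mul1r; apply: le_trans density_le4 _.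
  apply: (@le_trans _ _ ((1 + L) * expR (- u))).
    by rewrite ler_wpM2l // ler_expR; have := u_gt0; lra.
  have := f7; have s0 : 0 < eta ^+ 2 by apply: exprn_gt0.
  by rewrite -mulrA mulrAC ler_pdivrMr // mul1r => ?; lra.
apply: le_trans (lerD h1 h2) _; rewrite -mulrDl ler_wpM2r ?invr_ge0 ?(ltW x0) //.
by rewrite expr2; lra.
Qed.

Lemma batch_size_le2 : batch_size%:R * density <= 2.
Proof.
have x0 := density_gt0; have e0 := eta_gt0; have el := eta_le.
have := batch_size_le; rewrite ler_pdivlMr // => /le_trans; apply.
have : eta * eta <= 1 / 10 * eta by rewrite ler_wpM2r // ltW.
lra.
Qed.

(** From 1 + y <= exp y. The linear term gives [decay], as batch_size times cover_prob is at least
    eta; the quadratic term contributes at most 1 to the exponent, whence the constant e. The bound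
    [Jp] keeps the base nonnegative, as monotonicity of powers requires. *)
Lemma uncovered_moment_le j : (j <= deg_moments)%N ->
  (1 - (j * k.-1)%:R * cover_prob + ((j * k.-1) * (j * k.-1))%:R * (inflation * xs prob kappa n) ^+ 2) ^+ batch_size
    <= expR 1 * decay ^+ j.
Proof.
move=> jr; rewrite (xs_prob (leqnn _)).
have /andP[_ r2u] := deg_moments_bounds; have h3 := kr_ge3; have x0 := density_gt0; have p0 := cover_prob_gt0.
have J_le : (j * k.-1)%:R <= (1 + L) ^+ 3 * kr.
  rewrite natrM; apply: ler_pM => //; last by rewrite k1E; lra.
  by apply: le_trans r2u; rewrite ler_nat.
have T0 : 0 <= (inflation * X) ^+ 2 by apply: sqr_ge0.
have T_le : (inflation * X) ^+ 2 <= (1 + L) * expR (- u) * density.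
  rewrite exprMn [X ^+ 2]expr2 mulrA; apply: ler_pM inflation2_profile_le profile_n_le; rewrite ?profile_ge0 //.
  by rewrite mulr_ge0 ?profile_ge0 // sqr_ge0.
have Jp : (j * k.-1)%:R * cover_prob <= 1.
  apply: (@le_trans _ _ ((1 + L) ^+ 3 * kr * ((1 + L) * expR (- u)))).
    apply: ler_pM J_le _ => //; first exact: ltW.
    have /andP[_ h] := cover_prob_bounds; apply: le_trans h _; apply: le_trans density_le4 _.
    by rewrite ler_wpM2l // ler_expR; have := u_gt0; lra.
  apply: le_trans f8; rewrite le_eqVlt; apply/orP; left; apply/eqP.
  have fin (l z e : R) : l ^+ 3 * z * (l * e) = z * l ^+ 4 * e by ring.
  exact: fin.
have mp : eta <= batch_size%:R * cover_prob.
  by have /andP[h _] := batch_size_bounds; rewrite ler_pdivrMr in h.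
have mJT : batch_size%:R * (((j * k.-1) * (j * k.-1))%:R * (inflation * X) ^+ 2) <= 1.
  apply: (@le_trans _ _ (batch_size%:R * ((((1 + L) ^+ 3 * kr) * ((1 + L) ^+ 3 * kr)) *
      ((1 + L) * expR (- u) * density)))).
    by rewrite ler_wpM2l //; apply: ler_pM T_le => //; rewrite natrM; apply: ler_pM.
  have := f9; have := batch_size_le2.
  have q0 : 0 <= kr ^+ 2 * (1 + L) ^+ 7 * expR (- u).
    by rewrite mulr_ge0 ?expR_ge0 // mulr_ge0 ?exprn_ge0.
  have fin (m l x e z : R) : 0 <= z ^+ 2 * l ^+ 7 * e -> m * x <= 2 ->
    4 * z ^+ 2 * l ^+ 7 * e <= 1 -> m * ((l ^+ 3 * z) * (l ^+ 3 * z) * (l * e * x)) <= 1.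
    move=> q_0 mx; have -> : m * ((l ^+ 3 * z) * (l ^+ 3 * z) * (l * e * x)) =
      (m * x) * (z ^+ 2 * l ^+ 7 * e) by ring.
    by have := ler_wpM2r q_0 mx; lra.
  exact: fin.
move: mJT Jp T0; set J := (j * k.-1)%:R; set T := (inflation * X) ^+ 2.
rewrite natrM -/J => mJT Jp T0.
have J0 : 0 <= J by apply: ler0n.
have JT0 : 0 <= J * J * T by apply: mulr_ge0 T0; apply: mulr_ge0.
apply: (@le_trans _ _ (expR (- (J * cover_prob) + J * J * T) ^+ batch_size)).
  apply: lerXn2r; rewrite ?nnegrE ?expR_ge0 //; first by rewrite addr_ge0 // subr_ge0.
  by apply: le_trans (expR_ge1Dx _); rewrite addrA.
rewrite -expRM_natl /decay -expRM_natl -expRD ler_expR mulrDr.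
have mJp : J * eta <= J * (batch_size%:R * cover_prob) by rewrite ler_wpM2l.
rewrite {1}/J natrM in mJp.
have fin (a b c e m p t : R) : a * b * e <= c * (m * p) -> m * t <= 1 ->
  m * - (c * p) + m * t <= 1 + a * - (e * b) by lra.
exact: fin mJp mJT.
Qed.

Lemma shrink_bounds : 1 / 2 <= shrink <= 1.
Proof.
have e0 := eta_gt0; have el := eta_le; rewrite /shrink expr2.
have : 0 <= eta * eta by rewrite mulr_ge0 // ltW.
have : eta * eta <= 1 / 10 * eta by rewrite ler_wpM2r // ltW.
by move=> *; apply/andP; split; lra.
Qed.

Lemma new_degree_gt0 : 0 < new_degree.
Proof.
by have /andP[h _] := shrink_bounds; rewrite mulr_gt0 // exprn_gt0 //; lra.
Qed.

Lemma deg_moments_le : deg_moments%:R <= eta ^+ 2 / 2 * new_degree.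
Proof.
have /andP[_ r2u] := deg_moments_bounds; apply: le_trans r2u _.
have s0 : 0 < eta ^+ 2 by apply: exprn_gt0.
have h2 : 0 < 2 ^+ k :> R by apply: exprn_gt0.
have h : 2 ^+ k * (1 + L) ^+ 3 <= eta ^+ 2 * D%:R.
  have := f10; rewrite expRN expL ler_pdivrMr // mul1r mulrAC ler_pdivrMr //.
  by rewrite [D%:R * _]mulrC.
have ht : (1 / 2) ^+ k.-1 <= shrink ^+ k.-1.
  have /andP[t0 _] := shrink_bounds; apply: lerXn2r; rewrite ?nnegrE //.
  exact: le_trans t0.
have hk2 : (1 / 2) ^+ k.-1 * 2 ^+ k = 2 :> R.
  rewrite -{2}(prednK (ltnW (ltnW hk))) exprS mulrCA -exprMn mul1r mulVf //.
  by rewrite expr1n mulr1.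
apply: (@le_trans _ _ (eta ^+ 2 / 2 * ((1 / 2) ^+ k.-1 * D%:R))); last first.
  by rewrite ler_wpM2l ?ler_wpM2r // divr_ge0 // ltW.
have c0 : 0 <= (1 / 2) ^+ k.-1 / 2 :> R by rewrite divr_ge0 // exprn_ge0.
have fin (a b c d e : R) : a * b = 2 -> a / 2 * (b * c) <= a / 2 * (d * e) ->
    c <= d / 2 * (a * e).
  move=> ab; have -> : a / 2 * (b * c) = (a * b) * c / 2 by ring.
  by rewrite ab; lra.
exact: fin hk2 (ler_wpM2l c0 h).
Qed.

Lemma deg_moments_lt : deg_moments%:R < new_degree.
Proof.
apply: le_lt_trans deg_moments_le _; have w_0 := new_degree_gt0; have e0 := eta_gt0; have el := eta_le.
have : eta * eta <= 1 / 10 * eta by rewrite ler_wpM2r // ltW.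
by move=> h; rewrite -[ltRHS]mul1r ltr_pM2r // expr2; lra.
Qed.

(** exp(-eta) <= 1 - eta + eta^2 <= (1 - eta^2)(1 - eta + 2 eta^2). *)
Lemma decay_le : D%:R * decay <= (1 - eta ^+ 2) * new_degree.
Proof.
have e0 := eta_gt0; have el := eta_le.
have s0 : 0 <= eta ^+ 2 by rewrite exprn_ge0 // ltW.
have s1 : eta ^+ 2 <= 1 / 10 * eta by rewrite expr2 ler_wpM2r // ltW.
have /andP[t0 t1] := shrink_bounds.
have h1 : expR (- eta) <= (1 - eta ^+ 2) * shrink.
  have h2 : 1 <= (1 - eta + eta ^+ 2) * expR eta.
    apply: le_trans (ler_wpM2l _ (expR_ge1Dx eta)); last lra.
    have : 0 <= eta * eta ^+ 2 by rewrite mulr_ge0 // ltW.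
    by rewrite !expr2; lra.
  rewrite expRN -[leLHS]mul1r ler_pdivrMr ?expR_gt0 //; apply: le_trans h2 _.
  rewrite ler_wpM2r ?expR_ge0 // /shrink.
  have : 0 <= eta * eta ^+ 2 * (1 - 2 * eta).
    by apply: mulr_ge0; [rewrite mulr_ge0 // ltW | lra].
  by rewrite !expr2; lra.
have h2 : 0 <= 1 - eta ^+ 2 <= 1 by apply/andP; split; lra.
have /andP[h20 h21] := h2.
rewrite /decay mulrC -[eta * _]mulrC -mulrN expRM_natl /new_degree mulrA ler_wpM2r //.
apply: (@le_trans _ _ (((1 - eta ^+ 2) * shrink) ^+ k.-1)).
  apply: lerXn2r; rewrite ?nnegrE ?expR_ge0 //; apply: mulr_ge0 => //.
  exact: le_trans t0.
rewrite exprMn ler_wpM2r //; first by rewrite exprn_ge0 //; apply: le_trans t0.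
by rewrite -[leRHS]expr1; apply: ler_wiXn2l.
Qed.

(** With s = eta^2 the denominator is at least (1 - s/2) [new_degree], and 1 - s <= (1 - s/2)^2. *)
Lemma ratio_le : 0 <= D%:R * decay / (new_degree - deg_moments%:R) <= expR (- (eta ^+ 2 / 2)).
Proof.
have w_0 := new_degree_gt0; have e0 := eta_gt0; have el := eta_le.
have s1 : eta ^+ 2 <= 1 / 10 * eta by rewrite expr2 ler_wpM2r // ltW.
have s2 : 0 <= eta ^+ 2 by rewrite exprn_ge0 // ltW.
have d_0 : (1 - eta ^+ 2 / 2) * new_degree <= new_degree - deg_moments%:R by have := deg_moments_le; lra.
have c0 : 0 < 1 - eta ^+ 2 / 2 by lra.
have d0 : 0 < new_degree - deg_moments%:R by apply: lt_le_trans d_0; apply: mulr_gt0.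
apply/andP; split; first by rewrite divr_ge0 ?(ltW d0) // mulr_ge0 // expR_ge0.
apply: le_trans (expR_ge1Dx _); rewrite ler_pdivrMr //; apply: le_trans decay_le _.
apply: le_trans (ler_wpM2l (ltW c0) d_0); rewrite [leRHS]mulrA ler_wpM2r ?(ltW w_0) //.
have : 0 <= eta ^+ 2 * eta ^+ 2 by rewrite mulr_ge0.
lra.
Qed.

Lemma lll_condition : 4 * (expR 1 * (D%:R * decay / (new_degree - deg_moments%:R)) ^+ deg_moments) *
  ((k * D).+1 ^ (n.-1.+2 + n.-1.+2))%:R <= 1.
Proof.
have four : 4 <= expR (2 : R).
  have -> : 2 = 2%:R * 1 :> R by rewrite mulr1.
  rewrite expRM_natl; have e1 := expR_ge1Dx (1 : R).
  by apply: (@le_trans _ _ ((1 + 1) ^+ 2)); [lra | apply: lerXn2r; rewrite ?nnegrE ?expR_ge0].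
have h3 := kr_ge3; have g0 := increment_gt0; have l1 := L_ge1.
have s0 : 0 < eta ^+ 2 by apply: exprn_gt0.
have kD : (k * D).+1%:R <= expR (L + kr).
  rewrite expRD expL -natr1 natrM mulrC.
  apply: (@le_trans _ _ (D%:R * (1 + kr))).
    by rewrite mulrDr mulr1 addrC lerD2r ler1n.
  by rewrite ler_wpM2l // expR_ge1Dx.
have hr : (D%:R * decay / (new_degree - deg_moments%:R)) ^+ deg_moments <= expR (- (eta ^+ 2 / 2) * L ^+ 3).
  have /andP[r0 r1] := ratio_le; have /andP[h _] := deg_moments_bounds.
  apply: le_trans (_ : _ <= expR (- (eta ^+ 2 / 2)) ^+ deg_moments) _.
    by apply: lerXn2r; rewrite ?nnegrE ?expR_ge0.
  by rewrite -expRM_natl ler_expR mulrN [deg_moments%:R * _]mulrC mulNr lerN2 ler_wpM2l // divr_ge0 // ltW.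
have hP : ((k * D).+1 ^ (n.-1.+2 + n.-1.+2))%:R <= expR ((2 * n%:R + 2) * (L + kr)).
  apply: (@le_trans _ _ (expR (L + kr) ^+ (n.-1.+2 + n.-1.+2))).
    by rewrite natrX; apply: lerXn2r; rewrite ?nnegrE ?expR_ge0.
  rewrite -expRM_natl ler_expR (prednK rounds_gt0) natrD -natr1.
  by rewrite le_eqVlt; apply/orP; left; apply/eqP; ring.
apply: (@le_trans _ _ (expR 2 * (expR 1 * expR (- (eta ^+ 2 / 2) * L ^+ 3)) *
    expR ((2 * n%:R + 2) * (L + kr)))).
  have /andP[r0 _] := ratio_le.
  apply: ler_pM hP => //; first by rewrite mulr_ge0 // mulr_ge0 ?expR_ge0 ?exprn_ge0.
  by apply: ler_pM four _; rewrite ?mulr_ge0 ?expR_ge0 ?exprn_ge0 // ler_wpM2l ?expR_ge0.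
rewrite -!expRD expR_le1.
apply: (@lll_arith R n%:R L (eta ^+ 2) increment^-1 kr s0 h3 l1).
- exact: increment_inv_ge1.
- by have /andP[h _] := rounds_bounds; rewrite ler_pdivlMr //; apply: le_trans h u_le.
- by rewrite -ler_pdivrMl // mulrC.
Qed.

Lemma degree_step (V : finType) (E : {set {set V}}) :
  uniform k E -> linear_hypergraph E -> (max_degree E <= D)%N ->
  exists (m : nat) (E' : {set {set V}}),
    [/\ uniform k E', linear_hypergraph E', (max_degree E')%:R < new_degree,
        m%:R <= eta * (1 + eta) / density & forall q, colorable E' q -> colorable E (m + q)].
Proof.
move=> unif lin degE; exists batch_size.
have nE : n.-1.+1 = n := prednK rounds_gt0.
have [E' [unif' lin' deg' colE']] : exists E' : {set {set V}},
    [/\ uniform k E', linear_hypergraph E', (max_degree E')%:R < new_degree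
      & forall q, colorable E' q -> colorable E (batch_size + q)].
  have M_lam : 1 <= inflation * kappa ^+ n.-1.+1.
    by rewrite nE mulVf // gt_eqF // exprn_gt0 // kappa_gt0.
  have C2 : (window * window * D * k)%:R * (xs prob kappa n.-1.+1 * inflation ^+ 2) ^+ (k.-1 + k.-2) <=
      theta / 2 * kappa ^+ window.
    by rewrite nE (xs_prob (leqnn _)); apply: pair_correction.
  have th0 : 0 <= theta by case/andP: theta_bounds.
  have ts : (1 + theta) ^+ n.-1.+1 <= 2 by rewrite nE; apply: theta_pow_le2.
  have hN : 1 / coin_den.+1%:R <= d0 * kappa ^+ n.-1.+1 by rewrite nE; apply: coin_den_large.
  have hp : cover_prob <= kappa * (1 - 4 * d0 * n.-1.+1%:R) * xs prob kappa n.-1.+1 -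
      (inflation * xs prob kappa n.-1.+1) ^+ 2.
    by rewrite nE; apply: cover_prob_attained.
  have hm j : (j <= deg_moments)%N -> (1 - (j * k.-1)%:R * cover_prob + ((j * k.-1) * (j * k.-1))%:R *
      (inflation * xs prob kappa n.-1.+1) ^+ 2) ^+ batch_size <= expR 1 * decay ^+ j.
    by rewrite nE; apply: uncovered_moment_le.
  exact: (@batch_color R V E k D (ltnW hk) lin unif degE batch_size n.-1 coin_den prob kappa
    prob01 kap01 inflation theta window inflation_ge1 M_lam th0 window_correction C2
    increment half_slack (inflation * X) moments increment_gt0 (erefl _) kappa_half
    profile_increment prob_le moments_prob_lt ts (leqnn _) hN cover_prob (expR 1) decay
    new_degree deg_moments hp (expR_ge0 _) (expR_ge0 _) hm deg_moments_lt lll_condition).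
by exists E'; split=> //; apply: batch_size_le.
Qed.

End Degree.

End Constants.

(** [D] is tied to the real variable by [L = ln D%:R], so that the finitely many conditions on L can
    be collected with [for_large]. *)
Lemma large_degree_step (R : realType) (k : nat) (eta : R) :
  (3 <= k)%N -> 0 < eta -> eta <= 1 / 10 ->
  for_large (fun L : R => forall D : nat, L = ln D%:R ->
    forall (V : finType) (E : {set {set V}}),
    uniform k E -> linear_hypergraph E -> (max_degree E <= D)%N ->
    exists (m : nat) (E' : {set {set V}}),
      [/\ uniform k E', linear_hypergraph E', (max_degree E')%:R < new_degree k eta D,
          m%:R <= eta * (1 + eta) / density R k D & forall q, colorable E' q -> colorable E (m + q)]).
Proof.
move=> hk eta_gt0 eta_le; pose kr : R := k%:R.
have k0 : 0 <= kr by []. have a0 := alpha_gt0 R hk.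
have g0 := increment_gt0 hk eta_gt0; have d0 := delta_gt0 eta_gt0; have e0 := half_slack_gt0 R hk.
have z0 := zeta_gt0 R hk; have s0 : 0 < eta ^+ 2 by apply: exprn_gt0.
have [L0 H] : for_large (fun L : R => (1 <= L) /\ (increment k eta / (delta eta * alpha R k) <= L) /\
  (64 * kr ^+ 2 * (1 + L) ^+ 3 * expR (- (alpha R k * L)) <= 1) /\
  (32 * kr ^+ 3 * expR (2 * kr) * (1 + L) ^+ k.+1 * expR (- (alpha R k / 8 * L)) <= 1) /\
  (2 / increment k eta * (1 + L) ^+ 1 * expR (- (alpha R k / 4 * L)) <= 1) /\
  (2 / (half_slack R k * increment k eta) * (1 + L) ^+ 2 * expR (- (alpha R k * L)) <= 1) /\
  (64 / (delta eta * increment k eta) * (1 + L) ^+ 1 * expR (- (zeta R k * half_slack R k / 4 * L)) <= 1) /\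
  (4 / delta eta * (1 + L) ^+ 1 * expR (- (alpha R k * L)) <= 1) /\
  (2 / eta ^+ 2 * (1 + L) ^+ 1 * expR (- (alpha R k * L)) <= 1) /\
  (kr * (1 + L) ^+ 4 * expR (- (alpha R k * L)) <= 1) /\
  (4 * kr ^+ 2 * (1 + L) ^+ 7 * expR (- (alpha R k * L)) <= 1) /\
  (2 ^+ k / eta ^+ 2 * (1 + L) ^+ 3 * expR (- (1 * L)) <= 1) /\
  8 * (4 * kr / increment k eta + 3) / eta ^+ 2 <= L).
  do 12! (apply: for_large_and; first by
    (exact: for_large_ge || (apply: for_large_poly_exp;
      repeat first [done | by apply: ltW | apply: mulr_ge0 | apply: exprn_ge0
        | apply: expR_ge0 | rewrite invr_ge0 | apply: mulr_gt0 | rewrite invr_gt0]))).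
  exact: for_large_ge.
exists L0 => L LL0 D LD V E unif lin degE; subst L.
have [l1 [f0 [f1 [f2 [f3 [f4 [f5 [f6 [f7 [f8 [f9 [f10 f11]]]]]]]]]]]] := H _ LL0.
have D0 : (0 < D)%N.
  by rewrite lt0n; apply: contraTneq l1 => ->; rewrite ln0 // ler10.
apply: (@degree_step R k eta hk eta_gt0 eta_le D D0 l1) => //.
- by rewrite ler_pdivrMr in f0; [rewrite mulrA mulrC | rewrite mulr_gt0].
- by rewrite [X in - X]mulrAC.
- by rewrite [X in - X]mulrAC.
- by rewrite -[X in - X]mul1r.
Qed.

(** * Iteration over the degree *)

Section Iteration.
Variables (R : realType) (k : nat) (eta l : R).
Hypothesis hk : (3 <= k)%N.
Hypothesis eta_gt0 : 0 < eta.
Hypothesis eta_le : eta <= 1 / 10.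
Local Notation nroot := (nroot k.-1).
Local Notation lo := ((1 - eta) * l).
Hypothesis lo_ge1 : 1 <= lo.
Hypothesis large : forall D : nat, lo <= ln (D%:R : R) ->
    forall (V : finType) (E : {set {set V}}),
    uniform k E -> linear_hypergraph E -> (max_degree E <= D)%N ->
    exists (m : nat) (E' : {set {set V}}),
      [/\ uniform k E', linear_hypergraph E', (max_degree E')%:R < new_degree k eta D,
          m%:R <= eta * (1 + eta) / density R k D & forall q, colorable E' q -> colorable E (m + q)].

Let k1_gt0 : (0 < k.-1)%N. Proof. by case: k hk => [|[|]]. Qed.
Let lo_gt0 : 0 < lo.
Proof. exact: lt_le_trans lo_ge1. Qed.

(** 9k instead of 8k absorbs the rounding up of the number of colours. *)
Definition base : R := 9 * k%:R * expR (lo / (k.-1)%:R).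
(** Fixed point of the recursion: since shrink = 1 - eta (1 - 2 eta), adding eta (1 + eta) to shrink
    times (1 + eta) / (1 - 2 eta) gives the latter back. The logarithm is frozen at its smallest
    value [lo]. *)
Definition slope : R := (1 + eta) / (1 - 2 * eta) / nroot (alpha R k * lo).

Lemma base_coloring D (V : finType) (E : {set {set V}}) :
  ln D%:R < lo -> uniform k E -> (max_degree E <= D)%N ->
  exists2 q : nat, colorable E q & q%:R <= base.
Proof.
move=> Dlo unif degE; set z := expR (lo / (k.-1)%:R).
have z1 : 1 <= z.
  have : 0 <= lo / (k.-1)%:R by rewrite divr_ge0 // ltW.
  by move=> h; apply: le_trans (expR_ge1Dx _); rewrite lerDl.
have k3 : 3 <= k%:R :> R by rewrite ler_nat.
have zk : z ^+ k.-1 = expR lo.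
  by rewrite /z -expRM_natl mulrC divfK // pnatr_eq0 -lt0n.
have Dz : D%:R <= z ^+ k.-1.
  rewrite zk; case: (posnP D) => [->|D0]; first exact: expR_ge0.
  by rewrite -[D%:R]lnK ?posrE ?ltr0n // ler_expR ltW.
have kz0 : 0 <= 8 * k%:R * z by rewrite !mulr_ge0 ?expR_ge0.
have /andP[q1 q2] := truncn_itv kz0.
exists (Num.truncn (8 * k%:R * z)).+1.
  apply: (uniform_coloring (ltnW hk) unif degE).
  rewrite -(ler_nat R) natrM -[(k * D).+1%:R]natr1 natrM natrX.
  apply: (@le_trans _ _ ((8 * k%:R * z) ^+ k.-1)); last first.
    by apply: lerXn2r; rewrite ?nnegrE // ltW.
  rewrite exprMn; set Z := z ^+ k.-1 in Dz *.
  have Z1 : 1 <= Z by apply: exprn_ege1.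
  apply: (@le_trans _ _ (8 * k%:R * Z)).
    have h1 : k%:R * D%:R <= k%:R * Z by rewrite ler_wpM2l.
    have h2 : 1 * 1 <= k%:R * Z by apply: ler_pM => //; lra.
    lra.
  rewrite ler_wpM2r //; first by rewrite (le_trans ler01).
  by rewrite -[leLHS]expr1; apply: ler_weXn2l => //; lra.
rewrite -natr1 /base -/z.
have : 3 * 1 <= k%:R * z by apply: ler_pM.
lra.
Qed.

(** Strong induction on the degree bound: after a batch the maximum degree itself, which is strictly
    smaller, becomes the new bound. *)
Lemma iterate_coloring D (V : finType) (E : {set {set V}}) :
  uniform k E -> linear_hypergraph E -> (max_degree E <= D)%N ->
  exists2 q : nat, colorable E q & q%:R <= slope * nroot D%:R + base.
Proof.
have e0 := eta_gt0; have el := eta_le; have a0 := alpha_gt0 R hk.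
have y0 : 0 < nroot (alpha R k * lo) by apply: powR_gt0; apply: mulr_gt0.
have t0 : 0 < 1 - 2 * eta by lra.
have s0 : 0 <= slope.
  by apply: divr_ge0 (ltW y0); apply: divr_ge0; lra.
elim/ltn_ind: D V E => D IH V E unif lin degE.
have [small|big] := ltP (ln D%:R) lo.
  have [q qc qb] := base_coloring small unif degE.
  by exists q => //; apply: le_trans qb _; rewrite lerDr mulr_ge0 ?nroot_ge0.
have [m [E' [unif' lin' deg' mb colE']]] := large big unif lin degE.
have D0 : (0 < D)%N.
  rewrite lt0n; apply: contraTneq big => ->; rewrite ln0 // -ltNge; exact: lo_gt0.
have D0R : 0 < D%:R :> R by rewrite ltr0n.
have /andP[tau0 tau1] := shrink_bounds eta_gt0 eta_le.
have tau0' : 0 <= shrink eta by apply: le_trans tau0.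
have ltD : (max_degree E' < D)%N.
  rewrite -(ltr_nat R); apply: lt_le_trans deg' _.
  by rewrite /new_degree ler_piMl // exprn_ile1.
have [q qc qb] := IH _ ltD V E' unif' lin' (leqnn _).
exists (m + q)%N; first exact: colE'.
have q1 : nroot (max_degree E')%:R <= shrink eta * nroot D%:R.
  rewrite -[shrink eta](nrootX k1_gt0) // -nrootM ?exprn_ge0 //; apply: nroot_le => //.
  exact: ltW.
have m1 : m%:R <= eta * (1 + eta) / nroot (alpha R k * lo) * nroot D%:R.
  have x0 := density_gt0 hk D0 (le_trans lo_ge1 big).
  apply: le_trans mb _; rewrite -[leRHS]mulrA; apply: ler_wpM2l.
    by apply: mulr_ge0; lra.
  have lD0 : 0 <= ln D%:R :> R by apply: le_trans big; apply: ltW.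
  have xD : nroot D%:R * density R k D = nroot (alpha R k * ln D%:R).
    rewrite /density -nrootM //; last by apply: divr_ge0 => //; apply: mulr_ge0 (ltW a0) lD0.
    by rewrite mulrC divfK ?gt_eqF.
  rewrite ler_pdivlMl // ler_pdivrMr // xD; apply: nroot_le.
    exact: mulr_ge0 (ltW a0) (ltW lo_gt0).
  exact: ler_wpM2l (ltW a0) _ _ big.
rewrite natrD; apply: le_trans (lerD m1 qb) _; rewrite addrA lerD2r.
have h1 := ler_wpM2l s0 q1; apply: le_trans (lerD (lexx _) h1) _.

rewrite [slope * (_ * _)]mulrA -mulrDl ler_wpM2r ?nroot_ge0 // /slope.
have -> : (1 + eta) / (1 - 2 * eta) / nroot (alpha R k * lo) * shrink eta =
  ((1 + eta) / (1 - 2 * eta) * shrink eta) / nroot (alpha R k * lo) by rewrite mulrAC.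
rewrite -mulrDl ler_wpM2r ?invr_ge0 ?(ltW y0) // le_eqVlt; apply/orP; left; apply/eqP.
by rewrite /shrink; field; rewrite gt_eqF.
Qed.

End Iteration.

Theorem corollary1p7 (R : realType) (k : nat) (eps : R)
    (hk : (3 <= k)%N) (heps : 0 < eps) :
  exists Delta0 : nat, forall Delta : nat, (Delta0 <= Delta)%N ->
  forall (V : finType) (E : {set {set V}}),
    uniform k E -> linear_hypergraph E -> (max_degree E <= Delta)%N ->
    (chromatic_number E)%:R <=
      (1 + eps) *
      ((4 * k%:R - 5) * (k%:R - 1) / (k%:R - 2) * (Delta%:R / ln Delta%:R))
        `^ (1 / (k%:R - 1)).
Proof.
have k1_gt0 : (0 < k.-1)%N by case: k hk => [|[|]].
have k1E : (k.-1)%:R = k%:R - 1 :> R by rewrite -subn1 natrB // (leq_trans _ hk).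
have k3 : 3 <= k%:R :> R by rewrite ler_nat.
have a0 := alpha_gt0 R hk; have a1 := alpha_le1 R hk.
pose eta : R := Num.min (1 / 10) (eps / 7).
have e0 : 0 < eta by rewrite lt_min !divr_gt0.
have el : eta <= 1 / 10 by rewrite ge_min lexx.
have ee : 7 * eta <= eps.
  have : eta <= eps / 7 by rewrite ge_min lexx orbT.
  lra.
clearbody eta.
have [L0 H] := large_degree_step hk e0 el.
(* [2 * L0 <= l] keeps (1 - eta) l, which is at least l / 2, above [L0], so that every batch meets a
   large enough degree. *)
have [L1 H1] : for_large (fun l : R => 2 * L0 <= l /\ 2 <= l /\
    9 * k%:R / eta * (1 + l) ^+ 1 * expR (- (eta / (k.-1)%:R * l)) <= 1).
  do 2! (apply: for_large_and; first exact: for_large_ge).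
  apply: for_large_poly_exp; last by rewrite divr_gt0 // ltr0n.
  by rewrite divr_ge0 ?mulr_ge0 // ltW.
exists (Num.truncn (expR L1)).+1 => Delta hD V E unif lin degE.
have D0 : (0 < Delta)%N by apply: leq_ltn_trans hD.
have D0R : 0 < Delta%:R :> R by rewrite ltr0n.
pose l : R := ln Delta%:R.
have lL1 : L1 <= l.
  rewrite -ler_expR lnK ?posrE //.
  have /andP[_ /ltW h] := truncn_itv (expR_ge0 L1); apply: le_trans h _.
  by rewrite ler_nat.
have [l0 [l2 hB]] := H1 _ lL1.
have lo_ge : l / 2 <= (1 - eta) * l.
  by rewrite mulrC ler_wpM2r //; lra.
have lo1 : 1 <= (1 - eta) * l by lra.
have lo0 : L0 <= (1 - eta) * l by lra.
have [q qc qb] := iterate_coloring hk e0 el lo1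
  (fun D hl => H _ (le_trans lo0 hl) D erefl) unif lin degE.
have [_ /(_ q qc) chq] : colorable E (chromatic_number E) /\
    (forall q : nat, colorable E q -> (chromatic_number E <= q)%N).
  by apply: chromatic_numberP => e /unif ->; apply: ltnW.
apply: (@le_trans _ _ q%:R); first by rewrite ler_nat.
apply: le_trans qb _.
have lgt0 : 0 < l by lra.
have -> : (4 * k%:R - 5) * (k%:R - 1) / (k%:R - 2) * (Delta%:R / ln Delta%:R) =
    Delta%:R / (alpha R k * l).
  rewrite /alpha -/l; field.
  by repeat (apply/andP; split); apply/eqP; lra.
rewrite -k1E -[_ `^ _]/(nroot k.-1 _).
set W := nroot k.-1 (Delta%:R / (alpha R k * l)).
have al0 : 0 < alpha R k * l by apply: mulr_gt0.
have W0 : 0 <= W by apply: nroot_ge0.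
have c0 : 0 < 1 - eta by lra.
have hs : nroot k.-1 Delta%:R / nroot k.-1 (alpha R k * ((1 - eta) * l)) <= W / (1 - eta).
  have y0 : 0 < nroot k.-1 (alpha R k * l) by apply: powR_gt0.
  have -> : W = nroot k.-1 Delta%:R / nroot k.-1 (alpha R k * l).
    rewrite /W; apply: (canRL (mulfK (lt0r_neq0 y0))).
    by rewrite -nrootM ?divfK ?gt_eqF // ?divr_ge0 // ltW.
  rewrite -[leRHS]mulrA; apply: ler_wpM2l; first exact: nroot_ge0.
  rewrite -invfM lef_pV2 ?posrE.
  - rewrite [leLHS]mulrC [alpha R k * (_ * _)]mulrCA; apply: nroot_scale => //; last exact: ltW.
    by apply/andP; split; lra.
  - by apply: powR_gt0; apply: mulr_gt0 => //; apply: mulr_gt0.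
  - exact: mulr_gt0.
(* Stopping at degree Delta^(1 - eta) saves the factor Delta^(-eta / (k - 1)), which beats the 1 + l
   lost in comparing the root of Delta with [W]. *)
have hb : base k eta l <= eta * W.
  have hW : expR (l / (k.-1)%:R) <= W * (1 + l).
    have -> : expR (l / (k.-1)%:R) = W * nroot k.-1 (alpha R k * l).
      by rewrite -nrootM ?divfK ?gt_eqF // ?divr_ge0 // ?(ltW al0) // -nroot_exp lnK ?posrE.
    rewrite ler_wpM2l //; apply: le_trans (nroot_le1D k1_gt0 (ltW al0)) _.
    by rewrite lerD2l ler_piMl // ltW.
  rewrite /base.
  have -> : (1 - eta) * l / (k.-1)%:R = - (eta / (k.-1)%:R * l) + l / (k.-1)%:R.
    by field; rewrite pnatr_eq0 -lt0n.
  rewrite expRD mulrA.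
  have b0 : 0 <= 9 * k%:R * expR (- (eta / (k.-1)%:R * l)) :> R by rewrite !mulr_ge0 ?expR_ge0.
  apply: le_trans (ler_wpM2l b0 hW) _.
  have hB2 : 9 * k%:R * expR (- (eta / (k.-1)%:R * l)) * (1 + l) <= eta.
    move: hB; rewrite expr1.
    have -> : 9 * k%:R / eta * (1 + l) * expR (- (eta / (k.-1)%:R * l)) =
      9 * k%:R * expR (- (eta / (k.-1)%:R * l)) * (1 + l) / eta by ring.
    by rewrite ler_pdivrMr // mul1r.
  by rewrite mulrCA [leRHS]mulrC; apply: ler_wpM2l.
have hS : slope k eta l * nroot k.-1 Delta%:R <= (1 + 6 * eta) * W.
  rewrite /slope -mulrA [_^-1 * _]mulrC.
  have c1 : 0 <= (1 + eta) / (1 - 2 * eta) by rewrite divr_ge0 //; lra.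
  apply: le_trans (ler_wpM2l c1 hs) _.
  rewrite mulrCA mulrC ler_wpM2r // -mulrA -invfM ler_pdivrMr; last by apply: mulr_gt0; lra.
  have h1 : eta * eta <= 1 / 10 * eta by rewrite ler_wpM2r // ltW.
  have h2 : 0 <= eta * eta * eta by rewrite !mulr_ge0 // ltW.
  lra.
apply: le_trans (lerD hS hb) _; rewrite -mulrDl ler_wpM2r //; lra.
Qed.
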